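(* Fix any real numbers $z \geq 0$ and $r \geq 0$. For a positive integer $m$ let $\omega(m)$ denote the number of distinct prime divisors of $m$, let $p_1(m)<p_2(m)<\dots<p_{\omega(m)}(m)$ be the distinct prime divisors of $m$ in increasing order, and let \[\omega_z(m) := \#\left\{1\leq i < \omega(m) : \log \log p_{i+1}(m) - \log \log p_i(m) > z\right\}.\] Then \[ \frac{1}{n} \sum_{m\in \mathbb{N} \cap [1,n]} \left(\omega_z(m) - \frac{ \log \log n }{ \mathrm{e}^z} \right)^r =\mu_r \left((1-2 z\mathrm{e}^{-z} ) \mathrm{e}^{-z} \log \log n\right)^{r/2} (1+o(1)) , \text{ as } n\to+\infty,\] where $\mu_r$ is the $r$-th moment of the standard normal distribution.
   Formalization: The right side is read as (μ_r + o(1)) times the power, since for odd integers r, where μ_r = 0, the literal μ_r(1+o(1)) form fails (e.g. z=0, r=1); for non-integer r, powers of negative numbers, also in μ_r, are principal complex powers. *)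

(* Defs.v *)
From HB Require Import structures.
From mathcomp Require Import all_boot all_order all_algebra.
From mathcomp Require Import all_classical all_reals all_analysis.
From mathcomp Require Import complex.

Set Implicit Arguments.
Unset Strict Implicit.
Unset Printing Implicit Defensive.

Import Order.TTheory GRing.Theory Num.Theory.
Import numFieldNormedType.Exports.

Local Open Scope ring_scope.
Local Open Scope complex_scope.

Definition omega (m : nat) : nat := size (primes m).

(* 1-based: [prime_divisor m i] is p_i(m) for 1 <= i <= omega m. *)
Definition prime_divisor (m i : nat) : nat := nth 0%N (primes m) i.-1.

Definition loglog {R : realType} (k : nat) : R := ln (ln k%:R).

Definition omega_gap {R : realType} (z : R) (m : nat) : nat :=
  #|[set i : 'I_(omega m) | (1 <= i)%N &&
      (z < loglog (prime_divisor m i.+1) - loglog (prime_divisor m i))]|.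

(* The value x ^ r = exp (r Log x) for the principal branch of Log, so that
   Log x = ln |x| + i pi for x < 0, with 0 ^ 0 = 1 and 0 ^ r = 0 for r > 0.
   It is the usual power when x >= 0 or r is a natural number (rpowCn). *)
Definition rpowC {R : realType} (x r : R) : R[i] :=
  let theta := if x < 0 then r * pi else 0 in
  (`|x| `^ r)%:C * (cos theta +i* sin theta).

Lemma rpowCn {R : realType} (x : R) (n : nat) : rpowC x n%:R = (x ^+ n)%:C.
Proof.
rewrite /rpowC powR_mulrn //; case: ltP => x0; last first.
  by rewrite cos0 sin0 ger0_norm // -[_ +i* _]/(1 : R[i]) mulr1.
have -> : cos (n%:R * pi) +i* sin (n%:R * pi) = ((-1) ^+ n : R)%:C.
  elim: n => [|n]; first by rewrite mul0r cos0 sin0 expr0.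
  case=> hc hs; rewrite -natr1 mulrDl mul1r (sinD (n%:R * pi)) cosD cospi sinpi hc hs.
  by rewrite !mul0r !mulr0 addr0 subr0 mulrC -exprS.
by rewrite ltr0_norm // -[LHS](rmorphM (real_complex R)) /= -exprMn mulrN1 opprK.
Qed.

(* The complex expectation E[X ^ r] of a standard normal X, taken
   componentwise.  normal_prob takes the standard deviation, not the variance. *)
Definition normal_moment {R : realType} (r : R) : R[i] :=
  fine 'E_(normal_prob (0 : R) 1)[fun x => complex.Re (rpowC x r)] +i*
  fine 'E_(normal_prob (0 : R) 1)[fun x => complex.Im (rpowC x r)].

(* Main.v *)
(** Method of moment generating functions.

    Replace divisibility of a uniform [m <= n] by the primes up to a level [y]
    by independent events of probability [1/p].  Reading the primes in
    increasing order, the generating function [E exp (eta * omega_z)] satisfies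
    a linear recursion with delay: a prime [k] that divides [m] counts when none of
    the next primes [j] with [loglog j <= loglog k + z] does.  By Mertens' theorem
    such a window has total weight [z] and is empty with probability [exp (- z)],
    both up to [O(1 / log k)], so the generating function equals
    [exp (s * loglog y) * (1 + O(eta^3 * loglog y + eta))] with
    [s = exp (- z) * eta + (1 - 2 z exp (- z)) * exp (- z) * eta^2 / 2].

    The model is transferred to the integers up to [n] by expanding over
    squarefree divisors and by bounding the prime divisors beyond [y] through
    Rankin's trick; with [eta] of order [(loglog n)^(-1/2)] every moment generating
    function of the normalised [omega_z] converges to that of the standard normal law.

    Convergence for all real arguments gives convergence of the mean of every
    continuous function of exponential growth: truncate with an exponential
    weight, approximate by trigonometric polynomials (Bernstein polynomials in a sine),
    and compare the sines with their Taylor polynomials.  The real and imaginary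
    parts of [x |-> x ^ r] are such functions. *)
Require Import Defs.
From mathcomp Require Import all_boot all_order all_algebra.
From mathcomp Require Import all_classical all_reals all_analysis.
From mathcomp Require Import complex ring lra zify measurable_realfun.
Import Order.TTheory GRing.Theory Num.Theory.
Import numFieldNormedType.Exports.
Local Open Scope classical_set_scope.
Local Open Scope ring_scope.
Local Open Scope complex_scope.

(** * Mertens' theorem *)

(** The exponent [s] comes from the delay equation. If the generating function over the primes from
    k to y behaves like exp (s w), with w the total weight of these primes, then a prime at k
    changes it at the rate (exp eta - 1) exp (- z) times its value at the end of the window, where
    only the weight w - z remains. Hence s = (exp eta - 1) exp (- z) exp (- s z). Solving this to
    second order in eta yields the factor 1 - 2 z exp (- z): a counted prime is followed by a window
    without primes, which lowers the variance below the Poisson value exp (- z) loglog n.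

    The recursion has about y steps, yet its error must stay O(eta^3 loglog y + eta). So errors are
    not compounded step by step: the total variation of the normalised generating function is
    bounded in terms of itself.

    The level y balances two demands. The transfer error wants ln n / ln y to be a large multiple of
    loglog n; the primes beyond y are negligible only if loglog n - loglog y is o((loglog n)^(1/2)).
    With ln y of order ln n / loglog n the difference is of order ln (loglog n). *)

Lemma prod_primes_dvd (s : seq nat) (N : nat) :
  uniq s -> all prime s -> all (fun p => p %| N)%N s -> (\prod_(p <- s) p %| N)%N.
Proof.
elim: s => [|p s IH] /=; first by rewrite big_nil dvd1n.
move=> /andP[ps us] /andP[pp ps'] /andP[pN sN]; rewrite big_cons Gauss_dvd.
  by rewrite pN IH.
rewrite big_seq; apply: (big_ind (fun d => coprime p d)); first exact: coprimen1.
  by move=> x y px py; rewrite coprimeMr px py.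
move=> q qs; rewrite prime_coprime // dvdn_prime2 // ?(allP ps') //.
by apply: contra ps => /eqP ->.
Qed.

Lemma prime_dvd_central_bin (n p : nat) :
  prime p -> (n < p <= n.*2)%N -> (p %| 'C(n.*2, n))%N.
Proof.
move=> pp /andP[np pn].
have h : (p %| (n.*2)`!)%N by rewrite dvdn_fact // pn prime_gt0.
have nf : ~~ (p %| n`!)%N.
  have : coprime p n`!; last by rewrite prime_coprime.
  elim: n np {pn h} => [|n IH] np; first by rewrite fact0 coprimen1.
  rewrite factS coprimeMr IH ?andbT ?(ltnW np)//.
  by rewrite prime_coprime // gtnNdvd.
have := bin_fact (leq_addr n n); rewrite addnn -{2}addnn addnK => e.
by move: h; rewrite -e !Euclid_dvdM // (negbTE nf) !orbF.
Qed.

Lemma central_bin_le (n : nat) : ('C(n.*2, n) <= 4 ^ n)%N.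
Proof.
have -> : (4 ^ n = 2 ^ n.*2)%N by rewrite -mul2n expnM.
rewrite (_ : 2 = 1 + 1)%N // expnDn -addnn.
have lt : (n < (n + n).+1)%N by rewrite ltnS leq_addr.
by rewrite (bigD1 (Ordinal lt)) //= !exp1n !muln1 leq_addr.
Qed.

Lemma ln_prod_nat {R : realType} (s : seq nat) : all (ltn 0) s ->
  ln (\prod_(p <- s) p)%:R = \sum_(p <- s) ln p%:R :> R.
Proof.
elim: s => [|p s IH]; first by rewrite !big_nil ln1.
move=> /= /andP[p0 s0]; rewrite !big_cons natrM lnM ?IH ?posrE ?ltr0n //.
by rewrite big_seq; elim/big_ind: _ => // [x y|i /(allP s0)//]; rewrite muln_gt0 => -> ->.
Qed.

Definition theta {R : realType} (n : nat) : R :=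
  \sum_(0 <= p < n.+1 | prime p) ln p%:R.

(** The product of the primes in (n, 2n] divides the central binomial coefficient, which is at most
    4^n. *)
Lemma theta_double {R : realType} (n : nat) :
  theta n.*2 <= theta n + n%:R * ln 4 :> R.
Proof.
have le : (n.+1 <= n.*2.+1)%N by rewrite ltnS -addnn leq_addr.
rewrite /theta (@big_cat_nat _ _ _ n.+1 0 n.*2.+1)//= lerD2l -big_filter.
set s := [seq _ <- _ | _].
have us : uniq s by rewrite filter_uniq // iota_uniq.
have ps : all prime s by apply/allP => p; rewrite mem_filter => /andP[].
rewrite -ln_prod_nat; last by apply: sub_all ps => p /prime_gt0.
rewrite mulr_natl -lnXn ?ltr0n// ler_ln ?posrE ?exprn_gt0 ?ltr0n//; last first.
  rewrite big_seq; elim/big_ind: _ => // [x y|i /(allP ps)/prime_gt0//].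
  by rewrite muln_gt0 => -> ->.
rewrite -natrX ler_nat; apply: leq_trans (central_bin_le n).
apply: dvdn_leq; first by rewrite bin_gt0 -addnn leq_addr.
apply: prod_primes_dvd => //; apply/allP => p; rewrite mem_filter => /andP[pp].
by rewrite mem_index_iota ltnS => h; exact: prime_dvd_central_bin.
Qed.

Lemma theta_mono {R : realType} (m n : nat) : (m <= n)%N -> theta m <= theta n :> R.
Proof.
move=> mn; rewrite /theta (@big_cat_nat _ _ _ m.+1 0 n.+1)//= lerDl.
by apply: sumr_ge0 => p pp; rewrite ln_ge0 // ler1n prime_gt0.
Qed.

Lemma theta_le {R : realType} (n : nat) : theta n <= 3 * ln 4 * n%:R :> R.
Proof.
have l4 : 0 <= ln 4 :> R by rewrite ln_ge0 // ler1n.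
elim/ltn_ind: n => n IH; case: (leqP n 1) => n1.
  rewrite /theta big1_seq ?mulr_ge0 // => p /andP[pp]; rewrite mem_index_iota => /andP[_ pn].
  by have := prime_gt1 pp; lia.
(* Exact halving would need only the constant 1 in place of 3; the slack pays for rounding n / 2
   up. *)
have h : (uphalf n < n)%N by lia.
have le : (n <= (uphalf n).*2)%N by lia.
apply: le_trans (theta_mono _ _ le) _; apply: le_trans (theta_double _) _.
apply: le_trans (lerD (IH _ h) (lexx _)) _.
have : (3 * (uphalf n)%:R + (uphalf n)%:R <= 3 * n%:R :> R).
  by rewrite -!natrM -natrD ler_nat; lia.
by move=> h2; have := ler_wpM2l l4 h2; lra.
Qed.

Lemma ln_factE {R : realType} (n : nat) :
  ln (n`!)%:R = \sum_(0 <= p < n.+1 | prime p) (logn p n`!)%:R * ln p%:R :> R.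
Proof.
have n0 : (0 < n`!)%N by rewrite fact_gt0.
have le : (n <= n`!)%N.
  by case: n {n0} => // n; rewrite factS leq_pmulr // fact_gt0.
rewrite -[X in ln X%:R](partnT n0) /partn (eq_bigl xpredT) //.
have -> : (\prod_(0 <= p < (n`!).+1) p ^ logn p n`! =
    \prod_(p <- [seq (p ^ logn p n`!)%N | p <- index_iota 0 (n`!).+1]) p)%N.
  by rewrite big_map.
rewrite ln_prod_nat; last first.
  apply/allP => _ /mapP[p _ ->] /=; case: p => [|p]; last by rewrite expn_gt0.
  by rewrite lognE.
rewrite big_map (@big_cat_nat _ _ _ n.+1 0 (n`!).+1)//= [X in _ + X]big1_seq ?addr0.
  rewrite [RHS]big_mkcond /=; apply: eq_big_nat => p _.
  case: ifPn => pp; last by rewrite lognE (negbTE pp) ln1.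
  by rewrite natrX lnXn ?ltr0n ?prime_gt0// mulr_natl.
move=> p; rewrite mem_index_iota => /andP[_ /andP[np _]].
rewrite lognE; case: and3P => [[pp _]|]; last by rewrite ln1.
move=> h; exfalso; move: h; apply/negP.
have : coprime p n`!; last by rewrite prime_coprime.
elim: n np {n0 le} => [|n IH] np; first by rewrite fact0 coprimen1.
rewrite factS coprimeMr IH ?andbT ?(ltnW np)//.
by rewrite prime_coprime // gtnNdvd.
Qed.

Lemma ln_fact_le {R : realType} (n : nat) : ln (n`!)%:R <= n%:R * ln n%:R :> R.
Proof.
case: n => [|n]; first by rewrite fact0 ln1 mul0r.
rewrite mulr_natl -lnXn ?ltr0n// ler_ln ?posrE ?ltr0n ?exprn_gt0 ?ltr0n ?fact_gt0//.
rewrite -natrX ler_nat; move: n.+1 => N.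
suff h m : (m <= N)%N -> (m`! <= N ^ m)%N by exact: h.
elim: m => // m IH mN; by rewrite factS expnS leq_mul // IH // ltnW.
Qed.

(** The single term n^n / n! of the exponential series is at most exp n. *)
Lemma ln_fact_ge {R : realType} (n : nat) : n%:R * ln n%:R - n%:R <= ln (n`!)%:R :> R.
Proof.
case: n => [|n]; first by rewrite fact0 ln1 !mul0r subr0.
have f0 : 0 < (n.+1)`!%:R :> R by rewrite ltr0n fact_gt0.
have h : n.+1%:R ^+ n.+1 / (n.+1)`!%:R <= expR n.+1%:R :> R.
  by apply: le_trans (expR_ge1Dxn n (ler0n R n.+1)); rewrite lerDr ler01.
rewrite lerBlDr mulr_natl -lnXn ?ltr0n//.
rewrite -[X in _ <= _ + X]expRK -lnM ?posrE ?expR_gt0 ?f0 //.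
rewrite ler_ln ?posrE ?mulr_gt0 ?expR_gt0 ?exprn_gt0 ?ltr0n ?fact_gt0//.
by rewrite -ler_pdivrMl // mulrC.
Qed.

Definition mertens_sum {R : realType} (n : nat) : R :=
  \sum_(0 <= p < n.+1 | prime p) ln p%:R / p%:R.

(** The exponent of p in n! is at least n / p - 1. Summed against ln p, the loss of 1 is the
    Chebyshev function, which is O(n). *)
Lemma mertens_sum_le {R : realType} (n : nat) : (0 < n)%N ->
  mertens_sum n <= ln n%:R + 3 * ln 4 :> R.
Proof.
move=> n0; have n0' : 0 < n%:R :> R by rewrite ltr0n.
have : n%:R * mertens_sum n - theta n <= ln (n`!)%:R :> R.
  rewrite ln_factE /mertens_sum /theta mulr_sumr -sumrB; apply: ler_sum => p pp.
  have p0 : 0 < p%:R :> R by rewrite ltr0n prime_gt0.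
  have l0 : 0 <= ln p%:R :> R by rewrite ln_ge0 // ler1n prime_gt0.
  have le : (n %/ p <= logn p n`!)%N.
    rewrite logn_fact // big_ltn // expn1 leq_addr //.
  have : n%:R / p%:R <= (logn p n`!)%:R + 1 :> R.
    rewrite ler_pdivrMr // natr1 -natrM ler_nat.
    by apply: ltnW; rewrite -ltn_divLR ?prime_gt0 // ltnS.
  move=> /(ler_wpM2r l0); rewrite mulrDl mul1r; lra.
have := @ln_fact_le R n; have := @theta_le R n => h1 h2 h3.
have : n%:R * mertens_sum n <= n%:R * (ln n%:R + 3 * ln 4) :> R by lra.
by rewrite ler_pM2l.
Qed.

Lemma ln_leB1 {R : realType} (x : R) : 0 < x -> ln x <= x - 1.
Proof. by move=> x0; have := @le_ln1Dx R (x - 1); rewrite (addrC 1) subrK; apply; lra. Qed.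

(** The bound is shaped for induction: (ln n + 2) / n exceeds (ln n + 1) / n, the integral of ln x /
    x^2 beyond n, and the excess covers the replacement of k^2 by k (k - 1). *)
Lemma sum_ln_pred_le {R : realType} (n : nat) : (0 < n)%N ->
  \sum_(2 <= k < n.+1) ln k%:R / (k%:R * (k%:R - 1)) <= 2 - (ln n%:R + 2) / n%:R :> R.
Proof.
elim: n => // n IH _; case: n IH => [|n] IH.
  by rewrite big_geq // ln1 add0r divr1 subrr.
rewrite big_nat_recr //=; apply: le_trans (lerD (IH isT) (lexx _)) _.
set a := n.+1%:R : R; have -> : n.+2%:R = a + 1 :> R by rewrite natr1.
have a1 : 1 <= a by rewrite ler1n.
move: a a1 => a a1 {IH}.
have h : a * (ln (a + 1) - ln a) <= 1.
  rewrite -ln_div ?posrE; try lra.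
  have a0 : 0 < a by lra.
  have h : ln ((a + 1) / a) <= (a + 1) / a - 1 by apply: ln_leB1; rewrite divr_gt0 //; lra.
  have := ler_wpM2l (ltW a0) h; rewrite (_ : a * ((a + 1) / a - 1) = 1) //.
  by field; lra.
have l2 : ln a <= ln (a + 1) by rewrite ler_ln ?posrE; lra.
rewrite -subr_ge0.
have -> : 2 - (ln (a + 1) + 2) / (a + 1) - (2 - (ln a + 2) / a + ln (a + 1) / ((a + 1) * (a + 1 - 1)))
  = (2 - a * (ln (a + 1) - ln a) - (ln (a+1) - ln a)) / (a * (a + 1)) by field; lra.
apply: divr_ge0; last by nra.
have : (ln (a+1) - ln a) <= a * (ln (a+1) - ln a) by nra.
lra.
Qed.

Lemma geometric_sum_le {R : realType} (x : R) (n : nat) : 0 <= x -> x < 1 ->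
  \sum_(1 <= k < n.+1) x ^+ k <= x / (1 - x).
Proof.
move=> x0 x1.
have -> : \sum_(1 <= k < n.+1) x ^+ k = (x - x ^+ n.+1) / (1 - x).
  elim: n => [|n IH]; first by rewrite big_geq // expr1 subrr mul0r.
  by rewrite big_nat_recr //= IH (exprS _ n.+1); field; lra.
by rewrite ler_pdivrMr ?subr_gt0 // divfK ?subr_eq0 ?gt_eqF // gerBl exprn_ge0.
Qed.

(** The exponent of p in n! is at most n / (p - 1) = n / p + n / (p (p - 1)). The excess contributes
    2 to the constant and the lower bound for ln n! contributes 1. *)
Lemma mertens_sum_ge {R : realType} (n : nat) : (0 < n)%N ->
  ln n%:R - 3 <= mertens_sum n :> R.
Proof.
move=> n0; have n0' : 0 < n%:R :> R by rewrite ltr0n.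
have : ln (n`!)%:R <= n%:R * mertens_sum n +
    n%:R * \sum_(2 <= k < n.+1) ln k%:R / (k%:R * (k%:R - 1)) :> R.
  have -> : \sum_(2 <= k < n.+1) ln k%:R / (k%:R * (k%:R - 1))
     = \sum_(0 <= k < n.+1) ln k%:R / (k%:R * (k%:R - 1)) :> R.
    rewrite (@big_cat_nat _ _ _ 2 0 n.+1)//= [X in _ = X + _]big_nat_recl //=.
    by rewrite big_nat1 ln1 mul0r mul0r invr0 mulr0 !add0r.
  apply: (@le_trans _ _ (n%:R * mertens_sum n +
    n%:R * \sum_(0 <= p < n.+1 | prime p) ln p%:R / (p%:R * (p%:R - 1)))); last first.
    rewrite lerD2l ler_pM2l // [leLHS]big_mkcond /=; apply: ler_sum => k _.
    case: ifP => // _; case: k => [|k]; first by rewrite mul0r invr0 mulr0.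
    apply: divr_ge0; first by rewrite ln_ge0 // ler1n.
    by rewrite mulr_ge0 // subr_ge0 ler1n.
  rewrite ln_factE /mertens_sum -mulrDr -big_split mulr_sumr /=; apply: ler_sum => p pp.
  have p1 : 1 < p%:R :> R by rewrite ltr1n prime_gt1.
  have l0 : 0 <= ln p%:R :> R by rewrite ln_ge0 // ler1n prime_gt0.
  have : (logn p n`!)%:R <= n%:R / (p%:R - 1) :> R.
    rewrite logn_fact // natr_sum.
    apply: (@le_trans _ _ (n%:R * \sum_(1 <= k < n.+1) (p%:R^-1) ^+ k)).
      rewrite mulr_sumr; apply: ler_sum => k _.
      rewrite exprVn ler_pdivlMr; last by apply: exprn_gt0; lra.
      by rewrite -natrX -natrM ler_nat leq_trunc_div.
    rewrite ler_pM2l // (_ : (p%:R - 1)^-1 = p%:R^-1 / (1 - p%:R^-1) :> R); last first.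
      by field; lra.
    by apply: geometric_sum_le; [rewrite invr_ge0; lra | rewrite invf_lt1; lra].
  move=> /(ler_wpM2r l0); set L := ln _; set N := n%:R; move=> h.
  apply: le_trans h _; rewrite le_eqVlt; apply/orP; left; apply/eqP.
  by field; lra.
have := @sum_ln_pred_le R n n0; have := @ln_fact_ge R n => h1 h2 h3.
have l0 : 0 <= ln n%:R :> R by rewrite ln_ge0 // ler1n.
have h4 : \sum_(2 <= k < n.+1) ln k%:R / (k%:R * (k%:R - 1)) <= 2 :> R.
  by apply: le_trans h2 _; rewrite gerBl divr_ge0 // addr_ge0.
have h5 := ler_wpM2l (ltW n0') h4.
have : n%:R * (ln n%:R - 3) <= n%:R * mertens_sum n :> R by lra.
by rewrite ler_pM2l.
Qed.

Lemma abel_sum_le {R : realType} (c r : nat -> R) (C : R) (m n : nat) : (m < n)%N ->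
  (forall k, (m <= k)%N -> `|r k| <= C) ->
  (forall k, (m < k)%N -> 0 <= c k) ->
  (forall k, (m < k)%N -> c k.+1 <= c k) ->
  `|\sum_(m.+1 <= k < n.+1) c k * (r k - r k.-1)| <= 2 * C * c m.+1.
Proof.
move=> mn hr c0 cd.
have C0 : 0 <= C by apply: le_trans (normr_ge0 _) (hr m _).
(* Strengthened for the induction on [n]: the boundary term of the summation by parts stays on the
   left, and its size is taken off the bound. *)
suff h : `|\sum_(m.+1 <= k < n.+1) c k * (r k - r k.-1) - c n * r n|
    <= C * (2 * c m.+1 - c n).
  have h2 : `|c n * r n| <= C * c n.
    by rewrite normrM ger0_norm ?c0// mulrC ler_wpM2r ?c0 ?hr // ltnW.
  rewrite -[X in `|X|](subrK (c n * r n)); apply: le_trans (ler_normD _ _) _; lra.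
elim: n mn => // n IH; rewrite ltnS leq_eqVlt => /orP[/eqP <-|mn].
  rewrite big_nat1 /= (_ : _ - _ = - (c m.+1 * r m)); last by ring.
  rewrite normrN normrM ger0_norm ?c0// mulrC.
  have := ler_wpM2r (c0 m.+1 (leqnn _)) (hr m (leqnn m)); lra.
rewrite big_nat_recr; last by lia.
have -> : \sum_(m.+1 <= i < n.+1) c i * (r i - r i.-1) + c n.+1 * (r n.+1 - r n.+1.-1)
  - c n.+1 * r n.+1 = (\sum_(m.+1 <= i < n.+1) c i * (r i - r i.-1) - c n * r n)
   + (c n - c n.+1) * r n by move=> /=; ring.
apply: le_trans (ler_normD _ _) _.
have := IH mn; have : `|(c n - c n.+1) * r n| <= (c n - c n.+1) * C.
  by rewrite normrM ger0_norm ?subr_ge0 ?cd// ler_wpM2l ?subr_ge0 ?cd ?hr // ltnW.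
lra.
Qed.

(* The weight [1/k] of a prime [k], and [0] at composites: sums over primes become
   sums over intervals of integers. *)
Definition pw {R : realType} (k : nat) : R := (prime k)%:R / k%:R.

Lemma pw_ge0 {R : realType} (k : nat) : 0 <= pw k :> R.
Proof. by rewrite divr_ge0. Qed.

Lemma pw_le {R : realType} (k : nat) : pw k <= k%:R^-1 :> R.
Proof. by rewrite /pw ler_piMl ?invr_ge0 // lern1 leq_b1. Qed.

Lemma pw_le1 {R : realType} (k : nat) : pw k <= 1 :> R.
Proof.
case: k => [|k]; first by rewrite /pw mul0r.
by apply: le_trans (pw_le _) _; rewrite invf_le1 ?ltr0n ?ler1n.
Qed.

Lemma pwE {R : realType} (k : nat) : (1 < k)%N ->
  pw k = (ln k%:R)^-1 * (mertens_sum k - mertens_sum k.-1) :> R.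
Proof.
move=> k1; case: k k1 => // k k1.
rewrite /mertens_sum big_mkcond big_nat_recr //= -big_mkcond /= (addrC (\sum_(0 <= p < k.+1 | prime p) _)) addrK /pw.
have : ln k.+1%:R != 0 :> R by rewrite gt_eqF // ln_gt0 // ltr1n.
by case: ifP => _ h; rewrite ?mul0r ?mulr0 // mulrA mulVf.
Qed.

Lemma mertens_error {R : realType} (k : nat) : (0 < k)%N ->
  `|mertens_sum k - ln k%:R| <= 3 + 3 * ln 4 :> R.
Proof.
move=> k0; have l4 : 0 <= ln 4 :> R by rewrite ln_ge0 // ler1n.
rewrite ler_norml; have := @mertens_sum_ge R k k0; have := @mertens_sum_le R k k0.
by move=> h1 h2; apply/andP; split; lra.
Qed.

Lemma lnS_sub_le1 {R : realType} (k : nat) : (0 < k)%N -> ln k.+1%:R - ln k%:R <= 1 :> R.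
Proof.
move=> k0; have k0' : 0 < k%:R :> R by rewrite ltr0n.
rewrite -ln_div ?posrE ?ltr0n // -natr1 mulrDl mulfV ?gt_eqF // mul1r.
apply: le_trans (le_ln1Dx _) _; last by rewrite invf_le1 // ler1n.
by apply: lt_trans (_ : 0 < _); rewrite ?invr_gt0 // ltrN10.
Qed.

Lemma ln_nat_gt0 {R : realType} (k : nat) : (1 < k)%N -> 0 < ln k%:R :> R.
Proof. by move=> k1; rewrite ln_gt0 // ltr1n. Qed.

Lemma ln_nat_le {R : realType} (j k : nat) : (0 < j)%N -> (j <= k)%N -> ln j%:R <= ln k%:R :> R.
Proof. by move=> j0 jk; rewrite ler_ln ?posrE ?ltr0n ?ler_nat // (leq_trans j0). Qed.

Lemma loglog_le {R : realType} (j k : nat) : (1 < j)%N -> (j <= k)%N -> loglog j <= loglog k :> R.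
Proof.
move=> j1 jk; rewrite /loglog ler_ln ?posrE ?ln_nat_gt0 //; last exact: leq_trans jk.
by rewrite ln_nat_le // ltnW.
Qed.

Lemma mertens_second {R : realType} : exists2 C : R, 0 < C & forall m n : nat,
  (1 < m)%N -> (m <= n)%N ->
  `|\sum_(m.+1 <= k < n.+1) pw k - (loglog n - loglog m)| <= C / ln m%:R.
Proof.
have l4 : 0 <= ln 4 :> R by rewrite ln_ge0 // ler1n.
exists (2 * (3 + 3 * ln 4) + 1); first by lra.
move=> m n m1; rewrite leq_eqVlt => /orP[/eqP <-|mn].
  rewrite big_geq // subrr subr0 normr0 divr_ge0 ?(ltW (ln_nat_gt0 _ _)) //; lra.
have lm := @ln_nat_gt0 R m m1.
pose r k : R := mertens_sum k - ln k%:R.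
pose c k : R := (ln k%:R)^-1.
have e1 : \sum_(m.+1 <= k < n.+1) pw k =
   \sum_(m.+1 <= k < n.+1) c k * (r k - r k.-1) +
   \sum_(m.+1 <= k < n.+1) c k * (ln k%:R - ln k.-1%:R).
  rewrite -big_split /=; apply: eq_big_nat => k /andP[mk _].
  by rewrite pwE; [rewrite /r /c; ring | lia].
have h1 : `|\sum_(m.+1 <= k < n.+1) c k * (r k - r k.-1)| <= 2 * (3 + 3 * ln 4) * c m.+1.
  apply: abel_sum_le => // k mk.
  - by apply: mertens_error; lia.
  - by rewrite invr_ge0 ltW // ln_nat_gt0 //; lia.
  - rewrite /c lef_pV2 ?posrE ?ln_nat_gt0 ?ln_nat_le//; lia.
have h2 : c m.+1 <= c m.
  by rewrite /c lef_pV2 ?posrE ?ln_nat_gt0 ?ln_nat_le//; lia.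
(* A Riemann sum of 1 / u at the right endpoints u = ln k. As the steps have length at most 1, the
   error of each step is at most the drop of 1 / u, and these drops telescope. *)
have h3 : loglog n - loglog m - (c m - c n) <=
   \sum_(m.+1 <= k < n.+1) c k * (ln k%:R - ln k.-1%:R) <= loglog n - loglog m.
  elim: n mn {e1 h1} => // n IH; rewrite ltnS => mn.
  rewrite big_nat_recr //=.
  have {IH} : loglog n - loglog m - (c m - c n) <=
   \sum_(m.+1 <= k < n.+1) c k * (ln k%:R - ln k.-1%:R) <= loglog n - loglog m.
    move: mn; rewrite leq_eqVlt => /orP[/eqP <-|/IH//].
    by rewrite big_geq // !subrr ?subr0 lexx.
  have a0 : 0 < ln n%:R :> R by rewrite ln_nat_gt0 //; lia.
  have b0 : 0 < ln n.+1%:R :> R by rewrite ln_nat_gt0 //; lia.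
  have ab : ln n.+1%:R - ln n%:R <= 1 :> R by apply: lnS_sub_le1; lia.
  have ab' : ln n%:R <= ln n.+1%:R :> R by apply: ln_nat_le; lia.
  rewrite /loglog /c; move: a0 b0 ab ab'; set a := ln n%:R; set b := ln n.+1%:R.
  move=> a0 b0 ab ab'.
  have k1 : b^-1 * (b - a) <= ln b - ln a.
    have := ln_leB1 _ (divr_gt0 a0 b0); rewrite ln_div ?posrE //.
    by rewrite (_ : b^-1 * (b - a) = 1 - a / b); [lra | field; lra].
  have k2 : ln b - ln a <= b^-1 * (b - a) + (a^-1 - b^-1).
    have := ln_leB1 _ (divr_gt0 b0 a0); rewrite ln_div ?posrE // => h'.
    apply: le_trans h' _; rewrite -subr_ge0.
    have -> : b^-1 * (b - a) + (a^-1 - b^-1) - (b / a - 1) = (b - a) * (1 - (b - a)) / (a * b).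
      by field; lra.
    by apply: divr_ge0; nra.
  move=> /andP[i1 i2]; apply/andP; split; lra.
have cn : 0 <= c n by rewrite invr_ge0 ltW // ln_nat_gt0 //; lia.
have C0 : 0 <= 2 * (3 + 3 * ln 4) :> R by lra.
have h4 := ler_wpM2l C0 h2.
rewrite e1 -/(c m) -addrA; apply: le_trans (ler_normD _ _) _.
have : `|\sum_(m.+1 <= k < n.+1) c k * (ln k%:R - ln k.-1%:R) - (loglog n - loglog m)| <= c m.
  by rewrite ler_norml; case/andP: h3 => ? ?; apply/andP; split; lra.
by lra.
Qed.

(** This is why errors of relative size 1 / ln k in the windows add up to O(1). The decomposition is
    that of [mertens_second], now with weight 1 / u^2, whose Riemann sum is bounded. *)
Lemma sum_pw_div_ln {R : realType} : exists2 C : R, 0 < C & forall n : nat,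
  \sum_(2 <= k < n.+1) pw k / ln k%:R <= C.
Proof.
have l4 : 0 <= ln 4 :> R by rewrite ln_ge0 // ler1n.
pose c k : R := (ln k%:R)^-1 ^+ 2.
pose K : R := pw 2 / ln 2%:R + (2 * (3 + 3 * ln 4) * c 3%N + (ln 2%:R)^-1).
have l2 : 0 < ln 2%:R :> R by apply: ln_nat_gt0.
have c3 : 0 <= c 3%N by rewrite exprn_ge0 // invr_ge0 ltW // ln_nat_gt0.
have K0 : 0 < K.
  rewrite /K; apply: ltr_wpDl; first by rewrite divr_ge0 ?pw_ge0 // ltW.
  by apply: ltr_wpDl; [apply: mulr_ge0 => //; lra | rewrite invr_gt0].
exists K => // n; case: (leqP n 1) => n1; first by rewrite big_geq ?(ltW K0).
rewrite big_ltn // lerD2l; case: (ltnP 2 n) => n2; last first.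
  rewrite big_geq // addr_ge0 ?invr_ge0 ?(ltW l2) // mulr_ge0 //; lra.
pose r k : R := mertens_sum k - ln k%:R.
have -> : \sum_(3 <= k < n.+1) pw k / ln k%:R =
   \sum_(3 <= k < n.+1) c k * (r k - r k.-1) +
   \sum_(3 <= k < n.+1) c k * (ln k%:R - ln k.-1%:R).
  rewrite -big_split /=; apply: eq_big_nat => k /andP[mk _].
  by rewrite pwE; [rewrite /r /c; ring | lia].
apply: lerD.
  apply: le_trans (ler_norm _) _; apply: (@abel_sum_le R c r) => // k mk.
  - by apply: mertens_error; lia.
  - by rewrite exprn_ge0 // invr_ge0 ltW // ln_nat_gt0 //; lia.
  - have k0 : 0 < ln k%:R :> R by rewrite ln_nat_gt0 //; lia.
    have k1 : 0 < ln k.+1%:R :> R by rewrite ln_nat_gt0 //; lia.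
    rewrite /c lerXn2r ?nnegrE ?invr_ge0 ?(ltW k0) ?(ltW k1) //.
    by rewrite lef_pV2 ?posrE ?ln_nat_le//; lia.
apply: (@le_trans _ _ ((ln 2%:R)^-1 - (ln n%:R)^-1)); last first.
  by rewrite gerBl invr_ge0 ltW // ln_nat_gt0.
elim: n n2 {n1} => // n IH; rewrite ltnS => n2; rewrite big_nat_recr //=.
have {IH} : \sum_(3 <= k < n.+1) c k * (ln k%:R - ln k.-1%:R) <= (ln 2%:R)^-1 - (ln n%:R)^-1.
  move: n2; rewrite leq_eqVlt => /orP[/eqP <-|/IH//].
  by rewrite big_geq // subrr.
have a0 : 0 < ln n%:R :> R by rewrite ln_nat_gt0 //; lia.
have b0 : 0 < ln n.+1%:R :> R by rewrite ln_nat_gt0 //; lia.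
have ab' : ln n%:R <= ln n.+1%:R :> R by apply: ln_nat_le; lia.
rewrite /c; move: a0 b0 ab'; set a := ln n%:R; set b := ln n.+1%:R => a0 b0 ab.
have : b^-1 ^+ 2 * (b - a) <= a^-1 - b^-1; last by lra.
rewrite -subr_ge0.
have -> : a^-1 - b^-1 - b^-1 ^+ 2 * (b - a) = (b - a) ^+ 2 / (a * b ^+ 2) by field; lra.
by rewrite divr_ge0 ?sqr_ge0 // mulr_ge0 ?sqr_ge0 // ltW.
Qed.
Set Implicit Arguments.
Unset Strict Implicit.
Unset Printing Implicit Defensive.

(** * The independent model *)

Lemma exp_coeff_sum_le {R : realType} (x : R) (n : nat) : 0 <= x ->
  \sum_(0 <= i < n) x ^+ i / i`!%:R <= expR x.
Proof.
move=> x0.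
have nd : nondecreasing_seq (series (exp_coeff x)).
  by apply/nondecreasing_seqP => k; rewrite /series /= big_nat_recr //= lerDl exp_coeff_ge0.
exact: (nondecreasing_cvgn_le nd (is_cvg_series_exp_coeff x) n).
Qed.

Lemma pow_fact_le_expR {R : realType} (x : R) (n : nat) : 0 <= x -> x ^+ n / n`!%:R <= expR x.
Proof.
move=> x0; apply: le_trans (exp_coeff_sum_le n.+1 x0).
by rewrite big_nat_recr //= lerDr; apply: sumr_ge0 => i _; exact: exp_coeff_ge0.
Qed.

(** Since n! (i - n)! divides i!, the factor |x|^n / n! comes out of the tail and leaves an
    exponential series. Serves both the exponential and the sine. *)
Lemma series_tail_le {R : realType} (c : nat -> R) (x l : R) (n : nat) :
  (forall i, `|c i| <= `|x| ^+ i / i`!%:R) ->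
  series c @ \oo --> l ->
  `|l - \sum_(0 <= i < n) c i| <= `|x| ^+ n / n`!%:R * expR `|x|.
Proof.
move=> hc cl.
have cl' : (fun N => `|series c N - \sum_(0 <= i < n) c i|) @ \oo -->
    `|l - \sum_(0 <= i < n) c i|.
  by apply: cvg_norm; apply: cvgB => //; exact: cvg_cst.
rewrite -(cvg_lim (@norm_hausdorff _ R^o) cl'); apply: limr_le; first by apply/cvg_ex; eexists; exact: cl'.
near=> N.
have nN : (n <= N)%N by near: N; exact: nbhs_infty_ge.
rewrite /series /= (@big_cat_nat _ _ _ n 0 N)//= (addrC (\sum_(0 <= i < n) _)) addrK.
apply: le_trans (ler_norm_sum _ _ _) _.
apply: (@le_trans _ _ (\sum_(n <= i < N) `|x| ^+ n / n`!%:R * (`|x| ^+ (i - n) / (i - n)`!%:R))).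
  rewrite big_nat_cond [leRHS]big_nat_cond; apply: ler_sum => i /andP[/andP[ni _] _].
  apply: le_trans (hc i) _.
  rewrite mulrACA -exprD subnKC // ler_wpM2l ?exprn_ge0 //.
  rewrite -invfM lef_pV2 ?posrE ?mulr_gt0 ?ltr0n ?fact_gt0 // -natrM ler_nat.
  have := bin_fact ni => <-; rewrite mulnC leq_pmull // bin_gt0 //.
rewrite -mulr_sumr ler_wpM2l ?divr_ge0 ?exprn_ge0 //.
rewrite -{1}(add0n n) big_addn; under eq_bigr do rewrite addnK.
exact: exp_coeff_sum_le.
Unshelve. all: by end_near. Qed.

Lemma expR_taylor {R : realType} (x : R) (n : nat) :
  `|expR x - \sum_(0 <= i < n) x ^+ i / i`!%:R| <= `|x| ^+ n / n`!%:R * expR `|x|.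
Proof.
apply: series_tail_le (is_cvg_series_exp_coeff x) => i.
by rewrite normrM normrX normfV normr_nat.
Qed.

Lemma sin_taylor {R : realType} (x : R) (n : nat) :
  `|sin x - \sum_(0 <= i < n) (odd i)%:R * (-1) ^+ i.-1./2 * x ^+ i / i`!%:R|
     <= `|x| ^+ n / n`!%:R * expR `|x|.
Proof.
have h := @is_cvg_series_sin_coeff R x.
have -> : sin x = lim (series (sin_coeff x) @ \oo) by rewrite unlock.
apply: series_tail_le h => i.
rewrite !normrM normfV !normr_nat !normrX normrN normr1 expr1n mulr1.
by case: odd; rewrite ?mul1r // !mul0r divr_ge0 // exprn_ge0.
Qed.

Lemma expR_bound1 {R : realType} (x : R) : `|expR x - 1| <= `|x| * expR `|x|.
Proof. by have := @expR_taylor R x 1; rewrite big_nat1 expr0 fact0 factS fact0 !divr1 expr1. Qed.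

Lemma expR_bound2 {R : realType} (x : R) : `|expR x - 1 - x| <= x ^+ 2 * expR `|x|.
Proof.
have := @expR_taylor R x 2; rewrite !big_nat_recr //= big_geq // add0r expr0 expr1 !divr1.
rewrite opprD addrA real_normK ?num_real // => h; apply: le_trans h _.
by rewrite ler_wpM2r ?expR_ge0 // ler_piMr ?sqr_ge0 // invf_le1 ?ltr0n // ler1n.
Qed.

Lemma expR_bound3 {R : realType} (x : R) :
  `|expR x - 1 - x - x ^+ 2 / 2| <= `|x| ^+ 3 * expR `|x|.
Proof.
have := @expR_taylor R x 3; rewrite !big_nat_recr //= big_geq // add0r expr0 expr1 !divr1.
rewrite !opprD !addrA => h; apply: le_trans h _.
by rewrite ler_wpM2r ?expR_ge0 // ler_piMr ?exprn_ge0 // invf_le1 ?ltr0n // ler1n.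
Qed.

(** * Random sublists and the recursion with delay *)

Definition gap_after {R : realType} (z : R) (p : nat) (S : seq nat) : bool :=
  if S is q :: _ then z < loglog q - loglog p else true.

(* On a nonempty increasing list, [runs] exceeds the number of large gaps by one: the last
   element always counts. *)
Fixpoint runs {R : realType} (z : R) (S : seq nat) : nat :=
  if S is p :: S' then (gap_after z p S' + runs z S')%N else 0%N.

(* Expectation of [F S], where [S] is the random sublist of [ps] that keeps each [p]
   independently with probability [pw p]. *)
Fixpoint bexp {R : realType} (ps : seq nat) (F : seq nat -> R) : R :=
  if ps is p :: ps' then (1 - pw p) * bexp ps' F + pw p * bexp ps' (fun S => F (p :: S))
  else F [::].

Lemma eq_bexp {R : realType} (ps : seq nat) (F G : seq nat -> R) :
  (forall S, {subset S <= ps} -> F S = G S) -> bexp ps F = bexp ps G.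
Proof.
elim: ps F G => [|p ps IH] F G h /=; first exact: h.
congr (_ * _ + _ * _); apply: IH => S sS; apply: h => q.
  by move=> /sS; rewrite inE orbC => ->.
by rewrite !inE => /orP[->//|/sS ->]; rewrite orbT.
Qed.

Lemma bexpD {R : realType} (ps : seq nat) (F G : seq nat -> R) :
  bexp ps (fun S => F S + G S) = bexp ps F + bexp ps G.
Proof. by elim: ps F G => //= p ps IH F G; rewrite !IH; ring. Qed.

Lemma bexpZ {R : realType} (ps : seq nat) (a : R) (F : seq nat -> R) :
  bexp ps (fun S => a * F S) = a * bexp ps F.
Proof. by elim: ps F => //= p ps IH F; rewrite !IH; ring. Qed.

(** The indicator says that nothing in [qs] is kept. By independence this costs the product, and
    what is left of the sublist comes from [rs] alone. *)
Lemma bexp_gap_after {R : realType} (z : R) (p : nat) (qs rs : seq nat) (F : seq nat -> R) :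
  all (fun q => ~~ (z < loglog q - loglog p)) qs ->
  all (fun q => z < loglog q - loglog p) rs ->
  bexp (qs ++ rs) (fun S => (gap_after z p S)%:R * F S) =
  (\prod_(q <- qs) (1 - pw q)) * bexp rs F.
Proof.
elim: qs => [|q qs IH] /=.
  move=> _ hrs; rewrite big_nil mul1r; apply: eq_bexp => S sS.
  suff -> : gap_after z p S by rewrite mul1r.
  case: S sS => //= q S sS; apply: (allP hrs); apply: sS; exact: mem_head.
move=> /andP[/negbTE hq hqs] hrs; rewrite IH // big_cons.
under [X in _ + _ * X]eq_bexp do rewrite /= hq /= mul0r -[0](mul0r 0).
by rewrite (bexpZ _ 0 (fun=> 0)) mul0r mulr0 addr0 mulrA.
Qed.

Lemma bexp_runs_cons {R : realType} (z u : R) (p : nat) (ps : seq nat) :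
  bexp (p :: ps) (fun S => u ^+ runs z S) = bexp ps (fun S => u ^+ runs z S) +
  pw p * (u - 1) * bexp ps (fun S => (gap_after z p S)%:R * u ^+ runs z S).
Proof.
rewrite /=.
have -> : bexp ps (fun S => u ^+ (gap_after z p S + runs z S)) =
  bexp ps (fun S => u ^+ runs z S + (u - 1) * ((gap_after z p S)%:R * u ^+ runs z S)).
  apply: eq_bexp => S _; case: gap_after => /=; last by rewrite mul0r mulr0 addr0 add0n.
  by rewrite add1n exprS mul1r mulrBl mul1r addrC subrK.
rewrite bexpD bexpZ; move: (bexp ps _) (bexp ps _) => a b; ring.
Qed.

(* The first [j > k] with a gap larger than [z] after [k], or [y.+1] if there is none up to [y]. *)
Definition wend {R : realType} (z : R) (y k : nat) : nat :=
  (k.+1 + find (fun j => (z < loglog j - loglog k)%R) (iota k.+1 (y - k)))%N.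

Lemma wend_gt {R : realType} (z : R) (y k : nat) : (k < wend z y k)%N.
Proof. by rewrite /wend addSn ltnS leq_addr. Qed.

Lemma wend_le {R : realType} (z : R) (y k : nat) : (k <= y)%N -> (wend z y k <= y.+1)%N.
Proof.
move=> ky; have := find_size (fun j => z < loglog j - loglog k :> R) (iota k.+1 (y - k)).
by rewrite size_iota /wend; lia.
Qed.

Lemma wend_before {R : realType} (z : R) (y k j : nat) : (k < j < wend z y k)%N ->
  loglog j - loglog k <= z.
Proof.
move=> /andP[kj jw]; have jf : (j - k.+1 < find (fun j => (z < loglog j - loglog k)%R)
   (iota k.+1 (y - k)))%N by move: jw; rewrite /wend; lia.
have := before_find 0%N jf; rewrite nth_iota.
  by rewrite subnKC // => /negbT; rewrite -leNgt.
by move: (leq_trans jf (find_size _ _)); rewrite size_iota.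
Qed.

Lemma wend_after {R : realType} (z : R) (y k j : nat) : (1 < k)%N -> (wend z y k <= j <= y)%N ->
  z < loglog j - loglog k.
Proof.
move=> k1 /andP[wj jy].
have hf : has (fun j => z < loglog j - loglog k) (iota k.+1 (y - k)).
  by rewrite has_find size_iota; move: wj; rewrite /wend; lia.
have := nth_find 0%N hf; rewrite nth_iota; last first.
  by rewrite -[X in (_ < X)%N](size_iota k.+1) -has_find.
rewrite -/(wend z y k) => h; apply: lt_le_trans h _; rewrite lerD2r loglog_le //.
by apply: leq_trans k1 (ltnW (wend_gt _ _ _)).
Qed.

Definition genf {R : realType} (z u : R) (y k : nat) : R :=
  bexp (iota k (y.+1 - k)) (fun S => u ^+ runs z S).

Lemma genf_end {R : realType} (z u : R) (y : nat) : genf z u y y.+1 = 1.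
Proof. by rewrite /genf subnn /= expr0. Qed.

Lemma genf_rec {R : realType} (z u : R) (y k : nat) : (1 < k <= y)%N ->
  genf z u y k = genf z u y k.+1 +
   pw k * (u - 1) * (\prod_(k.+1 <= j < wend z y k) (1 - pw j)) * genf z u y (wend z y k).
Proof.
move=> /andP[k1 ky]; rewrite /genf subSn // -[iota k _]/(k :: iota k.+1 (y - k)).
rewrite (bexp_runs_cons z u k (iota k.+1 (y - k))) subSS; congr (_ + _); rewrite -!mulrA; congr (_ * (_ * _)).
have hw := @wend_gt R z y k; have hw2 := @wend_le R z y k ky.
have -> : iota k.+1 (y - k) = iota k.+1 (wend z y k - k.+1) ++
   iota (wend z y k) (y.+1 - wend z y k).
  by rewrite -{2}(subnKC hw) -iotaD; congr iota; lia.
rewrite bexp_gap_after //; apply/allP => j; rewrite mem_iota => hj.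
  rewrite -leNgt; apply: (@wend_before R z y); lia.
apply: (@wend_after R z y) => //; lia.
Qed.

(* The total variation [V] of [D] satisfies [V <= beta * M * V + E * (1 + V)]: each increment
   of [D] is controlled by the increments inside its window, and a given increment lies in
   windows of total weight at most [M]. *)
Lemma delay_bound {R : realType} (y : nat) (D x b c e : nat -> R) (w : nat -> nat) (beta M E : R) :
  (1 < y)%N ->
  D y.+1 = 1 -> 0 <= beta -> 0 <= E -> beta * M <= 1 / 4 -> E <= 1 / 4 ->
  (forall k, 0 <= x k) ->
  (forall k, (1 < k <= y)%N -> (k < w k <= y.+1)%N) ->
  (forall k, (1 < k <= y)%N ->
     D k - D k.+1 = x k * b k * (D (w k) - D k.+1) + c k * D k.+1) ->
  (forall k, (1 < k <= y)%N -> `|b k| <= beta) ->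
  (forall k, (1 < k <= y)%N -> `|c k| <= x k * e k) ->
  (forall j, (1 < j <= y)%N -> \sum_(2 <= k < j | (j < w k)%N) x k <= M) ->
  \sum_(2 <= k < y.+1) x k * e k <= E ->
  `|D 2%N - 1| <= 2 * E.
Proof.
move=> y1 Dy b0 E0 bM E4 x0 hw hD hb hc hM hE.
pose d k : R := `|D k.+1 - D k|; pose V : R := \sum_(2 <= k < y.+1) d k.
have d0 k : 0 <= d k by exact: normr_ge0.
have tele i j : (i <= j)%N -> `|D j - D i| <= \sum_(i <= k < j) d k.
  by move=> ij; rewrite -telescope_sumr // ler_norm_sum.
have V0 : 0 <= V by apply: sumr_ge0.
have DV k : (1 < k <= y.+1)%N -> `|D k| <= 1 + V.
  move=> /andP[k1 ky]; have := tele _ _ ky; rewrite Dy distrC => h.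
  have h2 : \sum_(k <= i < y.+1) d i <= V.
    by rewrite /V (@big_cat_nat _ _ _ k 2 y.+1)//= lerDr sumr_ge0.
  rewrite -[D k](subrK 1); apply: le_trans (ler_normD _ _) _; rewrite normr1; lra.
have step k : (1 < k <= y)%N -> d k <= beta * (x k * \sum_(k.+1 <= j < w k) d j) + x k * e k * (1 + V).
  move=> hk; have /andP[wk1 wk2] := hw k hk; rewrite /d distrC hD //.
  apply: le_trans (ler_normD _ _) _; apply: lerD; last first.
    by rewrite normrM ler_pM // ?hc // DV //; lia.
  rewrite !normrM (ger0_norm (x0 k)) -mulrA mulrCA.
  by apply: ler_pM; rewrite ?mulr_ge0 ?hb // ler_wpM2l ?tele.
(* As [beta * M] and [E] are at most 1 / 4, half of [V] is absorbed on the left, which leaves V <= 2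
   E. *)
suff hV : V <= beta * M * V + E * (1 + V).
  have h1 : beta * M * V <= 1 / 4 * V by rewrite ler_wpM2r.
  have h2 : E * V <= 1 / 4 * V by rewrite ler_wpM2r.
  have h3 : V <= 2 * E by lra.
  apply: le_trans h3; have := @tele 2%N y.+1 (leqW y1); rewrite Dy distrC; exact.
apply: (@le_trans _ _ (\sum_(2 <= k < y.+1)
   (beta * (x k * \sum_(k.+1 <= j < w k) d j) + x k * e k * (1 + V)))).
  by apply: ler_sum_nat => k; exact: step.
rewrite big_split /= -mulr_suml lerD ?ler_wpM2r //; last by lra.
rewrite -mulr_sumr -mulrA ler_wpM2l //.
have -> : \sum_(2 <= k < y.+1) x k * \sum_(k.+1 <= j < w k) d j =
   \sum_(2 <= k < y.+1) \sum_(2 <= j < y.+1) (if (k < j < w k)%N then x k * d j else 0).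
  apply: eq_big_nat => k hk; have /andP[wk1 wk2] := hw k hk.
  rewrite mulr_sumr (@big_nat_widenl _ _ _ k.+1 2) //; last by lia.
  rewrite (@big_nat_widen _ _ _ 2 (w k) y.+1) // big_mkcond /=.
  by apply: eq_bigr => j _; rewrite andbC.
rewrite exchange_big /= /V mulr_sumr big_nat_cond [leRHS]big_nat_cond.
apply: ler_sum => j /andP[/andP[j1 jy] _].
rewrite -big_mkcond /= -mulr_suml ler_wpM2r // (le_trans _ (hM j _)) //; last by lia.
rewrite [leRHS](@big_nat_widen _ _ _ 2 j y.+1) //; last by lia.
by rewrite le_eqVlt; apply/orP; left; apply/eqP; apply: eq_bigl => k; rewrite andbC.
Qed.

(** * Estimates in a single window *)

Lemma normM_le {R : realType} (a b A B : R) : `|a| <= A -> `|b| <= B -> `|a * b| <= A * B.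
Proof. by move=> ha hb; rewrite normrM ler_pM. Qed.

Lemma expRN_sub_le {R : realType} (x y : R) : 0 <= x -> 0 <= y ->
  `|expR (- x) - expR (- y)| <= `|x - y|.
Proof.
move=> x0 y0; wlog xy : x y x0 y0 / x <= y => [H|].
  by case: (leP x y) => [/H|/ltW/H]; [apply|rewrite distrC (distrC x); apply].
have e1 : expR (- y) <= expR (- x) by rewrite ler_expR lerN2.
rewrite ger0_norm ?subr_ge0 // distrC ger0_norm ?subr_ge0 //.
have -> : expR (- x) - expR (- y) = expR (- x) * (1 - expR (- (y - x))).
  by rewrite mulrBr mulr1 -expRD; congr (_ - expR _); ring.
have h1 : expR (- x) <= 1 by rewrite expR_le1 oppr_le0.
have h2 : 1 - expR (- (y - x)) <= y - x.
  have := @expR_ge1Dx R (- (y - x)); lra.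
have h3 : 0 <= 1 - expR (- (y - x)) by rewrite subr_ge0 expR_le1 oppr_le0 subr_ge0.
by rewrite -[leRHS]mul1r; apply: ler_pM => //; exact: expR_ge0.
Qed.

Lemma one_sub_ge_expR {R : realType} (x : R) : 0 <= x -> x <= 1 / 2 ->
  expR (- (x + 2 * x ^+ 2)) <= 1 - x.
Proof.
move=> x0 x1; rewrite expRN -[leLHS]mul1r ler_pdivrMr ?expR_gt0 //.
have h := expR_ge1Dx (x + 2 * x ^+ 2); have h1 : 0 <= 1 - x by lra.
apply: le_trans (ler_wpM2l h1 h).
have : 0 <= x ^+ 2 * (1 - 2 * x) by rewrite mulr_ge0 ?sqr_ge0 //; lra.
lra.
Qed.

Lemma sum_inv_sq_le {R : realType} (k n : nat) : (0 < k)%N -> (k <= n)%N ->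
  \sum_(k.+1 <= j < n.+1) (j%:R^-1) ^+ 2 <= k%:R^-1 - n%:R^-1 :> R.
Proof.
move=> k0; elim: n => [|n IH]; first by lia.
rewrite leq_eqVlt => /orP[/eqP <-|]; first by rewrite big_geq // subrr.
rewrite ltnS => kn; rewrite big_nat_recr //=; apply: le_trans (lerD (IH kn) (lexx _)) _.
have n0 : 0 < n%:R :> R by rewrite ltr0n; lia.
rewrite -natr1; move: n%:R n0 => a a0.
have : 0 <= a^-1 - (a + 1)^-1 - (a + 1)^-1 ^+ 2; last by lra.
have -> : a^-1 - (a + 1)^-1 - (a + 1)^-1 ^+ 2 = (a * (a + 1) ^+ 2)^-1 by field; lra.
by rewrite invr_ge0 mulr_ge0 ?sqr_ge0 // ltW.
Qed.

Lemma inv_nat_le_inv_ln {R : realType} (k : nat) : (1 < k)%N -> k%:R^-1 <= (ln k%:R)^-1 :> R.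
Proof.
move=> k1; have k0 : 0 < k%:R :> R by rewrite ltr0n ltnW.
rewrite lef_pV2 ?posrE ?ln_nat_gt0 //.
by rewrite ltW // ln_sublinear // ltr0n ltnW.
Qed.

Lemma prod_1sub_le {R : realType} (k w : nat) : (1 < k)%N ->
  \prod_(k.+1 <= j < w) (1 - pw j) <= expR (- \sum_(k.+1 <= j < w) pw j) :> R.
Proof.
move=> k1; rewrite -sumrN expR_sum big_nat_cond [leRHS]big_nat_cond.
apply: ler_prod => j /andP[/andP[kj _] _]; apply/andP; split; last exact: expR_ge1Dx.
by rewrite subr_ge0 pw_le1.
Qed.

(** The second-order loss 2 x^2 in 1 - x >= exp (- x - 2 x^2) sums to at most 2 / k over the
    integers beyond k. *)
Lemma prod_1sub_ge {R : realType} (k w : nat) : (1 < k)%N -> (k < w)%N ->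
  expR (- (\sum_(k.+1 <= j < w) pw j + 2 / k%:R)) <= \prod_(k.+1 <= j < w) (1 - pw j) :> R.
Proof.
move=> k1 kw.
apply: (@le_trans _ _ (expR (\sum_(k.+1 <= j < w) - (pw j + 2 * pw j ^+ 2)))); last first.
  rewrite expR_sum big_nat_cond [leRHS]big_nat_cond.
  apply: ler_prod => j /andP[/andP[kj _] _]; rewrite expR_ge0 one_sub_ge_expR ?pw_ge0 //.
  apply: le_trans (pw_le _) _; rewrite div1r lef_pV2 ?posrE ?ltr0n ?ler_nat; lia.
rewrite ler_expR sumrN lerN2 big_split /= lerD2l -mulr_sumr ler_pM2l //.
case: w kw => // w; rewrite ltnS => kw.
apply: (@le_trans _ _ (\sum_(k.+1 <= j < w.+1) (j%:R^-1) ^+ 2)).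
  by apply: ler_sum_nat => j _; rewrite lerXn2r ?nnegrE ?pw_ge0 ?invr_ge0 ?pw_le.
apply: le_trans (sum_inv_sq_le _ kw) _; first by lia.
by rewrite gerBl invr_ge0.
Qed.

Definition mertens_const {R : realType} (C : R) := forall m n : nat,
  (1 < m)%N -> (m <= n)%N ->
  `|\sum_(m.+1 <= k < n.+1) pw k - (loglog n - loglog m)| <= C / ln m%:R.

Lemma window_sum_le {R : realType} (z C : R) (y k : nat) : mertens_const C -> 0 <= z ->
  (1 < k <= y)%N -> \sum_(k.+1 <= j < wend z y k) pw j <= z + C / ln k%:R.
Proof.
move=> mC z0 /andP[k1 ky]; have kw := @wend_gt R z y k.
have bf := @wend_before R z y k.
move: kw bf; case: (wend z y k) => // w; rewrite ltnS => kw bf.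
have := mC k w k1 kw; rewrite ler_norml => /andP[_ h].
have : loglog w - loglog k <= z; last by lra.
move: kw; rewrite leq_eqVlt => /orP[/eqP <-|kw]; first by rewrite subrr.
by apply: bf; rewrite kw /=.
Qed.

(** The condition [wend z y k <= y] says that the window is not cut short by [y]. Mertens' estimate
    is applied up to [wend z y k], which already lies outside the window; removing its weight costs
    the extra 1. *)
Lemma window_sum_ge {R : realType} (z C : R) (y k : nat) : mertens_const C -> 0 <= z ->
  (1 < k <= y)%N -> (wend z y k <= y)%N ->
  z - (C + 1) / ln k%:R <= \sum_(k.+1 <= j < wend z y k) pw j.
Proof.
move=> mC z0 /andP[k1 ky] wy; have kw := @wend_gt R z y k.
have := mC k (wend z y k) k1 (ltnW kw); rewrite ler_norml => /andP[h _].
have h2 : z < loglog (wend z y k) - loglog k by apply: (@wend_after R z y) => //; rewrite leqnn.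
move: h; rewrite big_nat_recr //= => h.
have h3 : pw (wend z y k) <= (ln k%:R)^-1 :> R.
  apply: le_trans (pw_le _) _; apply: le_trans (inv_nat_le_inv_ln k1).
  by rewrite lef_pV2 ?posrE ?ltr0n ?ler_nat; lia.
rewrite mulrDl mul1r; lra.
Qed.

(** Supplies the weight [M] of [delay_bound], with [P] saying that the window of k contains j. All
    such k lie between the least of them and j; the least one costs the 1, because the Mertens sum
    starts after it. *)
Lemma preceding_sum_le {R : realType} (z C : R) (j : nat) (P : pred nat) : mertens_const C -> 0 < C -> 0 <= z ->
  (1 < j)%N -> (forall k, (1 < k < j)%N -> P k -> loglog j - loglog k <= z) ->
  \sum_(2 <= k < j | P k) pw k <= 1 + z + C / ln 2%:R.
Proof.
move=> mC C0 z0 j1 hP.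
have l2 : 0 < ln 2%:R :> R by exact: ln_nat_gt0.
have r0 := divr_ge0 (ltW C0) (ltW l2).
have [/hasP[k kj Pk]|none] := boolP (has P (index_iota 2 j)); last first.
  by rewrite big_hasC //; lra.
have ex : exists k, (1 < k < j)%N && P k.
  by exists k; rewrite Pk andbT; move: kj; rewrite mem_index_iota.
case: (ex_minnP ex) => m /andP[/andP[m1 mj] Pm] mmin.
rewrite (@big_cat_nat _ _ _ m 2 j) //=; last exact: ltnW.
rewrite big1_seq ?add0r; last first.
  move=> i /andP[Pi]; rewrite mem_index_iota => /andP[i1 im].
  have : (m <= i)%N by apply: mmin; rewrite Pi andbT i1 (ltn_trans im).
  by rewrite leqNgt im.
apply: (@le_trans _ _ (\sum_(m <= k < j) pw k)).
  by rewrite big_mkcond; apply: ler_sum => i _; case: ifP => // _; exact: pw_ge0.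
rewrite big_ltn //; case: j j1 hP kj ex mmin mj => // j j1 hP kj ex mmin; rewrite ltnS => mj.
have := mC m j m1 mj; rewrite ler_norml => /andP[_ h].
have h2 : pw m <= 1 :> R by exact: pw_le1.
have h3 : loglog j - loglog m <= z.
  apply: le_trans (hP m _ Pm); last by rewrite m1 ltnS.
  by rewrite lerD2r loglog_le // (leq_trans m1).
have h4 : C / ln m%:R <= C / ln 2%:R.
  by rewrite ler_pM2l // lef_pV2 ?posrE ?ln_nat_gt0 ?ln_nat_le.
lra.
Qed.

Lemma gap_variance_norm_le {R : realType} (z : R) : 0 <= z ->
  `|(1 - 2 * z * expR (- z)) * expR (- z)| <= 1 + 2 * z.
Proof.
move=> z0; set ep := expR (- z).
have ep0 : 0 <= ep by exact: expR_ge0.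
have ep1 : ep <= 1 by rewrite expR_le1 oppr_le0.
rewrite normrM (ger0_norm ep0) -[leRHS]mulr1; apply: ler_pM => //.
have h1 : 0 <= z * ep by rewrite mulr_ge0.
have h2 : z * ep <= z by rewrite ler_piMr.
by rewrite ler_norml; apply/andP; split; lra.
Qed.

Lemma cumulant_norm_le {R : realType} (z eta : R) : 0 <= z -> `|eta| <= 1 ->
  `|expR (- z) * eta + (1 - 2 * z * expR (- z)) * expR (- z) * eta ^+ 2 / 2| <= (2 + z) * `|eta|.
Proof.
move=> z0 N1; apply: le_trans (ler_normD _ _) _.
have h1 : `|expR (- z) * eta| <= 1 * `|eta|.
  by apply: normM_le => //; rewrite ger0_norm ?expR_ge0 // expR_le1 oppr_le0.
have h2 : `|eta ^+ 2| <= `|eta| by rewrite normrX expr2 ler_piMl.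
have h3 : `|2^-1 : R| <= 2^-1 by rewrite ger0_norm.
have h4 := normM_le (normM_le (gap_variance_norm_le z0) h2) h3.
have := normr_ge0 eta; lra.
Qed.

(* [s] is chosen so that [(exp eta - 1) exp (- z) exp (- s z) = s] up to third order in [eta]. *)
Lemma drift_approx {R : realType} (z De : R) : 0 <= z -> 0 <= De ->
  exists2 K : R, 0 < K & forall eta t a x de s : R,
  `|eta| <= 1 -> 0 <= de -> de <= De -> `|t - z| <= de -> 0 <= t -> 0 <= a -> a <= 1 ->
  `|a - expR (- z)| <= de -> 0 <= x -> x <= de ->
  s = expR (- z) * eta + (1 - 2 * z * expR (- z)) * expR (- z) * eta ^+ 2 / 2 ->
  `|(expR eta - 1) * a * expR (- (s * (x + t))) - s| <= K * (`|eta| ^+ 3 + `|eta| * de).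
Proof.
move=> z0 De0; pose B : R := 2 + z; pose Q : R := B * (z + 2 * De).
exists (expR 1 * expR Q + 2 * expR Q + 2 * (Q ^+ 2 * expR Q) + 4 * B + z * (1 + 2 * z + B)).
  have e1 := expR_gt0 (1 : R); have e2 := expR_gt0 Q.
  have : 0 < expR 1 * expR Q by rewrite mulr_gt0.
  have : 0 <= Q ^+ 2 * expR Q by rewrite mulr_ge0 ?sqr_ge0 // ltW.
  have : 0 <= z * (1 + 2 * z + B) by rewrite mulr_ge0 // /B; lra.
  rewrite /B; lra.
move=> eta t a x de s N1 de0 deD tz t0 a0 a1 az x0 xd es.
pose N : R := `|eta|; pose ep : R := expR (- z); pose v : R := (1 - 2 * z * ep) * ep.
have N0 : 0 <= N by exact: normr_ge0.
have ep0 : 0 <= ep by exact: expR_ge0.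
have ep1 : ep <= 1 by rewrite expR_le1 oppr_le0.
have B0 : 0 <= B by rewrite /B; lra.
have N2 : N ^+ 2 <= N by rewrite expr2 ler_piMl.
have eta2 : eta ^+ 2 = N ^+ 2 by rewrite real_normK ?num_real.
have vb : `|v| <= 1 + 2 * z by exact: gap_variance_norm_le.
have sN : `|s| <= B * N by rewrite es; exact: cumulant_norm_le.
have tz2 : x + t <= z + 2 * De by move: tz; rewrite ler_norml => /andP[_ ?]; lra.
have hN : `|s * (x + t)| <= Q * N.
  rewrite /Q mulrAC; apply: normM_le => //.
  by rewrite ger0_norm // addr_ge0.
have Q0 : 0 <= Q by rewrite /Q mulr_ge0 //; lra.
have hQ : `|s * (x + t)| <= Q by apply: le_trans hN _; rewrite ler_piMr.
set E := expR (- (s * (x + t))).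
have E0 : 0 <= E by exact: expR_ge0.
have EQ : E <= expR Q by rewrite ler_expR; apply: le_trans (ler_norm _) _; rewrite normrN.
have eQ0 : 0 <= expR Q by exact: expR_ge0.
have r3 : `|E - 1 + s * (x + t)| <= Q ^+ 2 * expR Q * N ^+ 2.
  have := expR_bound2 (- (s * (x + t))); rewrite opprK normrN sqrrN => h; apply: le_trans h _.
  rewrite [leRHS]mulrAC -exprMn; apply: ler_pM; rewrite ?sqr_ge0 ?expR_ge0 ?ler_expR //.
  by rewrite -[leLHS]real_normK ?num_real // lerXn2r ?nnegrE // mulr_ge0.
have r1 : `|expR eta - 1 - eta - eta ^+ 2 / 2| <= expR 1 * N ^+ 3.
  apply: le_trans (expR_bound3 _) _; rewrite mulrC ler_wpM2r ?exprn_ge0 //.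
  by rewrite ler_expR.
have pe : `|eta + eta ^+ 2 / 2| <= 2 * N.
  apply: le_trans (ler_normD _ _) _; rewrite eta2 (ger0_norm (_ : 0 <= N ^+ 2 / 2)) -/N; first by lra.
  by rewrite divr_ge0 // exprn_ge0.
(* In turn, exp eta is replaced by its second-order polynomial, [a] by exp (- z) and the last
   exponential by 1 - s z. The final summand is the amount by which [s] then fails to solve the
   equation; it is of third order in eta. *)
have split_err (e1 e2 : R) : (e1 - 1) * a * e2 - s =
   (e1 - 1 - eta - eta ^+ 2 / 2) * (a * e2) +
   (eta + eta ^+ 2 / 2) * ((a - ep) * e2 + ep * ((e2 - 1 + s * (x + t)) - s * (x + (t - z)))) +
   z * ep * (- (eta * (v * eta ^+ 2 / 2)) - eta ^+ 2 * s / 2).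
  have -> : s = ep * eta + v * eta ^+ 2 / 2 by rewrite es.
  by rewrite /v; field.
rewrite split_err.
have T1 : `|(expR eta - 1 - eta - eta ^+ 2 / 2) * (a * E)| <= expR 1 * N ^+ 3 * expR Q.
  apply: normM_le => //; rewrite ger0_norm ?mulr_ge0 // -[leRHS]mul1r.
  exact: ler_pM.
have T2 : `|(eta + eta ^+ 2 / 2) * ((a - ep) * E + ep * ((E - 1 + s * (x + t)) - s * (x + (t - z))))|
    <= 2 * N * (de * expR Q + (Q ^+ 2 * expR Q * N ^+ 2 + B * N * (2 * de))).
  apply: normM_le => //; apply: le_trans (ler_normD _ _) _; apply: lerD.
    by apply: normM_le => //; rewrite ger0_norm.
  rewrite -[leRHS]mul1r; apply: normM_le; first by rewrite ger0_norm.
  apply: le_trans (ler_normB _ _) _; apply: lerD => //; apply: normM_le => //.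
  apply: le_trans (ler_normD _ _) _; rewrite ger0_norm //; lra.
have T3 : `|z * ep * (- (eta * (v * eta ^+ 2 / 2)) - eta ^+ 2 * s / 2)|
    <= z * ((1 + 2 * z + B) * N ^+ 3).
  apply: normM_le; first by rewrite ger0_norm ?mulr_ge0 // ler_piMr.
  rewrite -normrN opprB opprK; apply: le_trans (ler_normD _ _) _.
  rewrite eta2 mulrDl; have N3 : 0 <= N ^+ 3 by exact: exprn_ge0.
  have B3 : 0 <= B * N ^+ 3 by rewrite mulr_ge0.
  have k1 : `|N ^+ 2 * s / 2| <= B * N ^+ 3.
    apply: (@le_trans _ _ (N ^+ 2 * (B * N) * 1)); last by rewrite mulr1 mulrCA -exprSr.
    apply: normM_le; last by rewrite ger0_norm //; lra.
    by apply: normM_le => //; rewrite ger0_norm ?exprn_ge0.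
  have k2 : `|eta * (v * N ^+ 2 / 2)| <= (1 + 2 * z) * N ^+ 3.
    apply: (@le_trans _ _ (N * ((1 + 2 * z) * N ^+ 2 * 1))); last by rewrite mulr1 mulrCA -exprS.
    apply: normM_le => //; apply: normM_le; last by rewrite ger0_norm //; lra.
    by apply: normM_le => //; rewrite ger0_norm ?exprn_ge0.
  by rewrite addrC lerD.
apply: le_trans (ler_normD _ _) _; apply: le_trans (lerD (ler_normD _ _) (lexx _)) _.
apply: le_trans (lerD (lerD T1 T2) T3) _.
rewrite -/N; move: (expR Q) (expR 1) eQ0 (expR_ge0 (1:R)) => eQ e1 eQ0 e10.
have N3 : 0 <= N ^+ 3 by exact: exprn_ge0.
have p1 : 0 <= N * de by rewrite mulr_ge0.
have p2 : N ^+ 2 * de <= N * de by rewrite ler_wpM2r.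
have p3 := ler_wpM2l B0 p2.
have p4 : 0 <= Q ^+ 2 * eQ by rewrite mulr_ge0 // sqr_ge0.
have p5 : 0 <= z * (1 + 2 * z + B) by rewrite mulr_ge0 //; lra.
have q1 : 0 <= e1 * eQ * (N * de) by rewrite !mulr_ge0.
have q2 : 0 <= eQ * N ^+ 3 by rewrite mulr_ge0.
have q3 : 0 <= (Q ^+ 2 * eQ) * (N * de) by rewrite mulr_ge0.
have q4 : 0 <= B * N ^+ 3 by rewrite mulr_ge0.
have q5 : 0 <= z * (1 + 2 * z + B) * (N * de) by rewrite mulr_ge0.
lra.
Qed.

(** Of the two factors [p] in the quadratic error, one is kept as the weight in the sum over primes;
    the other is traded for [L], which will be 1 / ln k. *)
Lemma expRN_quadratic_le {R : realType} (B N L s p : R) : 0 <= B -> 0 <= N -> N <= 1 ->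
  `|s| <= B * N -> 0 <= p -> p <= 1 -> p <= L ->
  `|expR (- (s * p)) - 1 - - (s * p)| <= p * (B ^+ 2 * expR B * (N * L)).
Proof.
move=> B0 N0 N1 sN p0 p1 pL; apply: le_trans (expR_bound2 _) _; rewrite sqrrN normrN.
have s1 : `|s| <= B by apply: le_trans sN _; rewrite ler_piMr.
have h1 : expR `|s * p| <= expR B.
  by rewrite ler_expR -[leRHS]mulr1; apply: normM_le => //; rewrite ger0_norm.
have h2 : (s * p) ^+ 2 <= p * (B ^+ 2 * (N * L)).
  rewrite (_ : (s * p) ^+ 2 = p * (s ^+ 2 * p)); last by ring.
  rewrite ler_wpM2l // mulrA; apply: ler_pM => //; first exact: sqr_ge0.
  rewrite -[leLHS]real_normK ?num_real //; apply: (@le_trans _ _ ((B * N) ^+ 2)).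
    by rewrite lerXn2r ?nnegrE // mulr_ge0.
  by rewrite exprMn ler_wpM2l ?sqr_ge0 // expr2 ler_piMl.
apply: (@le_trans _ _ (p * (B ^+ 2 * (N * L)) * expR B)).
  by apply: ler_pM => //; exact: sqr_ge0.
by rewrite le_eqVlt; apply/orP; left; apply/eqP; ring.
Qed.

Lemma window_drift {R : realType} (z C : R) : 0 <= z -> 0 < C -> mertens_const C ->
  exists2 K : R, 0 < K & forall (y k : nat) (eta s : R), `|eta| <= 1 ->
  s = expR (- z) * eta + (1 - 2 * z * expR (- z)) * expR (- z) * eta ^+ 2 / 2 ->
  (1 < k <= y)%N -> (wend z y k <= y)%N ->
  `|(expR eta - 1) * \prod_(k.+1 <= j < wend z y k) (1 - pw j)
     * expR (- (s * (pw k + \sum_(k.+1 <= j < wend z y k) pw j))) - s|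
  <= K * (`|eta| ^+ 3 + `|eta| / ln k%:R).
Proof.
move=> z0 C0 mC; have l2 : 0 < ln 2%:R :> R by exact: ln_nat_gt0.
pose De : R := (C + 3) / ln 2%:R.
have De0 : 0 <= De by rewrite divr_ge0 //; [lra | exact: ltW].
have [K0 K00 drift] := drift_approx z0 De0.
have a1 : 0 < K0 * (C + 3) by rewrite mulr_gt0 //; lra.
exists (K0 + K0 * (C + 3)) => [|y k eta s N1 es hk wy]; first by lra.
have /andP[k1 ky] := hk.
have tle := window_sum_le mC z0 hk; have tge := window_sum_ge mC z0 hk wy.
have up := @prod_1sub_le R k (wend z y k) k1.
have lo := @prod_1sub_ge R k (wend z y k) k1 (wend_gt _ _ _).
have t0 : 0 <= \sum_(k.+1 <= j < wend z y k) pw j :> R.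
  by rewrite sumr_ge0 // => j _; exact: pw_ge0.
have a0 : 0 <= \prod_(k.+1 <= j < wend z y k) (1 - pw j) :> R.
  by rewrite prodr_ge0 // => j _; rewrite subr_ge0 pw_le1.
move: tle tge up lo t0 a0; move: (\sum_(_ <= j < _) _) (\prod_(_ <= j < _) _) => t a.
move=> tle tge up lo t0 a0.
have lk : 0 < ln k%:R :> R by exact: ln_nat_gt0.
have lk2 : (ln k%:R)^-1 <= (ln 2%:R)^-1 :> R by rewrite lef_pV2 ?posrE // ln_nat_le.
have pk : pw k <= (ln k%:R)^-1 :> R by apply: le_trans (pw_le _) (inv_nat_le_inv_ln k1).
have p0 : 0 <= pw k :> R by exact: pw_ge0.
have k2 : 2 / k%:R <= 2 / ln k%:R :> R by rewrite ler_wpM2l // inv_nat_le_inv_ln.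
have k20 : 0 <= 2 / k%:R :> R by rewrite divr_ge0.
(* C + 1 is the error of the window weight, and 2 that of turning the product over the window into
   an exponential. *)
pose de : R := (C + 3) / ln k%:R.
have i0 : 0 <= (ln k%:R)^-1 :> R by rewrite invr_ge0 ltW.
have de0 : 0 <= de by rewrite mulr_ge0 //; lra.
have deD : de <= De by rewrite /de /De ler_wpM2l //; lra.
have tz : `|t - z| <= (C + 1) / ln k%:R.
  by rewrite ler_norml; move: tge; rewrite mulrDl mul1r => tge; apply/andP; split; lra.
have N3 : 0 <= `|eta| ^+ 3 by exact: exprn_ge0.
have NL : 0 <= `|eta| / ln k%:R by rewrite mulr_ge0.
have h : `|(expR eta - 1) * a * expR (- (s * (pw k + t))) - s| <= K0 * (`|eta| ^+ 3 + `|eta| * de).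
  apply: (drift eta t a (pw k) de s N1 de0 deD) => //.
  - by apply: le_trans tz _; rewrite /de ler_wpM2r //; lra.
  - by apply: le_trans up _; rewrite expR_le1 oppr_le0.
  - have d1 := le_trans (expRN_sub_le t0 z0) tz.
    have d2 := le_trans (ler_norm _) (expRN_sub_le t0 (addr_ge0 t0 k20)).
    rewrite opprD addrA subrr sub0r normrN (ger0_norm k20) in d2.
    rewrite opprD in lo.
    have -> : de = (C + 1) / ln k%:R + 2 / ln k%:R by rewrite -mulrDl /de; congr (_ / _); ring.
    by move: d1; rewrite !ler_norml => /andP[d11 d12]; apply/andP; split; lra.
  - by apply: le_trans pk _; rewrite /de ler_peMl //; lra.
apply: le_trans h _.
have q1 : 0 <= (K0 * (C + 3)) * `|eta| ^+ 3 by rewrite mulr_ge0 // ltW.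
have q2 : 0 <= K0 * (`|eta| / ln k%:R) by rewrite mulr_ge0 // ltW.
have -> : K0 * (`|eta| ^+ 3 + `|eta| * de)
        = K0 * `|eta| ^+ 3 + K0 * (C + 3) * (`|eta| / ln k%:R) by rewrite /de; ring.
lra.
Qed.

Lemma bexp_mgf {R : realType} (z : R) : 0 <= z ->
  exists2 K : R, 0 < K & forall (y : nat) (eta s tau : R), (1 < y)%N ->
  tau = \sum_(2 <= k < y.+1) pw k ->
  s = expR (- z) * eta + (1 - 2 * z * expR (- z)) * expR (- z) * eta ^+ 2 / 2 ->
  K * (`|eta| ^+ 3 * tau + `|eta|) <= 1 ->
  `|genf z (expR eta) y 2 * expR (- (s * tau)) - 1| <= K * (`|eta| ^+ 3 * tau + `|eta|).
Proof.
move=> z0; have [C C0 mC] := @mertens_second R; have [Cs Cs0 hCs] := @sum_pw_div_ln R.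
have l2 : 0 < ln 2%:R :> R by exact: ln_nat_gt0.
pose De := (C + 3) / ln 2%:R.
have De0 : 0 <= De by rewrite divr_ge0 //; [lra | exact: ltW].
have [K0 K00 drift] := window_drift z0 C0 mC.
pose B := 2 + z; pose Q := B * (z + 2 * De); pose eQ := expR 1 * expR Q.
have B0 : 0 <= B by rewrite /B; lra.
have eQ0 : 0 < eQ by rewrite mulr_gt0 ?expR_gt0.
pose K1 := K0 + B ^+ 2 * expR B + eQ + B.
have a2 : 0 <= B ^+ 2 * expR B by rewrite mulr_ge0 ?sqr_ge0 ?expR_ge0.
have K10 : 0 < K1 by rewrite /K1; lra.
pose M := 1 + z + C / ln 2%:R.
have M0 : 0 <= M by rewrite /M; have := divr_ge0 (ltW C0) (ltW l2); lra.
(* The factor 4 turns the smallness hypothesis into the bounds 1 / 4 that [delay_bound] asks for.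
   The three summands serve [E], the product of [beta] and [M], and |eta| <= 1. *)
pose K := 4 * (K1 * (1 + Cs + (M + 1)) + eQ * M + 1).
have b1 : 0 <= K1 * (1 + Cs + (M + 1)) by rewrite mulr_ge0 ?(ltW K10) //; lra.
have b2 : 0 <= eQ * M by rewrite mulr_ge0 ?(ltW eQ0).
exists K; first by rewrite /K; lra.
move=> y eta s tau y1 etau es small.
pose N : R := `|eta|; have N0 : 0 <= N by exact: normr_ge0.
have tau0 : 0 <= tau by rewrite etau sumr_ge0 // => k _; exact: pw_ge0.
have N3 : 0 <= N ^+ 3 * tau by rewrite mulr_ge0 ?exprn_ge0.
rewrite -/N in small *.
have KN : K * N <= 1.
  apply: le_trans small; rewrite ler_wpM2l //; first by rewrite /K; lra.
  by rewrite lerDr.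
have N1 : N <= 1.
  apply: le_trans KN; rewrite ler_peMl // /K; lra.
pose w := wend z y.
pose t k : R := \sum_(k.+1 <= j < w k) pw j.
pose a k : R := \prod_(k.+1 <= j < w k) (1 - pw j).
pose b k : R := (expR eta - 1) * a k * expR (- (s * (pw k + t k))).
pose ta k : R := \sum_(k <= j < y.+1) pw j.
(* The generating function divided by its predicted size. It should stay close to 1, its value at
   [y.+1], and the recursion turns into the one of [delay_bound] with delay coefficient [b] and
   defect [c]. *)
pose D k : R := genf z (expR eta) y k * expR (- (s * ta k)).
pose c k : R := expR (- (s * pw k)) - 1 + pw k * b k.
(* The last term is for windows that reach the end of the range, where only the trivial bound
   O(|eta|) is used. The primes k concerned have total weight at most M + 1. *)
pose e k : R := K1 * (N ^+ 3 + N / ln k%:R + N * (w k == y.+1)%:R).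
have hw k : (1 < k <= y)%N -> (k < w k <= y.+1)%N.
  by move=> /andP[k1 ky]; rewrite wend_gt wend_le.
have lk k : (1 < k)%N -> 0 < ln k%:R :> R by exact: ln_nat_gt0.
have lk2 k : (1 < k)%N -> (ln k%:R)^-1 <= (ln 2%:R)^-1 :> R.
  by move=> k1; rewrite lef_pV2 ?posrE ?lk // ln_nat_le.
have pk k : (1 < k)%N -> pw k <= (ln k%:R)^-1 :> R.
  by move=> k1; apply: le_trans (pw_le _) (inv_nat_le_inv_ln k1).
have t0 k : 0 <= t k by rewrite sumr_ge0 // => j _; exact: pw_ge0.
have tle k : (1 < k <= y)%N -> t k <= z + C / ln k%:R by move=> hk; exact: window_sum_le.
have ab k : (1 < k)%N -> 0 <= a k <= 1.
  move=> k1; apply/andP; split.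
    by rewrite /a prodr_ge0 // => j _; rewrite subr_ge0 pw_le1.
  by apply: le_trans (prod_1sub_le _ k1) _; rewrite expR_le1 oppr_le0; exact: t0.
have sN : `|s| <= B * N by rewrite es; exact: cumulant_norm_le.
have bb k : (1 < k <= y)%N -> `|b k| <= eQ * N.
  move=> hk; have /andP[k1 ky] := hk.
  have /andP[ak0 ak1] := ab k k1.
  rewrite /b /eQ (mulrC (expR 1 * _)) mulrA; apply: normM_le.
    rewrite -[leRHS]mulr1; apply: normM_le; last by rewrite ger0_norm.
    by apply: le_trans (expR_bound1 _) _; rewrite ler_wpM2l // ler_expR.
  rewrite ger0_norm ?expR_ge0 // ler_expR; apply: le_trans (ler_norm _) _; rewrite normrN.
  rewrite /Q; apply: normM_le; first by apply: le_trans sN _; rewrite ler_piMr.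
  rewrite ger0_norm ?addr_ge0 ?pw_ge0 //.
  have h1 := tle k hk; have h2 := pk k k1; have h3 := lk2 k k1.
  have h4 := ler_wpM2l (ltW C0) h3.
  have i0 : 0 <= (ln 2%:R)^-1 :> R by rewrite invr_ge0 ltW.
  by have i1 := mulr_ge0 (ltW C0) i0; rewrite /De mulrDl; lra.
have D1 : D y.+1 = 1 by rewrite /D genf_end /ta big_geq // mulr0 oppr0 expR0 mulr1.
have hD k : (1 < k <= y)%N ->
     D k - D k.+1 = pw k * b k * (D (w k) - D k.+1) + c k * D k.+1.
  move=> hk; have /andP[k1 ky] := hk; have /andP[wk1 wk2] := hw k hk.
  have e1 : ta k = pw k + ta k.+1 by rewrite /ta big_ltn.
  have e2 : ta k.+1 = t k + ta (w k) by rewrite /ta /t -big_cat_nat.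
  rewrite /D (genf_rec _ _ hk) -/w -/(a k) /c /b e1.
  rewrite (_ : - (s * (pw k + ta k.+1)) = - (s * pw k) + - (s * ta k.+1)); last by ring.
  rewrite (_ : - (s * (pw k + t k)) = - (s * pw k) + - (s * t k)); last by ring.
  rewrite e2 (_ : - (s * (t k + ta (w k))) = - (s * t k) + - (s * ta (w k))); last by ring.
  rewrite !expRD; move: (expR (- (s * pw k))) (expR (- (s * t k))) (expR (- (s * ta (w k)))).
  move: (genf z (expR eta) y k.+1) (genf z (expR eta) y (w k)) (pw k) (a k) (expR eta) => g1 g2 p a' u e4 e5 e6.
  by ring.
have hc k : (1 < k <= y)%N -> `|c k| <= pw k * e k.
  move=> hk; have /andP[k1 ky] := hk; have /andP[ak0 ak1] := ab k k1.
  have p0 : 0 <= pw k :> R by exact: pw_ge0.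
  (* The first-order change of the normalising factor is - s per unit of weight, and the choice of
     [s] makes [b k] cancel it. *)
  have -> : c k = pw k * (b k - s) + (expR (- (s * pw k)) - 1 - - (s * pw k)).
    by rewrite /c; ring.
  have c2 : `|expR (- (s * pw k)) - 1 - - (s * pw k)| <= pw k * (B ^+ 2 * expR B * (N / ln k%:R)).
    by apply: expRN_quadratic_le => //; [exact: pw_le1 | exact: pk].
  have L0 : 0 <= N / ln k%:R by rewrite divr_ge0 // ltW // lk.
  have N3' := exprn_ge0 3 N0.
  have W0 : 0 <= N * (w k == y.+1)%:R by rewrite mulr_ge0.
  have c1 : `|b k - s| <= (K0 + eQ + B) * (N ^+ 3 + N / ln k%:R + N * (w k == y.+1)%:R).
    have [wy|wy] := eqVneq (w k) y.+1.
      rewrite mulr1; apply: (@le_trans _ _ ((eQ + B) * N)).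
        by apply: le_trans (ler_normB _ _) _; rewrite mulrDl lerD // bb.
      clear -B0 eQ0 K00 N0 N3' L0.
      by apply: ler_pM => //; lra.
    rewrite mulr0 addr0.
    have wy' : (w k <= y)%N by have /andP[_] := hw k hk; rewrite leq_eqVlt (negbTE wy) ltnS.
    apply: le_trans (drift y k eta s N1 es hk wy') _.
    by rewrite ler_wpM2r //; [exact: addr_ge0 | clear -eQ0 B0; lra].
  apply: le_trans (ler_normD _ _) _.
  rewrite normrM (ger0_norm p0); apply: le_trans (lerD (ler_wpM2l p0 c1) c2) _.
  rewrite -mulrDr ler_wpM2l // /e /K1.
  move: (N * _) (N / _) (N ^+ 3) W0 L0 N3' => W L N3' W0 L0 N30.
  have h : B ^+ 2 * expR B * L <= B ^+ 2 * expR B * (N3' + L + W).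
    by rewrite ler_wpM2l //; clear -W0 L0 N30; lra.
  by clear -h; lra.
have hM j : (1 < j <= y)%N -> \sum_(2 <= k < j | (j < w k)%N) pw k <= M.
  move=> /andP[j1 jy]; apply: preceding_sum_le => // k /andP[k1 kj] jw.
  by apply: (@wend_before R z y); rewrite kj.
have hlast : \sum_(2 <= k < y.+1) pw k * (w k == y.+1)%:R <= M + 1.
  rewrite big_nat_recr //=; apply: lerD; last first.
    by rewrite -[leRHS]mulr1; apply: ler_pM; rewrite ?pw_ge0 ?lern1 ?leq_b1 ?pw_le1.
  apply: le_trans (hM y _); last by rewrite y1 leqnn.
  rewrite [leRHS]big_mkcond /=; apply: ler_sum_nat => k /andP[k1 ky].
  case: eqP => [->|_]; first by rewrite ltnSn mulr1.
  by rewrite mulr0; case: ifP => // _; exact: pw_ge0.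
pose E := K1 * (N ^+ 3 * tau + N * Cs + N * (M + 1)).
have hE : \sum_(2 <= k < y.+1) pw k * e k <= E.
  have -> : \sum_(2 <= k < y.+1) pw k * e k = K1 * (N ^+ 3 * \sum_(2 <= k < y.+1) pw k
      + N * (\sum_(2 <= k < y.+1) pw k / ln k%:R)
      + N * (\sum_(2 <= k < y.+1) pw k * (w k == y.+1)%:R)).
    rewrite !mulr_sumr -!big_split /= mulr_sumr; apply: eq_bigr => k _.
    rewrite /e; ring.
  rewrite -etau /E ler_pM2l // lerD ?lerD2l ?ler_wpM2l //.
have EK : E <= K / 4 * (N ^+ 3 * tau + N).
  rewrite /E /K.
  have r1 : 0 <= (eQ * M + 1) * (N ^+ 3 * tau + N) by rewrite mulr_ge0 //; lra.
  have r2 : 0 <= K1 * (Cs + (M + 1)) * (N ^+ 3 * tau).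
    by rewrite !mulr_ge0 ?(ltW K10) ?exprn_ge0 //; lra.
  have r3 : 0 <= K1 * N by rewrite mulr_ge0 // ltW.
  lra.
have E0 : 0 <= E by rewrite /E mulr_ge0 ?(ltW K10) // !addr_ge0 ?mulr_ge0 ?exprn_ge0 ?(ltW Cs0) //; lra.
have fin : `|D 2%N - 1| <= 2 * E.
  apply: (@delay_bound R y D pw b c e w (eQ * N) M E) => //.
  - by rewrite mulr_ge0 // ltW.
  - rewrite mulrAC; apply: (@le_trans _ _ (K / 4 * N)); last by lra.
    rewrite ler_wpM2r // /K; lra.
  - apply: le_trans EK _; lra.
  - exact: pw_ge0.
have kp : 0 <= K / 4 * (N ^+ 3 * tau + N) by apply: le_trans E0 EK.
rewrite etau -/(ta 2%N) -/(D 2%N); apply: le_trans fin _.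
rewrite /ta -etau; lra.
Qed.

(** * From moment generating functions to continuous functions *)

Lemma segment_uniform_continuous {R : realType} (f : R -> R) (a b : R) :
  {within `[a, b], continuous f} -> forall e : R, 0 < e ->
  exists2 d : R, 0 < d & forall x y, x \in `[a, b] -> y \in `[a, b] -> `|x - y| < d ->
    `|f x - f y| < e.
Proof.
move=> cf e e0.
pose A := [set` `[a, b]] : set R.
pose P (d x : R) := A x -> forall y, A y -> `|x - y| < d -> `|f x - f y| < e.
have cA : compact A by exact: segment_compact.
have : \forall d \near (0 : R)^'+, A `<=` P d.
  apply: (iffLR (compact_near_coveringP A) cA R (0 : R)^'+ P) => x Ax.
  have /subspace_continuousP /(_ x Ax) /cvgrPdist_lt /(_ (e / 2)) := cf.
  move=> /(_ ltac:(by rewrite divr_gt0)).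
  rewrite near_withinE => /nbhs_ballP [d /= d0 hd].
  have d2 : 0 < d / 2 by rewrite divr_gt0.
  near=> u v => /= Au y Ay uy.
  have xu : `|x - u| < d / 2.
    by near: u; exact: (nbhsx_ballx x _ d2).
  have vd : v < d / 2 by near: v; exact: nbhs_right_lt.
  have h1 : `|f x - f u| < e / 2 by apply: hd => //; rewrite /ball /=; lra.
  have h2 : `|f x - f y| < e / 2.
    apply: hd => //; rewrite /ball /= -[x - y](subrKA u).
    apply: le_lt_trans (ler_normD _ _) _.
    by rewrite (splitr d) ltrD // (lt_trans uy vd).
  rewrite -[f u - f y](subrKA (f x)); apply: le_lt_trans (ler_normD _ _) _.
  by rewrite (splitr e) ltrD // distrC.
move=> /(filterI (nbhs_right_gt (0 : R))) /filter_ex [d [/= d0 hd]].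
by exists d => // x y xA yA; apply: hd.
Unshelve. all: by end_near. Qed.

(* Expectation of [F] at a binomial variable with parameters [n] and [s]. *)
Fixpoint bernstein {R : realType} (n : nat) (s : R) (F : nat -> R) : R :=
  if n is n'.+1 then (1 - s) * bernstein n' s F + s * bernstein n' s (fun k => F k.+1)
  else F 0%N.

Lemma bernstein_cst {R : realType} (n : nat) (s c : R) : bernstein n s (fun=> c) = c.
Proof. by elim: n => //= n ->; ring. Qed.

Lemma bernsteinD {R : realType} (n : nat) (s : R) (F G : nat -> R) :
  bernstein n s (fun k => F k + G k) = bernstein n s F + bernstein n s G.
Proof. by elim: n F G => //= n IH F G; rewrite !IH; ring. Qed.

Lemma bernsteinZ {R : realType} (n : nat) (s a : R) (F : nat -> R) :
  bernstein n s (fun k => a * F k) = a * bernstein n s F.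
Proof. by elim: n F => //= n IH F; rewrite !IH; ring. Qed.

Lemma bernstein_le {R : realType} (n : nat) (s : R) (F G : nat -> R) : 0 <= s -> s <= 1 ->
  (forall k, (k <= n)%N -> F k <= G k) -> bernstein n s F <= bernstein n s G.
Proof.
move=> s0 s1; elim: n F G => [|n IH] F G h /=; first exact: h.
apply: lerD; first by apply: ler_wpM2l; [lra | apply: IH => k kn; apply: h; exact: leqW].
by apply: ler_wpM2l => //; apply: IH => k kn; apply: h.
Qed.

(** The shift [c] carries the induction, since the recursion passes from [F k] to [F k.+1]. At c = -
    n s this is the variance of the binomial law. *)
Lemma bernstein_sq {R : realType} (n : nat) (s c : R) :
  bernstein n s (fun k => (k%:R + c) ^+ 2) = (n%:R * s + c) ^+ 2 + n%:R * s * (1 - s).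
Proof.
elim: n c => [|n IH] c /=; first by ring.
under [X in _ + _ * bernstein n s X]eq_fun do rewrite -natr1 -addrA (addrC 1 c).
rewrite !IH -natr1; ring.
Qed.

Lemma bernstein_approx {R : realType} (H : R -> R) (B : R) :
  (forall t, t \in `[0, 1] -> `|H t| <= B) ->
  (forall e : R, 0 < e -> exists2 d : R, 0 < d & forall x y, x \in `[0, 1] -> y \in `[0, 1] ->
     `|x - y| < d -> `|H x - H y| < e) ->
  forall e : R, 0 < e -> exists n : nat, forall s, s \in `[0, 1] ->
    `|H s - bernstein n s (fun k => H (k%:R / n%:R))| <= e.
Proof.
move=> HB Hu e e0; have B0 : 0 <= B.
  by apply: le_trans (normr_ge0 _) (HB 0 _); rewrite in_itv /= lexx ler01.
have e2 : 0 < e / 2 by rewrite divr_gt0.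
have [d d0 hd] := Hu _ e2.
pose K := 2 * B / d ^+ 2; have K0 : 0 <= K by rewrite divr_ge0 ?sqr_ge0 // mulr_ge0.
pose n := (Num.truncn (K / (e / 2))).+1.
have nK : K / (e / 2) < n%:R by exact: truncnS_gt.
have n0 : 0 < n%:R :> R by rewrite ltr0n.
exists n => s; rewrite in_itv /= => /andP[s0 s1].
(* Either k / n is within [d] of [s], or (s - k / n)^2 is at least d^2 and the trivial bound 2 B
   suffices. The mean of this square is at most 1 / n. *)
have key k : (k <= n)%N ->
   `|H s - H (k%:R / n%:R)| <= e / 2 + K / n%:R ^+ 2 * (k%:R + - (n%:R * s)) ^+ 2.
  move=> kn.
  have kin : k%:R / n%:R \in `[0, (1:R)].
    by rewrite in_itv /= divr_ge0 //= ler_pdivrMr // mul1r ler_nat.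
  have sin01 : s \in `[0, (1 : R)] by rewrite in_itv /= s0.
  have -> : K / n%:R ^+ 2 * (k%:R + - (n%:R * s)) ^+ 2 = K * (s - k%:R / n%:R) ^+ 2.
    by field; rewrite gt_eqF.
  case: (ltP `|s - k%:R / n%:R| d) => sd.
    by apply: ler_wpDr; [rewrite mulr_ge0 ?sqr_ge0 | apply: ltW; exact: hd].
  apply: (@le_trans _ _ (2 * B)).
    by apply: le_trans (ler_normB _ _) _; rewrite mulr2n mulrDl mul1r lerD ?HB.
  rewrite ler_wpDl ?(ltW e2) // /K -mulrA ler_peMr ?mulr_ge0 // mulrC ler_pdivlMr ?exprn_gt0 // mul1r.
  by rewrite -[leRHS]real_normK ?num_real // lerXn2r ?nnegrE ?(ltW d0).
have -> : H s - bernstein n s (fun k => H (k%:R / n%:R)) =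
   bernstein n s (fun k => H s + -1 * H (k%:R / n%:R)).
  by rewrite bernsteinD bernsteinZ bernstein_cst mulN1r.
have bd : bernstein n s (fun k => e / 2 + K / n%:R ^+ 2 * (k%:R + - (n%:R * s)) ^+ 2) <= e.
  rewrite bernsteinD bernstein_cst bernsteinZ bernstein_sq subrr expr0n /= add0r.
  have ss : s * (1 - s) <= 1 by nra.
  have : K / n%:R ^+ 2 * (n%:R * s * (1 - s)) <= e / 2; last by lra.
  have -> : K / n%:R ^+ 2 * (n%:R * s * (1 - s)) = K / n%:R * (s * (1 - s)).
    by field; rewrite gt_eqF.
  apply: (@le_trans _ _ (K / n%:R)); first by rewrite ler_piMr // divr_ge0.
  by rewrite ler_pdivrMr // mulrC -ler_pdivrMr // ltW.
rewrite ler_norml; apply/andP; split.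
  rewrite lerNl.
  have -> : - bernstein n s (fun k => H s + -1 * H (k%:R / n%:R)) =
      bernstein n s (fun k => -1 * (H s + -1 * H (k%:R / n%:R))).
    by rewrite (bernsteinZ _ _ (-1)) mulN1r.
  apply: le_trans bd; apply: bernstein_le => // k kn.
  by apply: le_trans (key k kn); rewrite -normrN; apply: le_trans (ler_norm _); lra.
apply: le_trans bd; apply: bernstein_le => // k kn.
by apply: le_trans (key k kn); apply: le_trans (ler_norm _); lra.
Qed.

(** * Integrals against the normal law *)

Lemma integral_normal_prob_ge0 {R : realType} (f : R -> R) :
  measurable_fun setT f -> (forall x, 0 <= f x) ->
  (\int[normal_prob (0 : R) 1]_x (f x)%:E =
   \int[lebesgue_measure]_x (f x * normal_pdf 0 1 x)%:E)%E.
Proof.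
move=> mf f0; have dom := @normal_prob_dominates R 0 1.
have mf' : measurable_fun setT (fun x => (f x)%:E) by exact/measurable_EFinP.
rewrite -(Radon_Nikodym_SigmaFinite.change_of_variables dom) //=.
have hi := Radon_Nikodym_SigmaFinite.f_integrable dom.
apply: ae_eq_integral => //=.
- apply: emeasurable_funM => //; exact: (measurable_int _ hi).
- by apply/measurable_EFinP; apply: measurable_funM => //; exact: measurable_normal_pdf.
(* The Radon-Nikodym derivative and the normal density have the same integral over every measurable
   set, so they agree almost everywhere. *)
- under [X in ae_eq _ _ _ X]eq_fun do rewrite EFinM.
  apply: ae_eqe_mul2l => /=; apply: integral_ae_eq => //=.
  + by apply/measurable_EFinP; exact: measurable_normal_pdf.
  + by move=> E _ mE; rewrite -Radon_Nikodym_SigmaFinite.f_integral.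
Qed.

Lemma integral_normal_expR {R : realType} (xi : R) :
  (\int[normal_prob (0 : R) 1]_x (expR (xi * x))%:E = (expR (xi ^+ 2 / 2))%:E)%E.
Proof.
rewrite integral_normal_prob_ge0; last 2 first.
- by apply: measurableT_comp => //=; exact: measurable_funM.
- by move=> x; exact: expR_ge0.
(* Completing the square moves the mean of the density to [xi]. *)
transitivity (\int[lebesgue_measure]_x ((expR (xi ^+ 2 / 2))%:E * (normal_pdf xi 1 x)%:E))%E.
  apply: eq_integral => x _; rewrite -EFinM; congr EFin.
  rewrite !normal_pdfE ?oner_neq0 // mulrCA [RHS]mulrCA; congr (_ * _).
  rewrite /normal_fun -!expRD; congr expR; by field.
rewrite integralZl //; last exact: integrable_normal_pdf.
by rewrite integral_normal_pdf mule1.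
Qed.

Lemma expR_norm_le {R : realType} (M x : R) : 0 <= M ->
  expR (M * `|x|) <= expR (M * x) + expR (- M * x).
Proof.
move=> M0; case: (leP 0 x) => x0; first by rewrite ger0_norm // lerDl expR_ge0.
by rewrite ltr0_norm // mulrN mulNr lerDr expR_ge0.
Qed.

Lemma integrable_normal_expR {R : realType} (xi : R) :
  (normal_prob (0 : R) 1).-integrable setT (EFin \o (fun x => expR (xi * x))).
Proof.
apply/integrableP; split.
  by apply/measurable_EFinP; apply: measurableT_comp => //=; exact: measurable_funM.
under eq_integral do rewrite /= ger0_norm ?expR_ge0 //.
by rewrite integral_normal_expR ltry.
Qed.

Lemma integrable_normal_dom {R : realType} (f : R -> R) (C M : R) : 0 <= M ->
  measurable_fun setT f -> (forall x, `|f x| <= C * expR (M * `|x|)) ->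
  (normal_prob (0 : R) 1).-integrable setT (EFin \o f).
Proof.
move=> M0 mf hf.
have C0 : 0 <= C.
  by have := le_trans (normr_ge0 _) (hf 0); rewrite normr0 mulr0 expR0 mulr1.
have i1 := integrable_normal_expR M; have i2 := integrable_normal_expR (- M).
have i3 := integrableZl measurableT C (integrableD measurableT i1 i2).
apply: (le_integrable measurableT _ _ i3); first exact/measurable_EFinP.
move=> x _ /=; rewrite lee_fin; apply: le_trans (hf x) _.
apply: le_trans (ler_norm _); rewrite ler_wpM2l //; exact: expR_norm_le.
Qed.

(** * Functions whose means converge *)

Definition gexp {R : realType} (f : R -> R) : R := \int[normal_prob (0 : R) 1]_x f x.

Definition expdom {R : realType} (f : R -> R) := exists C M : R,
  [/\ 0 <= C, 0 <= M & forall x, `|f x| <= C * expR (M * `|x|)].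

Lemma expdom_integrable {R : realType} (f : R -> R) : measurable_fun setT f -> expdom f ->
  (normal_prob (0 : R) 1).-integrable setT (EFin \o f).
Proof. by move=> mf [C [M [C0 M0 h]]]; exact: integrable_normal_dom h. Qed.

Definition emean {R : realType} (Z : nat -> nat -> R) (n : nat) (f : R -> R) : R :=
  n%:R^-1 * \sum_(1 <= m < n.+1) f (Z n m).

Lemma emeanDZ {R : realType} (Z : nat -> nat -> R) (n : nat) (a b : R) (f g : R -> R) :
  emean Z n (fun x => a * f x + b * g x) = a * emean Z n f + b * emean Z n g.
Proof. by rewrite /emean big_split /= -!mulr_sumr; ring. Qed.

Lemma emean_norm_le {R : realType} (Z : nat -> nat -> R) (n : nat) (f g : R -> R) :
  (forall x, `|f x| <= g x) -> `|emean Z n f| <= emean Z n g.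
Proof.
move=> h; rewrite /emean normrM ger0_norm ?invr_ge0 // ler_wpM2l ?invr_ge0 //.
by apply: le_trans (ler_norm_sum _ _ _) _; apply: ler_sum.
Qed.

Definition mcv {R : realType} (Z : nat -> nat -> R) (f : R -> R) :=
  [/\ measurable_fun setT f, expdom f & emean Z n f @[n --> \oo] --> gexp f].

Lemma expdomDZ {R : realType} (a b : R) (f g : R -> R) : expdom f -> expdom g ->
  expdom (fun x => a * f x + b * g x).
Proof.
move=> [C [M [C0 M0 hf]]] [D [N [D0 N0 hg]]].
exists (`|a| * C + `|b| * D), (M + N); split; rewrite ?addr_ge0 ?mulr_ge0 // => x.
apply: le_trans (ler_normD _ _) _; rewrite !normrM mulrDl -!mulrA; apply: lerD.
  rewrite ler_wpM2l //; apply: le_trans (hf x) _; rewrite ler_wpM2l // ler_expR ler_wpM2r //.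
  by rewrite lerDl.
rewrite ler_wpM2l //; apply: le_trans (hg x) _; rewrite ler_wpM2l // ler_expR ler_wpM2r //.
by rewrite lerDr.
Qed.

Lemma mcvDZ {R : realType} (Z : nat -> nat -> R) (a b : R) (f g : R -> R) :
  mcv Z f -> mcv Z g -> mcv Z (fun x => a * f x + b * g x).
Proof.
move=> [mf df cf] [mg dg cg].
have ma : measurable_fun setT (fun x => a * f x) by exact: measurable_funM.
have mb : measurable_fun setT (fun x => b * g x) by exact: measurable_funM.
split; [exact: measurable_funD | exact: expdomDZ |].
under eq_fun do rewrite emeanDZ.
have -> : gexp (fun x => a * f x + b * g x) = a * gexp f + b * gexp g.
  have if_ := expdom_integrable mf df; have ig := expdom_integrable mg dg.
  rewrite /gexp RintegralD //; last 2 first.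
  - exact: integrableZl if_.
  - exact: integrableZl ig.
  by rewrite !RintegralZl.
by apply: cvgD; apply: cvgM => //; exact: cvg_cst.
Qed.

Lemma gexp_dist_le {R : realType} (f g : R -> R) (e M : R) :
  measurable_fun setT f -> measurable_fun setT g -> expdom f -> expdom g -> 0 <= M -> 0 <= e ->
  (forall x, `|f x - g x| <= e * expR (M * `|x|)) ->
  `|gexp f - gexp g| <= e * (2 * expR (M ^+ 2 / 2)).
Proof.
move=> mf mg df dg M0 e0 h.
have if_ := expdom_integrable mf df; have ig := expdom_integrable mg dg.
have i1 := integrable_normal_expR M; have i2 := integrable_normal_expR (- M).
have i12 := integrableD measurableT i1 i2.
have iw := integrableZl measurableT e i12.
have ew : \int[normal_prob (0 : R) 1]_x (e * (expR (M * x) + expR (- M * x)))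
    = e * (2 * expR (M ^+ 2 / 2)).
  rewrite RintegralZl // RintegralD // /Rintegral !integral_normal_expR /= sqrrN.
  by ring.
rewrite -ew /gexp -RintegralB // ; have idiff := integrableB measurableT if_ ig.
have hx x : `|f x - g x| <= e * (expR (M * x) + expR (- M * x)).
  by apply: le_trans (h x) _; rewrite ler_wpM2l // expR_norm_le.
rewrite ler_norml; apply/andP; split; last first.
  by apply: le_Rintegral => // x _; apply: le_trans (ler_norm _) (hx x).
rewrite lerNl -mulN1r -RintegralZl //; apply: le_Rintegral => //.
  exact: integrableZl idiff.
by move=> x _; rewrite mulN1r; apply: le_trans (hx x); rewrite -normrN ler_norm.
Qed.

(** The weight exp (M |x|) is at most exp (M x) + exp (- M x), whose means converge. So a weighted
    error e costs O(e) in the Gaussian mean and, for large n, in the empirical one. *)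
Lemma mcv_approx {R : realType} (Z : nat -> nat -> R) (f : R -> R) (M : R) :
  (forall xi, emean Z n (fun x => expR (xi * x)) @[n --> \oo] --> expR (xi ^+ 2 / 2)) ->
  measurable_fun setT f -> 0 <= M ->
  (forall e : R, 0 < e -> exists2 g, mcv Z g & forall x, `|f x - g x| <= e * expR (M * `|x|)) ->
  mcv Z f.
Proof.
move=> mgf mf M0 ap.
have df : expdom f.
  have [g [_ [C [N [C0 N0 hg]]] _] hfg] := ap 1 ltr01.
  exists (C + 1), (N + M); split; rewrite ?addr_ge0 // => x.
  rewrite -[f x](subrK (g x)); apply: le_trans (ler_normD _ _) _.
  rewrite mulrDl addrC; apply: lerD.
    apply: le_trans (hg x) _; rewrite ler_wpM2l // ler_expR ler_wpM2r // lerDl //.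
  by apply: le_trans (hfg x) _; rewrite ler_wpM2l // ler_expR ler_wpM2r // lerDr.
split => //; apply/cvgrPdist_lt => e e0.
(* Bounds the mean of the weight on both sides; the 2 allows each of the two empirical means to be 1
   above its limit. *)
pose B : R := 2 * expR (M ^+ 2 / 2) + 2.
have B0 : 0 < B by rewrite /B; have := expR_gt0 (M ^+ 2 / 2); lra.
pose d := e / (4 * B); have d0 : 0 < d by rewrite divr_gt0 // mulr_gt0.
have [g [mg dg cg] hfg] := ap d d0.
have dB : d * B = e / 4 by rewrite /d; field; rewrite gt_eqF.
have e4 : 0 < e / 4 by rewrite divr_gt0.
have h1 : `|gexp f - gexp g| <= e / 4.
  rewrite -dB; apply: le_trans (gexp_dist_le mf mg df dg M0 (ltW d0) hfg) _.
  by rewrite ler_wpM2l ?(ltW d0) // /B; lra.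
have [c1 c2] := (mgf M, mgf (- M)); rewrite sqrrN in c2.
near=> n.
have a1 : `|expR (M ^+ 2 / 2) - emean Z n (fun x => expR (M * x))| < 1.
  by near: n; move/cvgrPdist_lt : c1; apply.
have a2 : `|expR (M ^+ 2 / 2) - emean Z n (fun x => expR (- M * x))| < 1.
  by near: n; move/cvgrPdist_lt : c2; apply.
have a3 : `|gexp g - emean Z n g| < e / 4.
  by near: n; move/cvgrPdist_lt : cg; apply.
have a4 : `|emean Z n g - emean Z n f| <= e / 4.
  have -> : emean Z n g - emean Z n f = emean Z n (fun x => 1 * g x + -1 * f x).
    by rewrite emeanDZ; ring.
  have W : d * emean Z n (fun x => 1 * expR (M * x) + 1 * expR (- M * x)) <= e / 4.
    rewrite -dB ler_wpM2l ?(ltW d0) // emeanDZ !mul1r /B.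
    by move: a1 a2; rewrite !ltr_norml => /andP[? ?] /andP[? ?]; lra.
  apply: (@le_trans _ _ (emean Z n (fun x =>
    d * (1 * expR (M * x) + 1 * expR (- M * x)) + 0 * 0))).
    apply: emean_norm_le => x; rewrite mul1r mulN1r distrC mul0r addr0 !mul1r.
    by apply: le_trans (hfg x) _; rewrite ler_wpM2l ?(ltW d0) // expR_norm_le.
  by apply: le_trans W; rewrite (emeanDZ _ _ d 0 _ (fun=> 0)) mul0r addr0.
rewrite -[_ - _](subrKA (gexp g)); apply: le_lt_trans (ler_normD _ _) _.
rewrite -[gexp g - emean Z n f](subrKA (emean Z n g)).
apply: le_lt_trans (lerD (lexx _) (ler_normD _ _)) _; lra.
Unshelve. all: by end_near. Qed.

(* Unlike [mcv], this class is stable under multiplication by [x] and by [sin (a x)]. *)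
Definition mcvw {R : realType} (Z : nat -> nat -> R) (f : R -> R) :=
  measurable_fun setT f /\ forall xi, mcv Z (fun x => f x * expR (xi * x)).

Definition mgf_cvg {R : realType} (Z : nat -> nat -> R) :=
  forall xi, emean Z n (fun x => expR (xi * x)) @[n --> \oo] --> expR (xi ^+ 2 / 2).

Lemma mcvw1 {R : realType} (Z : nat -> nat -> R) : mgf_cvg Z -> mcvw Z (fun=> 1).
Proof.
move=> mgf; split; first exact: measurable_cst.
move=> xi; under eq_fun do rewrite mul1r; split.
- by apply: measurableT_comp => //=; exact: measurable_funM.
- exists 1, `|xi|; split => // x; rewrite ger0_norm ?expR_ge0 // mul1r ler_expR.
  by rewrite -normrM ler_norm.
- by rewrite /gexp /Rintegral integral_normal_expR /=; exact: mgf.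
Qed.

Lemma mcvwDZ {R : realType} (Z : nat -> nat -> R) (a b : R) (f g : R -> R) :
  mcvw Z f -> mcvw Z g -> mcvw Z (fun x => a * f x + b * g x).
Proof.
move=> [mf hf] [mg hg]; split.
  by apply: measurable_funD; exact: measurable_funM.
move=> xi; under eq_fun do rewrite mulrDl -!mulrA; exact: mcvDZ.
Qed.

Lemma mcvw_sum {R : realType} (Z : nat -> nat -> R) (n : nat) (c : nat -> R) (F : nat -> R -> R) :
  mgf_cvg Z -> (forall i, mcvw Z (F i)) -> mcvw Z (fun x => \sum_(0 <= i < n) c i * F i x).
Proof.
move=> mgf hF; elim: n => [|n IH].
  have := mcvwDZ 0 0 (mcvw1 mgf) (mcvw1 mgf).
  by under eq_fun do rewrite !mul0r addr0; under [X in _ -> mcvw _ X]eq_fun do rewrite big_geq //.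
have := mcvwDZ 1 (c n) IH (hF n).
by under eq_fun do rewrite mul1r; under [X in _ -> mcvw _ X]eq_fun do rewrite big_nat_recr //=.
Qed.

(** x exp (xi x) is the derivative of exp (xi x) in xi. A difference quotient of step [d] is a
    combination of admissible functions, and its error is O(d) against the extra weight exp (2
    |x|). *)
Lemma mcvw_id {R : realType} (Z : nat -> nat -> R) (f : R -> R) : mgf_cvg Z ->
  mcvw Z f -> mcvw Z (fun x => x * f x).
Proof.
move=> mgf [mf hf]; split; first exact: measurable_funM.
move=> xi; have [mfx [C [M [C0 M0 hC]]] _] := hf xi.
apply: (@mcv_approx _ _ _ (M + 2)) => //; first 2 last.
- move=> e e0; pose d : R := Num.min 1 (e / (2 * C + 1)).
  have C1 : 0 < 2 * C + 1 by lra.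
  have d0 : 0 < d by rewrite lt_min ltr01 divr_gt0.
  have d1 : d <= 1 by rewrite ge_min lexx.
  have de : d * (2 * C) <= e.
    apply: (@le_trans _ _ (d * (2 * C + 1))); first by rewrite ler_wpM2l ?(ltW d0) //; lra.
    by rewrite -ler_pdivlMr // ge_min lexx orbT.
  exists (fun x => d^-1 * (f x * expR ((xi + d) * x)) + (- d^-1) * (f x * expR (xi * x))).
    exact: mcvDZ.
  move=> x.
  have -> : x * f x * expR (xi * x) - (d^-1 * (f x * expR ((xi + d) * x)) + - d^-1 * (f x * expR (xi * x)))
     = (f x * expR (xi * x)) * (- d^-1 * (expR (d * x) - 1 - d * x)).
    by rewrite mulrDl expRD; field; rewrite gt_eqF.
  rewrite normrM.
  have h2 : `|- d^-1 * (expR (d * x) - 1 - d * x)| <= d * 2 * expR (2 * `|x|).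
    rewrite normrM normrN normfV (gtr0_norm d0) ler_pdivrMl //.
    apply: le_trans (expR_bound2 _) _.
    have k1 : expR `|d * x| <= expR `|x| by rewrite ler_expR normrM gtr0_norm // ler_piMl.
    have k2 : x ^+ 2 <= 2 * expR `|x|.
      have := pow_fact_le_expR 2 (normr_ge0 x); rewrite real_normK ?num_real //.
      by rewrite ler_pdivrMr // mulrC.
    have -> : d * (d * 2 * expR (2 * `|x|)) = d ^+ 2 * (2 * expR `|x|) * expR `|x|.
      rewrite [X in expR X](_ : _ = `|x| + `|x|); last by ring.
      by rewrite expRD; ring.
    rewrite exprMn; apply: ler_pM => //; first by rewrite mulr_ge0 ?sqr_ge0.
    by rewrite ler_wpM2l ?sqr_ge0.
  apply: le_trans (ler_pM _ _ (hC x) h2) _ => //.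
  have -> : C * expR (M * `|x|) * (d * 2 * expR (2 * `|x|)) = d * (2 * C) * expR ((M + 2) * `|x|).
    by rewrite (mulrDl M 2) expRD; ring.
  by rewrite ler_wpM2r ?expR_ge0.
- apply: measurable_funM; first exact: measurable_funM.
  by apply: measurableT_comp => //=; exact: measurable_funM.
- by rewrite addr_ge0.
Qed.

Lemma mcvw_pow {R : realType} (Z : nat -> nat -> R) (f : R -> R) (n : nat) : mgf_cvg Z ->
  mcvw Z f -> mcvw Z (fun x => x ^+ n * f x).
Proof.
move=> mgf hf; elim: n => [|n IH]; first by under eq_fun do rewrite expr0 mul1r.
by under eq_fun do rewrite exprS -mulrA; exact: mcvw_id.
Qed.

Lemma measurable_sin_scale {R : realType} (a : R) :
  measurable_fun setT (fun x : R => sin (a * x)).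
Proof.
apply: (measurableT_comp (f := sin)); last exact: measurable_funM.
by apply: continuous_measurable_fun; exact: continuous_sin.
Qed.

Lemma mcvw_sin {R : realType} (Z : nat -> nat -> R) (f : R -> R) (a : R) : mgf_cvg Z ->
  mcvw Z f -> mcvw Z (fun x => sin (a * x) * f x).
Proof.
move=> mgf hf'; have [mf hf] := hf'.
split; first by apply: measurable_funM => //; exact: measurable_sin_scale.
move=> xi; have [mfx [C [M [C0 M0 hC]]] _] := hf xi.
apply: (@mcv_approx _ _ _ (M + 3 * `|a|)) => //; first 2 last.
- move=> e e0; pose n := (Num.truncn (C / e)).+1.
  have nC : C / e < n%:R by exact: truncnS_gt.
  pose c i : R := (odd i)%:R * (-1) ^+ i.-1./2 * a ^+ i / i`!%:R.
  have [_ /(_ xi) hg] := mcvw_sum n c mgf (fun i => mcvw_pow i mgf hf').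
  exists (fun x => (\sum_(0 <= i < n) c i * (x ^+ i * f x)) * expR (xi * x)) => // x.
  have -> : sin (a * x) * f x * expR (xi * x) - (\sum_(0 <= i < n) c i * (x ^+ i * f x)) * expR (xi * x)
     = (f x * expR (xi * x)) * (sin (a * x) -
        \sum_(0 <= i < n) (odd i)%:R * (-1) ^+ i.-1./2 * (a * x) ^+ i / i`!%:R).
    rewrite mulrBr mulr_sumr mulr_suml; congr (_ - _); first by ring.
    by apply: eq_bigr => i _; rewrite /c exprMn; ring.
  rewrite normrM; apply: le_trans (ler_pM _ _ (hC x) (sin_taylor (a * x) n)) _ => //.
  (* The Taylor error is not uniformly small in x. Giving up a factor exp (2 |a x|) gains 2^(-n) for
     all x, while the exponential weight does not depend on n. *)
  have h1 : `|a * x| ^+ n / n`!%:R <= 2 ^- n * expR (2 * `|a * x|).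
    rewrite -ler_pdivrMl ?invr_gt0 ?exprn_gt0 // invrK mulrA -exprMn.
    by apply: pow_fact_le_expR; rewrite mulr_ge0.
  have h2 : C * 2 ^- n <= e.
    rewrite ler_pdivrMr ?exprn_gt0 // mulrC -ler_pdivrMr // ltW //; apply: lt_le_trans nC _.
    by rewrite -natrX ler_nat ltnW // ltn_expl.
  apply: (@le_trans _ _ (C * expR (M * `|x|) * (2 ^- n * expR (2 * `|a * x|) * expR `|a * x|))).
    by rewrite ler_wpM2l ?mulr_ge0 ?expR_ge0 // ler_wpM2r ?expR_ge0.
  have -> : C * expR (M * `|x|) * (2 ^- n * expR (2 * `|a * x|) * expR `|a * x|)
     = C * 2 ^- n * expR ((M + 3 * `|a|) * `|x|).
    rewrite -(mulrA (2 ^- n)) -expRD mulrACA -expRD normrM; congr (_ * expR _); ring.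
  by rewrite ler_wpM2r ?expR_ge0.
- apply: measurable_funM; last by apply: measurableT_comp => //=; exact: measurable_funM.
  by apply: measurable_funM => //; exact: measurable_sin_scale.
- by rewrite addr_ge0 ?mulr_ge0.
Qed.

Lemma mcvw_bernstein {R : realType} (Z : nat -> nat -> R) (a : R) (n : nat) (F : nat -> R) :
  mgf_cvg Z -> mcvw Z (fun x => bernstein n ((1 + sin (a * x)) / 2) F).
Proof.
move=> mgf; elim: n F => [|n IH] F /=.
  have := mcvwDZ (F 0%N) 0 (mcvw1 mgf) (mcvw1 mgf).
  by under eq_fun do rewrite mulr1 mul0r addr0.
have h1 := IH F; have h2 := IH (fun k => F k.+1).
have := mcvwDZ 1 1 (mcvwDZ (1 / 2) (- (1 / 2)) h1 (mcvw_sin a mgf h1))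
                   (mcvwDZ (1 / 2) (1 / 2) h2 (mcvw_sin a mgf h2)).
by congr (mcvw Z _); apply/funext => x; field.
Qed.

Lemma mcv_continuous {R : realType} (Z : nat -> nat -> R) (g : R -> R) : mgf_cvg Z ->
  continuous g -> expdom g -> mcv Z g.
Proof.
move=> mgf cg [C [M [C0 M0 hC]]].
have mg : measurable_fun setT g by exact: continuous_measurable_fun.
apply: (@mcv_approx _ _ _ (M + 1)) => //; first by rewrite addr_ge0.
move=> e e0.
have e2 : 0 < e / 2 by rewrite divr_gt0.
(* Beyond [L] the additional weight exp |x| is at least exp L, and by exp L >= 1 + L this outweighs
   the crude bound 2 C exp (M |x|) by the factor that [e / 2] requires. *)
pose L : R := 2 * C / (e / 2) + 1.
have L0 : 0 < L by rewrite ltr_pwDr // divr_ge0 ?mulr_ge0 // ltW.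
have CL : 2 * C * expR (- L) <= e / 2.
  rewrite expRN ler_pdivrMr ?expR_gt0 // (mulrC (e / 2)) -ler_pdivrMr //.
  apply: le_trans (expR_ge1Dx L); rewrite /L; lra.
pose a : R := pi / 2 / L.
have p0 : 0 < pi / 2 :> R by rewrite divr_gt0 ?pi_gt0.
have a0 : 0 < a by rewrite divr_gt0.
have aL : a * L = pi / 2 by rewrite /a divfK // gt_eqF.
(* [phi] maps the line into [0, 1] and is injective on [-L, L] with inverse [psi]. Thus g o psi is a
   continuous function on [0, 1], and composing it with [phi] gives a bounded periodic function that
   equals g on [-L, L]. *)
pose phi (x : R) : R := (1 + sin (a * x)) / 2.
pose psi (t : R) : R := asin (2 * t - 1) / a.
have phi01 x : phi x \in `[0, 1].
  rewrite in_itv /= /phi; have := sin_geN1 (a * x); have := sin_le1 (a * x).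
  by move=> ? ?; apply/andP; split; lra.
have can x : x \in `[- L, L] -> psi (phi x) = x.
  rewrite in_itv /= => /andP[x1 x2]; rewrite /psi /phi.
  rewrite (_ : 2 * ((1 + sin (a * x)) / 2) - 1 = sin (a * x)); last by field.
  rewrite sinK; first by rewrite mulrC mulKf // gt_eqF.
  by rewrite in_itv /= -aL -mulrN !ler_pM2l // x1 x2.
have phiL : phi L = 1 by rewrite /phi aL sin_pihalf; field.
have phiNL : phi (- L) = 0 by rewrite /phi mulrN aL sinN sin_pihalf; field.
have psiL t : t \in `[0, 1] -> psi t \in `[- L, L].
  rewrite !in_itv /= => /andP[t0 t1].
  have h : -1 <= 2 * t - 1 <= 1 by apply/andP; split; lra.
  rewrite /psi ler_pdivrMr // ler_pdivlMr // mulNr (mulrC L) aL.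
  by rewrite asin_geNpi2 // asin_lepi2.
have cphi : {within `[- L, L], continuous phi}.
  apply: continuous_subspaceT => x; apply: cvgM; last exact: cvg_cst.
  apply: cvgD; first exact: cvg_cst.
  apply: (cvg_comp _ sin); last exact: continuous_sin.
  by apply: cvgM; [exact: cvg_cst | exact: cvg_id].
have cpsi : {within `[0, 1], continuous psi}.
  rewrite -phiL -phiNL; apply: segment_can_le_continuous => //.
  by rewrite ge0_cp // ltW.
have cg' : {within `[- L, L], continuous g} by apply: continuous_subspaceT.
have HB t : t \in `[0, 1] -> `|g (psi t)| <= C * expR (M * L).
  move=> /psiL; rewrite in_itv /= => h; apply: le_trans (hC _) _.
  by rewrite ler_wpM2l // ler_expR ler_wpM2l // ler_norml.
have HU (e' : R) : 0 < e' -> exists2 d : R, 0 < d & forall x y, x \in `[0, 1] -> y \in `[0, 1] ->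
     `|x - y| < d -> `|g (psi x) - g (psi y)| < e'.
  move=> e'0; have [d1 d10 h1] := segment_uniform_continuous cg' e'0.
  have [d d0 h2] := segment_uniform_continuous cpsi d10.
  by exists d => // x y x01 y01 xy; apply: h1; [exact: psiL | exact: psiL | exact: h2].
have [n hn] := bernstein_approx HB HU e2.
exists (fun x => bernstein n (phi x) (fun k => g (psi (k%:R / n%:R)))).
  have [_ /(_ 0)] := mcvw_bernstein a n (fun k => g (psi (k%:R / n%:R))) mgf.
  by under eq_fun do rewrite mul0r expR0 mulr1.
move=> x; rewrite -[_ - _](subrKA (g (psi (phi x)))); apply: le_trans (ler_normD _ _) _.
have E1 : 1 <= expR ((M + 1) * `|x|) by rewrite -expR0 ler_expR mulr_ge0 // addr_ge0.
have h1 := hn _ (phi01 x).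
have h2 : e / 2 <= e / 2 * expR ((M + 1) * `|x|) by rewrite ler_peMr // ltW.
have : `|g x - g (psi (phi x))| <= e / 2 * expR ((M + 1) * `|x|); last by lra.
case: (boolP (x \in `[- L, L])) => xL.
  by rewrite can // subrr normr0 mulr_ge0 ?(ltW e2) ?expR_ge0.
have xL' : L < `|x|.
  by move: xL; rewrite in_itv /= -ler_norml -ltNge.
have k1 : `|g (psi (phi x))| <= C * expR (M * `|x|).
  apply: le_trans (HB _ (phi01 x)) _; rewrite ler_wpM2l // ler_expR ler_wpM2l // ltW //.
apply: le_trans (ler_normB _ _) _; apply: le_trans (lerD (hC x) k1) _.
have -> : C * expR (M * `|x|) + C * expR (M * `|x|) = 2 * C * expR (- L) * expR (L + M * `|x|).
  by rewrite expRD expRN; field; rewrite gt_eqF ?expR_gt0.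
apply: ler_pM => //; rewrite ?mulr_ge0 ?expR_ge0 // ler_expR mulrDl mul1r addrC lerD2l ltW //.
Qed.

(** * Transfer to the integers *)

(** Testing primality here matches [pw], which vanishes at composites, and lets [ps] be an interval
    of integers. *)
Definition sel (ps : seq nat) (m : nat) : seq nat := [seq p <- ps | prime p && (p %| m)%N].
Arguments sel : simpl never.

Lemma count_multiples {R : realType} (n d : nat) : (0 < d)%N ->
  \sum_(1 <= m < n.+1 | (d %| m)%N) 1 = (n %/ d)%:R :> R.
Proof.
move=> d0; elim: n => [|n IH]; first by rewrite big_geq // div0n.
rewrite big_mkcond big_nat_recr //= -big_mkcond IH divnS // natrD addrC.
by case: (d %| n.+1)%N.
Qed.

(** This is d^(-kappa) for d > 0. *)
Definition rankin {R : realType} (kappa : R) (d : nat) : R := expR (- (kappa * ln d%:R)).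

Lemma rankinM {R : realType} (kappa : R) (d p : nat) : (0 < d)%N -> (0 < p)%N ->
  rankin kappa (d * p) = rankin kappa d * rankin kappa p.
Proof.
move=> d0 p0; rewrite /rankin natrM lnM ?posrE ?ltr0n // -expRD; congr expR; ring.
Qed.

(** The error is at most 1 / n and at most 1 / d, hence at most the weighted geometric mean of the
    two. That mean is multiplicative in d, so the errors over all squarefree d form an Euler
    product. *)
Lemma divn_error_le {R : realType} (kappa : R) (n d : nat) : 0 <= kappa -> kappa <= 1 ->
  (0 < n)%N -> (0 < d)%N ->
  `|n%:R^-1 * (n %/ d)%:R - d%:R^-1| <= expR (- ((1 - kappa) * ln n%:R)) * rankin kappa d.
Proof.
move=> k0 k1 n0 d0.
have n0' : 0 < n%:R :> R by rewrite ltr0n.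
have d0' : 0 < d%:R :> R by rewrite ltr0n.
have lo : n%:R / d%:R - 1 <= (n %/ d)%:R :> R.
  rewrite lerBlDr ler_pdivrMr // natr1 -natrM ler_nat.
  by apply: ltnW; rewrite -ltn_divLR.
have up : (n %/ d)%:R <= n%:R / d%:R :> R by rewrite ler_pdivlMr // -natrM ler_nat leq_trunc_div.
have q0 : 0 <= (n %/ d)%:R :> R by [].
have up' : n%:R^-1 * (n %/ d)%:R <= d%:R^-1 :> R.
  by rewrite mulrC ler_pdivrMr // mulrC.
have b1 : `|n%:R^-1 * (n %/ d)%:R - d%:R^-1| <= d%:R^-1 :> R.
  rewrite distrC ger0_norm ?subr_ge0 // gerBl mulr_ge0 // invr_ge0 ltW //.
have b2 : `|n%:R^-1 * (n %/ d)%:R - d%:R^-1| <= n%:R^-1 :> R.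
  rewrite distrC ger0_norm ?subr_ge0 // lerBlDr.
  have := ler_wpM2l (ltW (_ : 0 < n%:R^-1)) lo; rewrite invr_gt0 => /(_ n0').
  by rewrite mulrBr mulr1 mulKf ?gt_eqF // lerBlDr addrC.
have ie (k : nat) : (0 < k)%N -> k%:R^-1 = expR (- ln k%:R) :> R.
  by move=> kk; rewrite expRN lnK // posrE ltr0n.
rewrite /rankin -expRD; case: (leqP d n) => dn.
  apply: le_trans b2 _; rewrite ie // ler_expR.
  have := ler_wpM2l k0 (@ln_nat_le R d n d0 dn); lra.
apply: le_trans b1 _; rewrite ie // ler_expR.
have k1' : 0 <= 1 - kappa by lra.
have := ler_wpM2l k1' (@ln_nat_le R n d n0 (ltnW dn)); lra.
Qed.

Lemma sel_cons_prime (p : nat) (ps : seq nat) (m : nat) : prime p ->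
  sel (p :: ps) m = if (p %| m)%N then p :: sel ps m else sel ps m.
Proof. by move=> pp; rewrite /sel /= pp. Qed.

Lemma sel_cons_composite (p : nat) (ps : seq nat) (m : nat) : ~~ prime p ->
  sel (p :: ps) m = sel ps m.
Proof. by move=> /negbTE pp; rewrite /sel /= pp. Qed.

Lemma sum_sel_cons {R : realType} (p : nat) (ps : seq nat) (n d : nat) (F : seq nat -> R) :
  prime p -> coprime d p ->
  \sum_(1 <= m < n.+1 | (d %| m)%N) F (sel (p :: ps) m) =
  \sum_(1 <= m < n.+1 | (d %| m)%N) F (sel ps m) +
  \sum_(1 <= m < n.+1 | (d * p %| m)%N) (F (p :: sel ps m) - F (sel ps m)).
Proof.
move=> pp cdp; rewrite big_mkcond [X in _ = X + _]big_mkcond [X in _ = _ + X]big_mkcond.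
rewrite -big_split /=.
apply: eq_bigr => m _; rewrite sel_cons_prime // Gauss_dvd //.
case: (d %| m)%N => /=; last by rewrite addr0.
by case: (p %| m)%N; rewrite ?addr0 // addrC subrK.
Qed.

(** The expansion over squarefree divisors is hidden in the induction: removing a prime p from the
    list leaves the sum over multiples of d, and a sum over multiples of d p with [F] replaced by
    its difference at p. This is why [d], [F] and [K] are general; the difference satisfies the same
    bound with K (c + 1). *)
Lemma sel_mean_bexp_dist {R : realType} (kappa c : R) (n : nat) (ps : seq nat) :
  0 <= kappa -> kappa <= 1 -> 0 <= c -> (0 < n)%N -> uniq ps ->
  forall (d : nat) (F : seq nat -> R) (K : R), (0 < d)%N -> 0 <= K ->
  (forall p, p \in ps -> prime p -> coprime d p) ->
  (forall S, `|F S| <= K * c ^+ size S) ->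
  `|n%:R^-1 * \sum_(1 <= m < n.+1 | (d %| m)%N) F (sel ps m) - d%:R^-1 * bexp ps F| <=
  K * (expR (- ((1 - kappa) * ln n%:R)) * rankin kappa d) *
    \prod_(p <- ps) (1 + (c + 1) * ((prime p)%:R * rankin kappa p)).
Proof.
move=> k0 k1 c0 n0; elim: ps => [|p ps IH] ups d F K d0 K0 cop hF.
  rewrite big_nil mulr1 /= /sel /=.
  have -> : \sum_(1 <= m < n.+1 | (d %| m)%N) F [::] = (n %/ d)%:R * F [::].
    by rewrite -count_multiples // mulr_suml; apply: eq_bigr => m _; rewrite mul1r.
  rewrite (mulrA _ _ (F [::])) -mulrBl normrM (mulrC K); apply: ler_pM => //.
    exact: divn_error_le.
  by have := hF [::]; rewrite expr0 mulr1.
move: ups; rewrite cons_uniq => /andP[pps ups]; rewrite big_cons.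
have cop' q : q \in ps -> prime q -> coprime d q.
  by move=> qs; apply: cop; rewrite inE qs orbT.
case: (boolP (prime p)) => pp; last first.
  rewrite mul0r mulr0 addr0 mul1r.
  have -> : \sum_(1 <= m < n.+1 | (d %| m)%N) F (sel (p :: ps) m) =
      \sum_(1 <= m < n.+1 | (d %| m)%N) F (sel ps m).
    by apply: eq_bigr => m _; rewrite sel_cons_composite.
  by rewrite /= /pw (negbTE pp) mul0r subr0 mul1r mul0r addr0; exact: IH.
have p0 : (0 < p)%N by exact: prime_gt0.
have cdp : coprime d p by apply: cop => //; exact: mem_head.
rewrite sum_sel_cons //.
pose F1 S := F (p :: S) - F S.
have e1 : bexp (p :: ps) F = bexp ps F + p%:R^-1 * bexp ps F1.
  have -> : bexp ps F1 = bexp ps (fun S => F (p :: S)) - bexp ps F.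
    rewrite -[- bexp ps F]mulN1r -bexpZ -bexpD; apply: eq_bexp => S _.
    by rewrite /F1 mulN1r.
  by rewrite /= /pw pp mul1r; move: (bexp ps _) (bexp ps _) => a b; ring.
have hF1 S : `|F1 S| <= K * (c + 1) * c ^+ size S.
  apply: le_trans (ler_normB _ _) _; apply: le_trans (lerD (hF _) (hF _)) _ => /=.
  by rewrite exprS; lra.
have Kc : 0 <= K * (c + 1) by rewrite mulr_ge0 // addr_ge0.
have cop1 q : q \in ps -> prime q -> coprime (d * p) q.
  move=> qs qp; rewrite coprimeMl cop' //= prime_coprime // dvdn_prime2 //.
  by apply: contra pps => /eqP ->.
have dp0 : (0 < d * p)%N by rewrite muln_gt0 d0.
have i1 := IH ups d F K d0 K0 cop' hF.
have i2 := IH ups (d * p)%N F1 _ dp0 Kc cop1 hF1.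
rewrite e1 !mulrDr mulrA -invfM -natrM.
rewrite (_ : forall a b c e : R, a + b - (c + e) = (a - c) + (b - e)); last by move=> *; ring.
apply: le_trans (ler_normD _ _) _; apply: le_trans (lerD i1 i2) _.
rewrite (rankinM _ d0 p0) mul1r; set P := \prod_(_ <- _) _.
by rewrite le_eqVlt; apply/orP; left; apply/eqP; ring.
Qed.

(** As c - 1 >= 0, every term of the expansion is nonnegative and the number of multiples of d is
    bounded by n / d. There is no error to control, so the primes may go up to n. *)
Lemma sel_count_mgf_le {R : realType} (c : R) (n : nat) (ps : seq nat) :
  1 <= c -> (0 < n)%N -> uniq ps -> forall d : nat, (0 < d)%N ->
  (forall p, p \in ps -> prime p -> coprime d p) ->
  n%:R^-1 * \sum_(1 <= m < n.+1 | (d %| m)%N) c ^+ size (sel ps m) <=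
  d%:R^-1 * \prod_(p <- ps) (1 + (c - 1) * pw p).
Proof.
move=> c1 n0; elim: ps => [|p ps IH] ups d d0 cop.
  rewrite big_nil mulr1 /sel /= expr0 count_multiples // mulrC ler_pdivrMr ?ltr0n // mulrC.
  by rewrite ler_pdivlMr ?ltr0n // -natrM ler_nat leq_trunc_div.
move: ups; rewrite cons_uniq => /andP[pps ups]; rewrite big_cons.
have cop' q : q \in ps -> prime q -> coprime d q.
  by move=> qs; apply: cop; rewrite inE qs orbT.
case: (boolP (prime p)) => pp; last first.
  have -> : \sum_(1 <= m < n.+1 | (d %| m)%N) c ^+ size (sel (p :: ps) m) =
      \sum_(1 <= m < n.+1 | (d %| m)%N) c ^+ size (sel ps m).
    by apply: eq_bigr => m _; rewrite sel_cons_composite.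
  by rewrite {1}/pw (negbTE pp) mul0r mulr0 addr0 mul1r IH.
have p0 : (0 < p)%N by exact: prime_gt0.
have cdp : coprime d p by apply: cop => //; exact: mem_head.
rewrite (sum_sel_cons _ _ (fun S => c ^+ size S)) //=.
have cop1 q : q \in ps -> prime q -> coprime (d * p) q.
  move=> qs qp; rewrite coprimeMl cop' //= prime_coprime // dvdn_prime2 //.
  by apply: contra pps => /eqP ->.
have dp0 : (0 < d * p)%N by rewrite muln_gt0 d0.
have i1 := IH ups d d0 cop'.
have i2 := IH ups (d * p)%N dp0 cop1.
have -> : \sum_(1 <= m < n.+1 | (d * p %| m)%N) (c ^+ (size (sel ps m)).+1 - c ^+ size (sel ps m))
   = (c - 1) * \sum_(1 <= m < n.+1 | (d * p %| m)%N) c ^+ size (sel ps m).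
  by rewrite mulr_sumr; apply: eq_bigr => m _; rewrite exprS mulrBl mul1r.
have c0 : 0 <= c - 1 by lra.
have i3 := ler_wpM2l c0 i2.
rewrite mulrDr mulrCA; apply: le_trans (lerD i1 i3) _.
rewrite /pw pp natrM invfM; set P := \prod_(_ <- _) _.
by rewrite le_eqVlt; apply/orP; left; apply/eqP; rewrite mul1r; ring.
Qed.

(** * Runs and the count of large gaps *)

Lemma runs_le_size {R : realType} (z : R) (S : seq nat) : (runs z S <= size S)%N.
Proof. by elim: S => //= p S IH; rewrite -add1n leq_add // leq_b1. Qed.

Lemma runs_cat_le {R : realType} (z : R) (S L : seq nat) :
  (runs z (S ++ L) <= runs z S + size L)%N.
Proof.
elim: S => [|p S IH] /=; first by rewrite add0n runs_le_size.
rewrite -addnA leq_add //; case: S {IH} => //= ; exact: leq_b1.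
Qed.

(** Appending a list can change the status of the last element of [S] only. *)
Lemma runs_cat_ge {R : realType} (z : R) (S L : seq nat) :
  (runs z S <= (runs z (S ++ L)).+1)%N.
Proof.
elim: S => [|p S IH] //=; case: S IH => [|q S] IH /=; first by rewrite addn0 ltnS.
by rewrite -addnS leq_add2l.
Qed.

(** Indexed to fit [omega_gap]: the zero-based positions i - 1 and i are the primes p_i and p_(i+1)
    there. *)
Lemma runs_gapE {R : realType} (z : R) (S : seq nat) :
  runs z S = ((0 < size S) + \sum_(0 <= i < size S)
    ((1 <= i) && (z < loglog (nth 0 S i) - loglog (nth 0 S i.-1))%R))%N.
Proof.
case: S => [|p S]; first by rewrite big_geq.
have shift (q : nat) (L : seq nat) : (\sum_(0 <= i < size (q :: L))
    ((1 <= i) && (z < loglog (nth 0 (q :: L) i) - loglog (nth 0 (q :: L) i.-1))%R) =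
    \sum_(0 <= i < size L) (z < loglog (nth 0 L i) - loglog (nth 0 (q :: L) i))%R)%N.
  by rewrite /= big_nat_recl.
rewrite shift; elim: S p => [|q S IH] p; first by rewrite big_geq.
rewrite -[runs z (p :: q :: S)]/(gap_after z p (q :: S) + runs z (q :: S))%N IH.
by rewrite [in RHS]big_nat_recl //= addnCA.
Qed.

Lemma omega_gapE {R : realType} (z : R) (m : nat) : (1 < m)%N ->
  runs z (primes m) = (omega_gap z m).+1.
Proof.
move=> m1; rewrite runs_gapE.
have -> : (0 < size (primes m))%N.
  by rewrite lt0n size_eq0 primes_eq0 -leqNgt.
rewrite add1n; congr _.+1; rewrite /omega_gap -sum1_card big_mkord.
by rewrite [RHS]big_mkcond /=; apply: eq_bigr => i _; rewrite inE; case: ifP.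
Qed.

Lemma sel_primes (n m : nat) : (0 < m <= n)%N -> sel (iota 2 n.-1) m = primes m.
Proof.
move=> /andP[m0 mn]; apply: (irr_sorted_eq ltn_trans ltnn).
- by apply: sorted_filter; [exact: ltn_trans | exact: iota_ltn_sorted].
- exact: sorted_primes.
move=> p; rewrite mem_filter mem_primes m0 /= mem_iota -andbA; case pp: (prime p) => //=.
case pm: (p %| m)%N => //=; have := dvdn_leq m0 pm; have := prime_gt1 pp.
by move=> h1 h2; apply/andP; split; lia.
Qed.

Lemma omega_gap_runs {R : realType} (z : R) (y n m : nat) : (1 < y)%N -> (y <= n)%N ->
  (0 < m <= n)%N ->
  `|(omega_gap z m)%:R - (runs z (sel (iota 2 y.-1) m))%:R| <=
  2 + (size (sel (iota y.+1 (n - y)) m))%:R :> R.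
Proof.
move=> y1 yn mn.
have e : primes m = sel (iota 2 y.-1) m ++ sel (iota y.+1 (n - y)) m.
  rewrite -(sel_primes mn) /sel -filter_cat; congr [seq p <- _ | _].
  have -> : (y.+1 = 2 + y.-1)%N by lia.
  by rewrite -iotaD; congr iota; lia.
have up := runs_cat_le z (sel (iota 2 y.-1) m) (sel (iota y.+1 (n - y)) m).
have lo := runs_cat_ge z (sel (iota 2 y.-1) m) (sel (iota y.+1 (n - y)) m).
rewrite -e in up lo.
have om : (omega_gap z m <= runs z (primes m) <= (omega_gap z m).+1)%N.
  case: (leqP m 1) => m1; last by rewrite omega_gapE // leqnn leqnSn.
  have -> : m = 1%N by lia.
  have -> : omega_gap z 1 = 0%N; last by [].
  by rewrite /omega_gap; apply: eq_card0 => i; case: i.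
move: up lo om; set a := omega_gap z m; set r := runs z _; set b := runs z _; set l := size _.
move=> up lo /andP[i1 i2].
have h1 : a%:R <= b%:R + l%:R :> R by rewrite -natrD ler_nat (leq_trans i1).
(* One unit is the last element, which always counts in [runs]; the other comes from
   [runs_cat_ge]. *)
have h2 : b%:R <= a%:R + 2 :> R by rewrite -natrD ler_nat addn2 (leq_trans lo).
have l0 : 0 <= l%:R :> R by [].
by rewrite ler_norml; apply/andP; split; lra.
Qed.

(** * The normalised count *)

(** exp z >= 1 + z + z^2 / 2, and this exceeds 2 z by (1 + (z - 1)^2) / 2. *)
Lemma gap_var_gt0 {R : realType} (z : R) : 0 <= z ->
  0 < (1 - 2 * z * expR (- z)) * expR (- z).
Proof.
move=> z0; rewrite mulr_gt0 ?expR_gt0 // subr_gt0 expRN ltr_pdivrMr ?expR_gt0 // mul1r.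
have := @exp_coeff_sum_le R z 3 z0; rewrite !big_nat_recr //= big_geq // add0r expr0 expr1 !divr1.
have : 0 <= (z - 1) ^+ 2 by exact: sqr_ge0.
rewrite (_ : (2`!)%:R = 2 :> R) //; lra.
Qed.

Lemma loglog_near {R : realType} (A : R) : \forall n \near \oo, A <= loglog n.
Proof.
exists (Num.truncn (expR (expR A))).+1 => // n /= hn.
have h : expR (expR A) < n%:R by apply: lt_le_trans (truncnS_gt _) _; rewrite ler_nat.
have h1 : expR A <= ln n%:R.
  by rewrite -[leLHS]expRK ler_ln ?posrE ?expR_gt0 ?(ltW h) // (lt_trans _ h) ?expR_gt0.
by rewrite -[leLHS]expRK /loglog ler_ln ?posrE ?expR_gt0 // (lt_le_trans _ h1) ?expR_gt0.
Qed.

(* The scale [(loglog n)^(1/4)] in which all error terms are measured. *)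
Definition qn {R : realType} (n : nat) : R := Num.sqrt (Num.sqrt (loglog n)).

Lemma qn_near {R : realType} (A : R) : \forall n \near \oo, A <= qn n.
Proof.
near=> n.
have : (`|A| ^+ 2) ^+ 2 <= loglog n by near: n; exact: loglog_near.
move=> h; apply: le_trans (ler_norm A) _.
have h2 := ler_wsqrtr h; rewrite sqrtr_sqr ger0_norm ?sqr_ge0 // in h2.
by have := ler_wsqrtr h2; rewrite sqrtr_sqr normr_id.
Unshelve. all: by end_near. Qed.

Lemma qn4 {R : realType} (n : nat) : 0 <= loglog n :> R -> qn n ^+ 4 = loglog n :> R.
Proof. by move=> T0; rewrite (exprM _ 2 2) /qn sqr_sqrtr ?sqrtr_ge0 // sqr_sqrtr. Qed.

Lemma cvg0_qn {R : realType} (x : nat -> R) (C : R) :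
  (\forall n \near \oo, `|x n| <= C / qn n) -> x n @[n --> \oo] --> (0 : R).
Proof.
move=> hx; apply/cvgrPdist_lt => e e0; near=> n.
rewrite sub0r normrN.
have q1 : `|C| / e + 1 <= qn n by near: n; exact: qn_near.
have Ce : 0 <= `|C| / e by rewrite divr_ge0 // ltW.
have q0 : 0 < qn n :> R by lra.
apply: (@le_lt_trans _ _ (C / qn n)); first by near: n.
rewrite ltr_pdivrMr // mulrC -ltr_pdivrMr //.
apply: (@le_lt_trans _ _ (`|C| / e)); last by lra.
by rewrite ler_wpM2r ?invr_ge0 ?(ltW e0) // ler_norm.
Unshelve. all: by end_near. Qed.

(* Chosen so that Rankin's saving [exp (- ln n / ln y)] beats the Euler product of
   [prod_rankin_le] at level [y = yn n]. *)
Definition cutoff_const {R : realType} : R := (expR 1 + 1) * expR 1 + 2.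

Definition yn {R : realType} (n : nat) : nat :=
  Num.truncn (expR (ln n%:R / (@cutoff_const R * loglog n))).

Lemma cutoff_const_ge2 {R : realType} : 2 <= @cutoff_const R.
Proof.
by rewrite /cutoff_const lerDr mulr_ge0 ?addr_ge0 ?expR_ge0.
Qed.

(** The third clause provides Rankin's saving. The fourth keeps the weight of the primes between y
    and n down to ln (loglog n) + O(1). *)
Definition cutoff_ok {R : realType} (n y : nat) : Prop :=
  [/\ (1 < y <= n)%N, 1 <= ln y%:R :> R,
     ln y%:R * (cutoff_const * loglog n) <= ln n%:R :> R &
     loglog n - ln (loglog n) - ln (2 * cutoff_const) <= loglog y :> R].

Lemma yn_near {R : realType} : \forall n \near \oo, @cutoff_ok R n (@yn R n).
Proof.
near=> n.
have : 4 * cutoff_const <= loglog n :> R by near: n; exact: loglog_near.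
set T : R := loglog n; set B : R := cutoff_const => T4.
have B2 : 2 <= B by exact: cutoff_const_ge2.
have T0 : 0 < T by lra.
have ln1 : 1 < ln n%:R :> R.
  by rewrite ltNge; apply/negP => /ln_le0 h; move: T0; rewrite /T /loglog; lra.
have n1 : (1 < n)%N.
  rewrite ltnNge; apply/negP => h; have := @ln_le0 R n%:R.
  by rewrite lern1 h => /(_ isT); lra.
have lnE : ln n%:R = expR T by rewrite /T /loglog lnK // posrE; lra.
pose E : R := ln n%:R / (B * T).
have BT0 : 0 < B * T by rewrite mulr_gt0 //; lra.
have BT1 : 1 <= B * T.
  by apply: (@le_trans _ _ (1 * 1)); [lra | apply: ler_pM; lra].
have E2 : 2 <= E.
  rewrite /E ler_pdivlMr // lnE; apply: le_trans (pow_fact_le_expR 2 (ltW T0)).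
  rewrite (_ : (2`!)%:R = 2 :> R) // ler_pdivlMr //.
  have : 4 * B * T <= T * T by rewrite ler_pM2r.
  by rewrite expr2; lra.
have /truncn_itv /andP[y1 y2] : 0 <= expR E by exact: expR_ge0.
rewrite -/(yn n) in y1 y2.
have ybig : (2 < @yn R n)%N.
  rewrite -ltnS -(ltr_nat R); apply: le_lt_trans y2.
  by apply: le_trans (expR_ge1Dx E); lra.
have y0 : 0 < (@yn R n)%:R :> R by rewrite ltr0n; exact: (@leq_trans 3).
have lyE : ln (@yn R n)%:R <= E by rewrite -[leRHS]expRK ler_ln ?posrE ?expR_gt0.
have lyE' : E - 1 <= ln (@yn R n)%:R.
  have h : E <= ln (@yn R n).+1%:R.
    by rewrite -[leLHS]expRK ler_ln ?posrE ?expR_gt0 ?ltr0n // ltW.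
  have y00 : (0 < @yn R n)%N by exact: (@leq_trans 3).
  by have := @lnS_sub_le1 R _ y00; lra.
split.
- rewrite (ltnW ybig) -(ler_nat R); apply: le_trans y1 _.
  rewrite -[leRHS]lnK ?posrE ?ltr0n; last exact: ltnW.
  rewrite ler_expR /E ler_pdivrMr // ler_peMr //; lra.
- lra.
- by rewrite -ler_pdivlMr.
(* Rounding down to an integer costs at most 1 in ln y, and E - 1 >= E / 2 because E >= 2. *)
- have -> : T - ln T - ln (2 * B) = ln (E / 2).
    have TB0 : 0 < T * (2 * B) by rewrite mulr_gt0 //; lra.
    have -> : E / 2 = ln n%:R / (T * (2 * B)).
      by rewrite /E; field; rewrite !gt_eqF //; lra.
    rewrite ln_div ?posrE //; last by lra.
    rewrite (@lnM R T (2 * B)) ?posrE //; last by lra.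
    by rewrite -/(loglog n) -/T opprD addrA.
  by rewrite /loglog ler_ln ?posrE; lra.
Unshelve. all: by end_near. Qed.

Definition taun {R : realType} (n : nat) : R := \sum_(2 <= k < (@yn R n).+1) pw k.

Lemma ln_loglog_le {R : realType} (n : nat) : 1 <= qn n :> R -> 0 <= loglog n :> R ->
  ln (loglog n) <= 4 * qn n :> R.
Proof.
move=> q1 T0; rewrite -qn4 // lnXn; last by lra.
rewrite -[leLHS]mulr_natl ler_pM2l // ltW // ln_sublinear //; lra.
Qed.

Lemma taun_near {R : realType} : exists2 C : R, 0 <= C & \forall n \near \oo,
  `|taun n - loglog n| <= (4 + C) * qn n.
Proof.
have [C C0 mC] := @mertens_second R.
have l2 : 0 < ln 2%:R :> R by exact: ln_nat_gt0.
have Cl := divr_ge0 (ltW C0) (ltW l2).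
pose C3 : R := 1 + `|loglog 2| + C / ln 2%:R + `|ln (2 * cutoff_const)|.
have C30 : 0 <= C3 by rewrite /C3 !addr_ge0.
exists C3 => //; near=> n.
have [/andP[y1 yle] _ _ lo] : @cutoff_ok R n (@yn R n).
  by near: n; exact: yn_near.
have q1 : 1 <= qn n :> R by near: n; exact: qn_near.
have T0 : 0 <= loglog n :> R by near: n; exact: loglog_near.
have up := @loglog_le R _ _ y1 yle.
have lT := ln_loglog_le q1 T0.
have := mC 2%N _ isT y1; rewrite ler_norml => /andP[m1 m2].
have p20 : 0 <= pw 2 :> R by exact: pw_ge0.
have p21 : pw 2 <= 1 :> R by exact: pw_le1.
have e : taun n = pw 2 + \sum_(3 <= k < (@yn R n).+1) pw k :> R by rewrite /taun big_ltn.
have n2 := ler_norm (loglog 2 : R); have n3 := ler_norm (ln (2 * cutoff_const) : R).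
have n4 := ler_norm (- loglog 2 : R); rewrite normrN in n4.
have C3q : C3 <= C3 * qn n by rewrite ler_peMr.
have n5 := normr_ge0 (ln (2 * cutoff_const) : R).
have n6 := normr_ge0 (loglog 2 : R).
rewrite e ler_norml; apply/andP; split; rewrite /C3 in C3q *; lra.
Unshelve. all: by end_near. Qed.

Lemma large_primes_near {R : realType} : exists2 C : R, 0 <= C & \forall n \near \oo,
  \sum_((@yn R n).+1 <= k < n.+1) pw k <= (4 + C) * qn n :> R.
Proof.
have [C C0 mC] := @mertens_second R.
pose C3 : R := C + `|ln (2 * cutoff_const)|.
have C30 : 0 <= C3 by rewrite /C3 !addr_ge0 // ltW.
exists C3 => //; near=> n.
have [/andP[y1 yle] ly _ lo] : @cutoff_ok R n (@yn R n).
  by near: n; exact: yn_near.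
have q1 : 1 <= qn n :> R by near: n; exact: qn_near.
have T0 : 0 <= loglog n :> R by near: n; exact: loglog_near.
have lT := ln_loglog_le q1 T0.
have := mC _ _ y1 yle; rewrite ler_norml => /andP[_ m2].
have Cy : C / ln (@yn R n)%:R <= C by rewrite ler_pdivrMr ?ler_peMr ?(ltW C0) //; lra.
have n3 := ler_norm (ln (2 * cutoff_const) : R).
have C3q : C3 <= C3 * qn n by rewrite ler_peMr.
rewrite /C3 in C3q *; lra.
Unshelve. all: by end_near. Qed.

(** [qn n ^+ 2] is the square root of [loglog n]. *)
Definition sdev {R : realType} (z : R) (n : nat) : R :=
  Num.sqrt ((1 - 2 * z * expR (- z)) * expR (- z)) * qn n ^+ 2.

(** For p <= y, lowering the exponent from 1 to kappa costs only p^(1 / ln y) <= e, so each factor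
    is within a constant of the one with 1 / p. *)
Lemma prod_rankin_le {R : realType} (kappa c : R) (y : nat) : (1 < y)%N -> 1 <= ln y%:R :> R ->
  kappa = 1 - (ln y%:R)^-1 -> 0 <= c -> c <= expR 1 ->
  \prod_(p <- iota 2 y.-1) (1 + (c + 1) * ((prime p)%:R * rankin kappa p)) <=
  expR ((cutoff_const - 2) * \sum_(2 <= k < y.+1) pw k).
Proof.
move=> y1 ly1 ek c0 c1; rewrite mulr_sumr expR_sum /index_iota.
rewrite (_ : y.+1 - 2 = y.-1)%N; last by lia.
rewrite big_seq [leRHS]big_seq; apply: ler_prod => p; rewrite mem_iota => hp.
have p0 : (0 < p)%N by lia.
have r0 : 0 <= rankin kappa p by exact: expR_ge0.
have t0 : 0 <= (prime p)%:R * rankin kappa p by rewrite mulr_ge0.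
apply/andP; split; first by rewrite addr_ge0 // mulr_ge0 // addr_ge0.
apply: le_trans (expR_ge1Dx _) _; rewrite ler_expR.
have r1 : rankin kappa p <= expR 1 * p%:R^-1.
  have pp : p%:R = expR (ln p%:R) :> R by rewrite lnK // posrE ltr0n.
  rewrite /rankin [in leRHS]pp -expRN -expRD ler_expR ek.
  have lp : ln p%:R <= ln y%:R :> R by apply: ln_nat_le => //; lia.
  have : (ln y%:R)^-1 * ln p%:R <= 1 :> R by rewrite mulrC ler_pdivrMr ?mul1r //; lra.
  by lra.
rewrite /cutoff_const addrK -mulrA; apply: ler_pM => //.
- by rewrite addr_ge0.
- by rewrite lerD2r.
- by rewrite /pw mulrCA ler_wpM2l.
Qed.

(** With kappa = 1 - 1 / ln y, Rankin's saving is exp (- ln n / ln y). As the weight of the primes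
    up to y is close to loglog n, the exponent is about - 2 loglog n; this margin beats the centring
    factor exp (O((loglog n)^(1/2))) of [mgf_small]. *)
Lemma runs_mean_error {R : realType} (z eta : R) (n y : nat) : (0 < n)%N -> `|eta| <= 1 ->
  @cutoff_ok R n y ->
  `|n%:R^-1 * (\sum_(1 <= m < n.+1) expR eta ^+ runs z (sel (iota 2 y.-1) m)) -
     genf z (expR eta) y 2| <=
  expR (- (cutoff_const * loglog n) + (cutoff_const - 2) * \sum_(2 <= k < y.+1) pw k).
Proof.
move=> n0 e1 [/andP[y1 yle] ly1 hy _].
pose kappa : R := 1 - (ln y%:R)^-1.
have ly0 : 0 < ln y%:R :> R by lra.
have k1 : kappa <= 1 by rewrite gerBl invr_ge0 ltW.
have k0 : 0 <= kappa by rewrite subr_ge0 invf_le1.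
have c1 : 1 <= expR `|eta| by rewrite -expR0 ler_expR.
have c0 : 0 <= expR `|eta| by exact: expR_ge0.
have hF S : `|expR eta ^+ runs z S| <= 1 * expR `|eta| ^+ size S.
  rewrite mul1r ger0_norm ?exprn_ge0 ?expR_ge0 //.
  apply: (@le_trans _ _ (expR `|eta| ^+ runs z S)).
    by rewrite lerXn2r ?nnegrE ?expR_ge0 // ler_expR ler_norm.
  by rewrite ler_weXn2l // runs_le_size.
have cop p : p \in iota 2 y.-1 -> prime p -> coprime 1 p by rewrite coprime1n.
have := @sel_mean_bexp_dist R kappa _ n (iota 2 y.-1) k0 k1 c0 n0 (iota_uniq _ _) 1%N
  (fun S => expR eta ^+ runs z S) 1 isT ler01 cop hF.
have -> : \sum_(1 <= m < n.+1 | (1 %| m)%N) expR eta ^+ runs z (sel (iota 2 y.-1) m) =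
    \sum_(1 <= m < n.+1) expR eta ^+ runs z (sel (iota 2 y.-1) m).
  by apply: eq_bigl => m; rewrite dvd1n.
rewrite invr1 !mul1r.
rewrite (_ : bexp _ _ = genf z (expR eta) y 2); last first.
  by rewrite /genf; congr (bexp (iota _ _) _); lia.
move=> h; apply: le_trans h _; rewrite expRD; apply: ler_pM.
- by rewrite mulr_ge0 ?expR_ge0.
- apply: prodr_ge0 => p _; rewrite addr_ge0 // mulr_ge0 ?mulr_ge0 ?addr_ge0 ?expR_ge0 //.
- rewrite /rankin ln1 mulr0 oppr0 expR0 mulr1 ler_expR lerN2 /kappa subKr.
  by rewrite (mulrC _^-1) ler_pdivlMr // mulrC.
- by apply: prod_rankin_le => //; rewrite ler_expR.
Qed.

Lemma mgf_small {R : realType} (z xi : R) : 0 <= z ->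
  n%:R^-1 * (\sum_(1 <= m < n.+1) expR (xi / sdev z n *
     ((runs z (sel (iota 2 (@yn R n).-1) m))%:R - loglog n / expR z))) @[n --> \oo]
  --> expR (xi ^+ 2 / 2).
Proof.
move=> z0.
have [K K0 hK] := bexp_mgf z0; have [C3 C30 htau] := @taun_near R.
have v0 := gap_var_gt0 z0.
pose ep := expR (- z); pose v := (1 - 2 * z * ep) * ep; pose rv := Num.sqrt v.
have ep0 : 0 <= ep by exact: expR_ge0.
have ep1 : ep <= 1 by rewrite expR_le1 oppr_le0.
have rv0 : 0 < rv by rewrite sqrtr_gt0.
have rv2 : v = rv ^+ 2 by rewrite sqr_sqrtr // ltW.
pose w : R := `|xi| / rv; have w0 : 0 <= w by rewrite divr_ge0 // ltW.
have wE : w = `|xi| / rv by [].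
clearbody w.
pose D := 4 + C3; have D0 : 0 <= D by rewrite /D; lra.
pose eta n := xi / sdev z n.
pose s n := ep * eta n + v * eta n ^+ 2 / 2.
pose G n := genf z (expR (eta n)) (@yn R n) 2.
pose A n := n%:R^-1 * (\sum_(1 <= m < n.+1) expR (eta n) ^+ runs z (sel (iota 2 (@yn R n).-1) m)).
(* [x1] is the error of the centred exponent, [x2] the relative error of the model and [x3] the
   centred transfer error; each is O(1 / qn n). In [x1] the linear term of [s] cancels the centring
   and the quadratic one gives xi^2 / 2, up to replacing [taun n] by [loglog n]. *)
pose x1 n := s n * taun n - eta n * (loglog n * ep) - xi ^+ 2 / 2.
pose x2 n := G n * expR (- (s n * taun n)) - 1.
pose x3 n := expR (- (eta n * (loglog n * ep))) * (A n - G n).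
have etaN n : 0 < qn n :> R -> `|eta n| = w / qn n ^+ 2.
  move=> q0; rewrite /eta /sdev -/ep -/v -/rv normrM normfV (ger0_norm (_ : 0 <= rv * _)); last first.
    by rewrite mulr_ge0 ?sqr_ge0 // ltW.
  by rewrite wE invfM mulrA.
have c1 : x1 n @[n --> \oo] --> (0 : R).
  apply: (@cvg0_qn R _ (w * D + xi ^+ 2 * D)); near=> n.
  have q1 : 1 <= qn n :> R by near: n; exact: qn_near.
  have T0 : 0 <= loglog n :> R by near: n; exact: loglog_near.
  have tT : `|taun n - loglog n| <= D * qn n :> R by near: n.
  have q0 : 0 < qn n :> R by lra.
  have q0' : qn n != 0 :> R by rewrite gt_eqF.
  have -> : x1 n = ep * (eta n * (taun n - loglog n)) + xi ^+ 2 / 2 / qn n ^+ 4 * (taun n - loglog n).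
    rewrite /x1 /s rv2 /eta /sdev -/ep -/v -/rv -(qn4 T0).
    by field; rewrite q0' gt_eqF.
  apply: le_trans (ler_normD _ _) _; rewrite mulrDl; apply: lerD.
    apply: (@le_trans _ _ (1 * (w / qn n ^+ 2 * (D * qn n)))); last first.
      by rewrite le_eqVlt; apply/orP; left; apply/eqP; field.
    by apply: normM_le; [rewrite ger0_norm | apply: normM_le => //; rewrite etaN].
  apply: (@le_trans _ _ (xi ^+ 2 / qn n ^+ 2 * (D * qn n))); last first.
    by rewrite le_eqVlt; apply/orP; left; apply/eqP; field.
  have q4 : 0 < qn n ^+ 4 :> R by exact: exprn_gt0.
  apply: normM_le => //; rewrite ger0_norm; last by rewrite !divr_ge0 ?sqr_ge0 ?(ltW q4).
  rewrite -mulrA ler_wpM2l ?sqr_ge0 // -invfM lef_pV2 ?posrE ?mulr_gt0 ?exprn_gt0 //.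
  have q2 : 1 <= qn n ^+ 2 :> R by rewrite exprn_ege1.
  rewrite (exprM _ 2 2); nra.
have c2 : x2 n @[n --> \oo] --> (0 : R).
  pose C5 := K * (w ^+ 3 * (1 + D) + w).
  apply: (@cvg0_qn R _ C5); near=> n.
  have q1 : 1 <= qn n :> R by near: n; exact: qn_near.
  have qC : C5 <= qn n by near: n; exact: qn_near.
  have T0 : 0 <= loglog n :> R by near: n; exact: loglog_near.
  have tT : `|taun n - loglog n| <= D * qn n :> R by near: n.
  have [/andP[y1 _] _ _ _] : @cutoff_ok R n (@yn R n) by near: n; exact: yn_near.
  have q0 : 0 < qn n :> R by lra.
  have q0' : qn n != 0 :> R by rewrite gt_eqF.
  have bnd : K * (`|eta n| ^+ 3 * taun n + `|eta n|) <= C5 / qn n.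
    rewrite /C5 -mulrA ler_pM2l // mulrDl etaN //; apply: lerD; last first.
      rewrite ler_wpM2l // lef_pV2 ?posrE ?exprn_gt0 // expr2 ler_peMl //; lra.
    have t2 : taun n <= (1 + D) * qn n ^+ 4.
      have : qn n <= qn n ^+ 4 :> R by rewrite -[leLHS]expr1 ler_weXn2l.
      move=> /(ler_wpM2l D0) h; move: tT; rewrite -(qn4 T0) ler_norml => /andP[_ t2]; lra.
    apply: (@le_trans _ _ ((w / qn n ^+ 2) ^+ 3 * ((1 + D) * qn n ^+ 4))).
      by rewrite ler_wpM2l // exprn_ge0 // divr_ge0 // sqr_ge0.
    apply: (@le_trans _ _ (w ^+ 3 * (1 + D) / qn n ^+ 2)).
      by rewrite le_eqVlt; apply/orP; left; apply/eqP; field.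
    have D1 : 0 <= 1 + D by lra.
    rewrite ler_wpM2l ?mulr_ge0 ?exprn_ge0 //.
    rewrite lef_pV2 ?posrE ?exprn_gt0 // expr2 ler_peMl //; lra.
  apply: (le_trans _ bnd); apply: (hK _ (eta n) (s n) (taun n)) => //.
  by apply: le_trans bnd _; rewrite ler_pdivrMr // mul1r.
have c3 : x3 n @[n --> \oo] --> (0 : R).
  pose C6 : R := (cutoff_const - 2) * D.
  have C60 : 0 <= C6 by rewrite mulr_ge0 // subr_ge0 cutoff_const_ge2.
  apply: (@cvg0_qn R _ 1); near=> n.
  have q1 : 1 <= qn n :> R by near: n; exact: qn_near.
  have qC : C6 + w <= qn n by near: n; exact: qn_near.
  have T0 : 0 <= loglog n :> R by near: n; exact: loglog_near.
  have tT : `|taun n - loglog n| <= D * qn n :> R by near: n.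
  have ok : @cutoff_ok R n (@yn R n) by near: n; exact: yn_near.
  have [/andP[y1 yle] _ _ _] := ok.
  have n0 : (0 < n)%N by apply: leq_trans yle; exact: ltnW.
  have q0 : 0 < qn n :> R by lra.
  have q0' : qn n != 0 :> R by rewrite gt_eqF.
  have q2 : qn n <= qn n ^+ 2 :> R by rewrite expr2 ler_peMl //; lra.
  have eta1 : `|eta n| <= 1.
    rewrite etaN // ler_pdivrMr ?exprn_gt0 // mul1r; lra.
  have err := runs_mean_error z n0 eta1 ok; rewrite -/(G n) -/(A n) -/(taun n) in err.
  rewrite normrM ger0_norm ?expR_ge0 //.
  apply: le_trans (ler_wpM2l (expR_ge0 _) err) _; rewrite -expRD.
  apply: (@le_trans _ _ (expR (- qn n ^+ 4))); last first.
    rewrite expRN mul1r lef_pV2 ?posrE ?expR_gt0 //; apply: le_trans (expR_ge1Dx _).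
    have : qn n <= qn n ^+ 4 :> R by rewrite -[leLHS]expr1 ler_weXn2l.
    by lra.
  rewrite ler_expR.
  have m1 : - (eta n * (loglog n * ep)) <= w * qn n ^+ 2.
    apply: le_trans (ler_norm _) _; rewrite normrN.
    apply: (@le_trans _ _ (w / qn n ^+ 2 * (qn n ^+ 4 * 1))); last first.
      by rewrite le_eqVlt; apply/orP; left; apply/eqP; field.
    apply: normM_le; first by rewrite etaN.
    by rewrite (qn4 T0); apply: normM_le; rewrite ger0_norm.
  have m2 : (cutoff_const - 2) * taun n <= (cutoff_const - 2) * loglog n + C6 * qn n.
    rewrite /C6 -mulrA -mulrDr ler_wpM2l ?subr_ge0 ?cutoff_const_ge2 //.
    by move: tT; rewrite ler_norml => /andP[_ ?]; lra.
  have m3 : C6 * qn n <= C6 * qn n ^+ 2 by rewrite ler_wpM2l.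
  have m4 : (C6 + w) * qn n ^+ 2 <= qn n ^+ 4.
    rewrite (exprM _ 2 2) [leRHS]expr2 ler_wpM2r ?sqr_ge0 //; lra.
  have T4 := qn4 T0; lra.
have e : (fun n => n%:R^-1 * (\sum_(1 <= m < n.+1) expR (xi / sdev z n *
     ((runs z (sel (iota 2 (@yn R n).-1) m))%:R - loglog n / expR z)))) =
   (fun n => expR (x1 n + xi ^+ 2 / 2) * (1 + x2 n) + x3 n).
  apply/funext => n; rewrite -/(eta n).
  have -> : expR (x1 n + xi ^+ 2 / 2) * (1 + x2 n) + x3 n = expR (- (eta n * (loglog n * ep))) * A n.
    rewrite /x1 /x2 /x3 subrK (addrC 1) subrK expRD.
    move: (expRxMexpNx_1 (s n * taun n)).
    move: (expR (s n * taun n)) (expR (- (s n * taun n))) (expR (- (eta n * (loglog n * ep)))).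
    move: (G n) (A n) => g a' a b c h.
    by rewrite (_ : a * c * (g * b) = (a * b) * (c * g)); [rewrite h; ring | ring].
  rewrite /A [RHS]mulrCA [in RHS]mulr_sumr; congr (_ * _); apply: eq_bigr => m _.
  by rewrite -expRM_natr -expRD -expRN -/ep; congr expR; ring.
have : expR (x1 n + xi ^+ 2 / 2) * (1 + x2 n) + x3 n @[n --> \oo] -->
    expR (0 + xi ^+ 2 / 2) * (1 + 0) + 0.
  apply: cvgD => //; apply: cvgM; last by apply: cvgD => //; exact: cvg_cst.
  apply: (cvg_comp _ expR); last exact: continuous_expR.
  by apply: cvgD => //; exact: cvg_cst.
by rewrite e add0r !addr0 mulr1.
Unshelve. all: by end_near. Qed.

(** * Prime divisors beyond the cutoff *)

Lemma weighted_AMGM {R : realType} (d a b : R) : 0 < d -> a * b <= d * a ^+ 2 + d^-1 * b ^+ 2.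
Proof.
move=> d0; rewrite -subr_ge0.
have -> : d * a ^+ 2 + d^-1 * b ^+ 2 - a * b =
    d^-1 * ((d * a - b / 2) ^+ 2 + 3 / 4 * b ^+ 2) by field; rewrite gt_eqF.
apply: mulr_ge0; first by rewrite invr_ge0 ltW.
by apply: addr_ge0; [exact: sqr_ge0 | apply: mulr_ge0; [lra | exact: sqr_ge0]].
Qed.

Lemma expR_dist_le {R : realType} (x h l : R) : `|h| <= l ->
  `|expR (x + h) - expR x| <= expR x * (expR l - 1).
Proof.
move=> hl; rewrite expRD -{2}[expR x]mulr1 -mulrBr normrM ger0_norm ?expR_ge0 //.
rewrite ler_wpM2l ?expR_ge0 // ler_norml.
have h1 : expR h <= expR l by rewrite ler_expR; apply: le_trans (ler_norm _) hl.
have h2 : expR (- l) <= expR h.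
  by rewrite ler_expR; move: hl; rewrite ler_norml => /andP[].
have h3 : 2 <= expR l + expR (- l).
  rewrite expRN; have e0 := expR_gt0 l; rewrite -subr_ge0.
  have -> : expR l + (expR l)^-1 - 2 = (expR l - 1) ^+ 2 / expR l by field; rewrite gt_eqF.
  by rewrite divr_ge0 ?sqr_ge0 // ltW.
by apply/andP; split; lra.
Qed.

Lemma large_part_mgf {R : realType} (a : R) (n y : nat) : 0 <= a -> (0 < n)%N ->
  n%:R^-1 * (\sum_(1 <= m < n.+1) expR (a * (2 + (size (sel (iota y.+1 (n - y)) m))%:R)))
  <= expR (2 * a + (expR a - 1) * \sum_(y.+1 <= k < n.+1) pw k).
Proof.
move=> a0 n0.
have c1 : 1 <= expR a by rewrite -expR0 ler_expR.
have cop p : p \in iota y.+1 (n - y) -> prime p -> coprime 1 p by rewrite coprime1n.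
have := @sel_count_mgf_le R (expR a) n (iota y.+1 (n - y)) c1 n0 (iota_uniq _ _) 1%N isT cop.
have -> : \sum_(1 <= m < n.+1 | (1 %| m)%N) expR a ^+ size (sel (iota y.+1 (n - y)) m) =
    \sum_(1 <= m < n.+1) expR a ^+ size (sel (iota y.+1 (n - y)) m).
  by apply: eq_bigl => m; rewrite dvd1n.
rewrite invr1 mul1r => h.
have -> : n%:R^-1 * (\sum_(1 <= m < n.+1) expR (a * (2 + (size (sel (iota y.+1 (n - y)) m))%:R)))
  = expR (2 * a) * (n%:R^-1 * \sum_(1 <= m < n.+1) expR a ^+ size (sel (iota y.+1 (n - y)) m)).
  rewrite mulrCA; congr (_ * _); rewrite mulr_sumr; apply: eq_bigr => m _.
  by rewrite -expRM_natr -expRD; congr expR; ring.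
rewrite expRD ler_wpM2l ?expR_ge0 //; apply: le_trans h _.
rewrite mulr_sumr expR_sum /index_iota subSS.
apply: ler_prod => p _; apply/andP; split; last exact: expR_ge1Dx.
by rewrite addr_ge0 // mulr_ge0 ?pw_ge0 // subr_ge0.
Qed.

Definition zscore {R : realType} (z : R) (n m : nat) : R :=
  ((omega_gap z m)%:R - loglog n / expR z) / sdev z n.

(** The small and the large prime divisors of m are not independent, so the mean of a product is
    separated by a weighted inequality of means. The square of the first factor is the same
    exponential at 2 xi, and (exp l - 1)^2 <= exp (2 l) - 1 handles the second. *)
Lemma zscore_mgf_dist {R : realType} (z xi d : R) (n y : nat) : 0 < d ->
  (1 < y <= n)%N ->
  `|emean (zscore z) n (fun x => expR (xi * x)) -
    n%:R^-1 * (\sum_(1 <= m < n.+1) expR (xi / sdev z n *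
     ((runs z (sel (iota 2 y.-1) m))%:R - loglog n / expR z)))| <=
  d * (n%:R^-1 * (\sum_(1 <= m < n.+1) expR (2 * xi / sdev z n *
     ((runs z (sel (iota 2 y.-1) m))%:R - loglog n / expR z)))) +
  d^-1 * (expR (2 * (2 * `|xi / sdev z n|) + (expR (2 * `|xi / sdev z n|) - 1) *
     \sum_(y.+1 <= k < n.+1) pw k) - 1).
Proof.
move=> d0 /andP[y1 yle]; have n0 : (0 < n)%N by apply: leq_trans yle; exact: ltnW.
have n0' : 0 < n%:R :> R by rewrite ltr0n.
pose eta := xi / sdev z n.
pose X' m : R := (runs z (sel (iota 2 y.-1) m))%:R - loglog n / expR z.
pose l m : R := `|eta| * (2 + (size (sel (iota y.+1 (n - y)) m))%:R).
have pt m : (0 < m < n.+1)%N ->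
  `|expR (xi * zscore z n m) - expR (eta * X' m)| <=
  d * expR (2 * xi / sdev z n * X' m) + d^-1 * (expR (2 * l m) - 1).
  rewrite ltnS => mn.
  have hl : `|eta * ((omega_gap z m)%:R - (runs z (sel (iota 2 y.-1) m))%:R)| <= l m.
    by rewrite normrM ler_wpM2l // omega_gap_runs.
  have -> : xi * zscore z n m = eta * X' m + eta * ((omega_gap z m)%:R - (runs z (sel (iota 2 y.-1) m))%:R).
    by rewrite /zscore /X' /eta; ring.
  apply: le_trans (expR_dist_le _ hl) _.
  apply: le_trans (weighted_AMGM _ _ d0) _.
  have l0 : 0 <= l m by apply: le_trans (normr_ge0 _) hl.
  have e1 : expR (eta * X' m) ^+ 2 = expR (2 * xi / sdev z n * X' m).
    by rewrite -expRM_natl; congr expR; rewrite /eta; ring.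
  have e2 : expR (2 * l m) = expR (l m) ^+ 2 by rewrite -expRM_natl.
  have w1 : 1 <= expR (l m) by rewrite -expR0 ler_expR.
  rewrite e1 e2 lerD2l ler_wpM2l ?invr_ge0 ?(ltW d0) //.
  by rewrite sqrrB1 mulr2n; lra.
rewrite /emean -mulrBr -sumrB normrM ger0_norm ?invr_ge0 ?(ltW n0') //.
have a0 : 0 <= 2 * `|eta| by rewrite mulr_ge0.
have lp := @large_part_mgf R _ n y a0 n0.
apply: (@le_trans _ _ (n%:R^-1 * \sum_(1 <= m < n.+1)
   (d * expR (2 * xi / sdev z n * X' m) + d^-1 * (expR (2 * l m) - 1)))).
  rewrite ler_wpM2l ?invr_ge0 ?(ltW n0') //; apply: le_trans (ler_norm_sum _ _ _) _.
  by apply: ler_sum_nat => m; exact: pt.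
rewrite big_split /= -!mulr_sumr sumrB mulrDr !(mulrCA n%:R^-1) lerD2l.
rewrite ler_wpM2l ?invr_ge0 ?(ltW d0) // mulrBr lerB //.
  apply: le_trans lp; rewrite le_eqVlt; apply/orP; left; apply/eqP; congr (_ * _).
  by apply: eq_bigr => m _; rewrite /l mulrA.
by rewrite sumr_const_nat subSS subn0 -[X in _ * X]/(n%:R) mulVf // gt_eqF.
Qed.

Lemma zscore_mgf_cvg {R : realType} (z : R) : 0 <= z -> mgf_cvg (zscore z).
Proof.
move=> z0 xi; have [C8 C80 large] := @large_primes_near R.
have c1 := @mgf_small R z xi z0; have c2 := @mgf_small R z (2 * xi) z0.
pose rv := Num.sqrt ((1 - 2 * z * expR (- z)) * expR (- z)).
have rv0 : 0 < rv by rewrite sqrtr_gt0 gap_var_gt0.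
pose w : R := `|xi| / rv; have w0 : 0 <= w by rewrite divr_ge0 // ltW.
have wE : w = `|xi| / rv by [].
clearbody w.
pose D := 4 + C8; have D0 : 0 <= D by rewrite /D; lra.
pose b n := expR (2 * (2 * `|xi / sdev z n|) + (expR (2 * `|xi / sdev z n|) - 1) *
     \sum_((@yn R n).+1 <= k < n.+1) pw k) - 1.
pose C9 := 4 * w + 2 * w * expR 2 * D.
have C90 : 0 <= C9 by rewrite addr_ge0 ?mulr_ge0 ?expR_ge0.
have cb : b n @[n --> \oo] --> (0 : R).
  apply: (@cvg0_qn R _ (C9 * expR C9)); near=> n.
  have q1 : 1 <= qn n :> R by near: n; exact: qn_near.
  have qw : w <= qn n :> R by near: n; exact: qn_near.
  have lg : \sum_((@yn R n).+1 <= k < n.+1) pw k <= D * qn n by near: n.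
  have q0 : 0 < qn n :> R by lra.
  have q0' : qn n != 0 :> R by rewrite gt_eqF.
  have q2 : qn n <= qn n ^+ 2 :> R by rewrite expr2 ler_peMl //; lra.
  have etaN : `|xi / sdev z n| = w / qn n ^+ 2.
    rewrite /sdev -/rv normrM normfV (ger0_norm (_ : 0 <= rv * _)); last first.
      by rewrite mulr_ge0 ?sqr_ge0 // ltW.
    by rewrite wE invfM mulrA.
  have eta1 : w / qn n ^+ 2 <= 1 by rewrite ler_pdivrMr ?exprn_gt0 // mul1r; lra.
  have eta0 : 0 <= w / qn n ^+ 2 by rewrite divr_ge0 // sqr_ge0.
  rewrite /b; set x := 2 * (2 * `|xi / sdev z n|) + _.
  have sl : 0 <= expR (2 * (w / qn n ^+ 2)) - 1.
    by rewrite subr_ge0 -expR0 ler_expR mulr_ge0.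
  have s0 : 0 <= \sum_((@yn R n).+1 <= k < n.+1) pw k :> R by rewrite sumr_ge0 // => k _; exact: pw_ge0.
  have x0 : 0 <= x.
    by rewrite /x etaN; apply: addr_ge0; [do 2 apply: mulr_ge0 => // | exact: mulr_ge0].
  have xC : x <= C9 / qn n.
    rewrite /x etaN /C9 (mulrDl (4 * w)); apply: lerD.
      rewrite mulrA (_ : 2 * 2 = 4 :> R); last by ring.
      by rewrite mulrA ler_wpM2l ?mulr_ge0 // lef_pV2 ?posrE ?exprn_gt0.
    apply: (@le_trans _ _ (2 * (w / qn n ^+ 2) * expR 2 * (D * qn n))); last first.
      by rewrite le_eqVlt; apply/orP; left; apply/eqP; field.
    apply: ler_pM => //; apply: le_trans (ler_norm _) _; apply: le_trans (expR_bound1 _) _.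
    have t0 : 0 <= 2 * (w / qn n ^+ 2) by apply: mulr_ge0.
    rewrite (ger0_norm t0) ler_wpM2l // ler_expR; lra.
  have xC' : x <= C9 by apply: le_trans xC _; rewrite ler_pdivrMr // ler_peMr.
  have := expR_bound1 x; rewrite (ger0_norm x0) => h; apply: le_trans h _.
  by rewrite mulrAC; apply: ler_pM => //; rewrite ?expR_ge0 ?ler_expR.
apply/cvgrPdist_lt => e e0.
pose B := expR ((2 * xi) ^+ 2 / 2) + 1.
have B0 : 0 < B by rewrite ltr_pwDr ?expR_ge0.
(* [d] is fixed first, so that the term at 2 xi is at most e / 4; then n is taken large enough for
   [b n] to absorb the factor 1 / d. *)
pose d := e / (4 * B); have d0 : 0 < d by rewrite divr_gt0 // mulr_gt0.
have dB : d * B = e / 4 by rewrite /d; field; rewrite gt_eqF.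
have e4 : 0 < e / 4 by rewrite divr_gt0.
have de : 0 < d * (e / 4) by rewrite mulr_gt0.
near=> n.
set a1 := n%:R^-1 * (\sum_(1 <= m < n.+1) expR (xi / sdev z n *
     ((runs z (sel (iota 2 (@yn R n).-1) m))%:R - loglog n / expR z))).
set a2 := n%:R^-1 * (\sum_(1 <= m < n.+1) expR (2 * xi / sdev z n *
     ((runs z (sel (iota 2 (@yn R n).-1) m))%:R - loglog n / expR z))).
have h1 : `|expR (xi ^+ 2 / 2) - a1| < e / 4.
  by rewrite /a1; near: n; move/cvgrPdist_lt : c1; apply.
have h2 : `|expR ((2 * xi) ^+ 2 / 2) - a2| < 1.
  by rewrite /a2; near: n; move/cvgrPdist_lt : c2; apply.
have h3 : `|0 - b n| < d * (e / 4).
  by near: n; move/cvgrPdist_lt : cb; apply.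
have [yok _ _ _] : @cutoff_ok R n (@yn R n) by near: n; exact: yn_near.
have h4 := zscore_mgf_dist z xi d0 yok; rewrite -/a1 -/a2 -/(b n) in h4.
have h5 : d * a2 <= e / 4.
  rewrite -dB ler_wpM2l ?(ltW d0) // /B; move: h2; rewrite ltr_norml => /andP[? ?]; lra.
have h6 : d^-1 * b n <= e / 4.
  rewrite ler_pdivrMl //; apply: ltW; apply: le_lt_trans h3.
  by rewrite sub0r normrN ler_norm.
rewrite -[_ - _](subrKA a1); apply: le_lt_trans (ler_normD _ _) _.
rewrite (distrC a1); apply: le_lt_trans (lerD (lexx _) h4) _; lra.
Unshelve. all: by end_near. Qed.

(** * Real powers and the conclusion *)

Lemma continuous_pos_powR {R : realType} (r : R) : 0 < r ->
  continuous (fun x : R => Num.max x 0 `^ r).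
Proof.
move=> r0 x; case: (ltrgtP x 0) => x0.
- have h : \forall y \near x, Num.max y 0 `^ r = 0.
    near=> y; have y0 : y < 0 by near: y; exact: lt_nbhsl.
    by rewrite max_r ?(ltW y0) // powR0 // gt_eqF.
  rewrite /continuous_at (nbhs_singleton h); apply: cvg_near_cst; exact: h.
- have h : \forall y \near x, expR (r * ln y) = Num.max y 0 `^ r.
    near=> y; have y0 : 0 < y by near: y; exact: lt_nbhsr.
    by rewrite max_l ?(ltW y0) // /powR gt_eqF.
  rewrite /continuous_at -(nbhs_singleton h); apply: cvg_trans.
    by apply: near_eq_cvg; exact: h.
  apply: (cvg_comp _ expR); last exact: continuous_expR.
  by apply: cvgM; [exact: cvg_cst | exact: continuous_ln].
- rewrite x0 /continuous_at maxxx powR0 ?gt_eqF //; apply/cvgrPdist_lt => e e0; near=> y.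
  have ye : `|0 - y| < e `^ r^-1 by near: y; exists (e `^ r^-1) => //=; rewrite powR_gt0.
  rewrite sub0r normrN ger0_norm ?powR_ge0 //.
  have -> : e = (e `^ r^-1) `^ r by rewrite -powRrM mulVf ?gt_eqF // powRr1 // ltW.
  apply: gt0_ltr_powR => //; rewrite ?nnegrE ?le_max ?lexx ?orbT ?powR_ge0 //.
  rewrite gt_max powR_gt0 // andbT; apply: le_lt_trans ye.
  by rewrite sub0r normrN ler_norm.
Unshelve. all: by end_near. Qed.

Lemma powR_norm_le {R : realType} (r : R) : 0 <= r ->
  exists2 C : R, 0 <= C & forall x : R, `|x| `^ r <= C * expR (1 * `|x|).
Proof.
move=> r0; pose k := (Num.truncn r).+1.
exists (k`!%:R + 1); first by rewrite addr_ge0.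
move=> x; rewrite mul1r mulrDl mul1r.
have e1 : 1 <= expR `|x| by rewrite -expR0 ler_expR.
have f0 : 0 <= k`!%:R * expR `|x| by rewrite mulr_ge0 ?expR_ge0.
case: (leP 1 `|x|) => x1; last first.
  apply: (@le_trans _ _ 1); last by lra.
  rewrite -[leRHS](_ : 1 `^ r = 1); last by rewrite powR1.
  apply: ge0_ler_powR; rewrite ?nnegrE // ltW //.
apply: (@le_trans _ _ (`|x| `^ k%:R)).
  by apply: ler_powR => //; apply: ltW; exact: truncnS_gt.
rewrite powR_mulrn //; have := pow_fact_le_expR k (normr_ge0 x).
rewrite ler_pdivrMr ?ltr0n ?fact_gt0 // mulrC; lra.
Qed.

(** For r > 0 the power vanishes at 0 and the two sides fit together. For r = 0 it is the constant
    1, also at 0, and continuity forces a = b. *)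
Lemma mcv_rpow_side {R : realType} (Z : nat -> nat -> R) (r a b : R) : mgf_cvg Z -> 0 <= r ->
  (r = 0 -> a = b) -> mcv Z (fun x => `|x| `^ r * (if x < 0 then a else b)).
Proof.
move=> mgf r0 hab; apply: mcv_continuous => //; last first.
  have [C C0 hC] := powR_norm_le r0.
  exists (C * (`|a| + `|b|)), 1; split; rewrite ?mulr_ge0 ?addr_ge0 // => x.
  rewrite normrM (ger0_norm (powR_ge0 _ _)) mulrAC; apply: ler_pM => //; rewrite ?powR_ge0 //.
  by case: ifP => _; rewrite ?lerDl ?lerDr.
have [req|rn0] := eqVneq r 0.
  rewrite req.
  have -> : (fun x : R => `|x| `^ 0 * (if x < 0 then a else b)) = (fun=> b).
    apply/funext => x; rewrite powRr0 mul1r; case: ifP => // _.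
    by rewrite hab.
  by move=> x; exact: cvg_cst.
have rp : 0 < r by rewrite lt_neqAle eq_sym rn0.
have -> : (fun x : R => `|x| `^ r * (if x < 0 then a else b)) =
   (fun x => b * Num.max x 0 `^ r + a * Num.max (- x) 0 `^ r).
  apply/funext => x; case: ltP => x0.
    by rewrite ltr0_norm // max_l ?oppr_ge0 ?(ltW x0) // powR0 // mulr0 add0r mulrC.
  by rewrite ger0_norm // max_r ?oppr_le0 // powR0 // mulr0 addr0 mulrC.
move=> x; apply: cvgD; apply: cvgM; try exact: cvg_cst; first exact: continuous_pos_powR.
apply: (cvg_comp (fun y : R => - y) (fun y : R => Num.max y 0 `^ r)); last exact: continuous_pos_powR.
by apply: cvgN; exact: cvg_id.
Qed.

Lemma Re_rpowC {R : realType} (x r : R) :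
  complex.Re (rpowC x r) = `|x| `^ r * (if x < 0 then cos (r * pi) else 1).
Proof.
by rewrite /rpowC /= mul0r subr0; case: ifP => // _; rewrite cos0.
Qed.

Lemma Im_rpowC {R : realType} (x r : R) :
  complex.Im (rpowC x r) = `|x| `^ r * (if x < 0 then sin (r * pi) else 0).
Proof.
by rewrite /rpowC /= mul0r addr0; case: ifP => // _; rewrite sin0.
Qed.

Lemma rpowCM {R : realType} (s x r : R) : 0 < s -> rpowC (s * x) r = (s `^ r)%:C * rpowC x r.
Proof.
move=> s0; rewrite /rpowC pmulr_rlt0 // normrM (gtr0_norm s0) powRM ?(ltW s0) //.
by rewrite rmorphM mulrA.
Qed.

Lemma sdevE {R : realType} (z r : R) (n : nat) : 0 <= z -> 0 <= loglog n :> R ->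
  sdev z n `^ r = ((1 - 2 * z * expR (- z)) * expR (- z) * loglog n) `^ (r / 2).
Proof.
move=> z0 T0; have v0 := ltW (gap_var_gt0 z0).
have -> : sdev z n = ((1 - 2 * z * expR (- z)) * expR (- z) * loglog n) `^ (2^-1).
  rewrite powR12_sqrt; last exact: mulr_ge0.
  by rewrite sqrtrM // /sdev /qn sqr_sqrtr ?sqrtr_ge0.
by rewrite -powRrM (mulrC 2^-1).
Qed.

Theorem theorem1p1 (R : realType) (z r : R) (hz : 0 <= z) (hr : 0 <= r) :
  exists2 eps : nat -> R[i],
    Normc.normc (eps n) @[n --> \oo] --> (0 : R) &
    \forall n \near \oo,
      n%:R^-1 * \sum_(1 <= m < n.+1)
                  rpowC ((omega_gap z m)%:R - loglog n / expR z) r =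
      (normal_moment r + eps n) *
      (((1 - 2 * z * expR (- z)) * expR (- z) * loglog n) `^ (r / 2))%:C.
Proof.
have mgf := zscore_mgf_cvg hz.
pose f1 (x : R) : R := `|x| `^ r * (if x < 0 then cos (r * pi) else 1).
pose f2 (x : R) : R := `|x| `^ r * (if x < 0 then sin (r * pi) else 0).
have [_ _ c1] : mcv (zscore z) f1.
  by apply: mcv_rpow_side => // ->; rewrite mul0r cos0.
have [_ _ c2] : mcv (zscore z) f2.
  by apply: mcv_rpow_side => // ->; rewrite mul0r sin0.
have nm : normal_moment r = gexp f1 +i* gexp f2.
  rewrite /normal_moment /gexp /Rintegral !unlock.
  by congr (fine _ +i* fine _); apply: eq_integral => x _; rewrite ?Re_rpowC ?Im_rpowC.
pose d1 n := emean (zscore z) n f1 - gexp f1.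
pose d2 n := emean (zscore z) n f2 - gexp f2.
(* An error added to the moment still makes sense when the moment is zero, as for odd integers r. *)
exists (fun n => d1 n +i* d2 n).
  have h1 : d1 n @[n --> \oo] --> (0 : R).
    by rewrite -[X in _ --> X](subrr (gexp f1)); apply: cvgB => //; exact: cvg_cst.
  have h2 : d2 n @[n --> \oo] --> (0 : R).
    by rewrite -[X in _ --> X](subrr (gexp f2)); apply: cvgB => //; exact: cvg_cst.
  apply: (@squeeze_cvgr _ _ _ _ (fun=> 0) (fun n => `|d1 n| + `|d2 n|)).
  - near=> n; rewrite /Normc.normc sqrtr_ge0 /= -[leRHS]ger0_norm ?addr_ge0 //.
    rewrite -[leRHS]sqrtr_sqr; apply: ler_wsqrtr; move: (d1 n) (d2 n) => x y.
    by rewrite sqrrD !real_normK ?num_real // addrAC lerDl mulrn_wge0 // mulr_ge0.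
  - exact: cvg_cst.
  - rewrite -[X in _ --> X](addr0 0); apply: cvgD.
      by rewrite -[X in _ --> X](normr0 R); exact: cvg_norm.
    by rewrite -[X in _ --> X](normr0 R); exact: cvg_norm.
near=> n.
have T1 : 1 <= loglog n :> R by near: n; exact: loglog_near.
have q1 : 1 <= qn n :> R by near: n; exact: qn_near.
have T0 : 0 <= loglog n :> R by lra.
have s0 : 0 < sdev z n.
  by rewrite mulr_gt0 ?sqrtr_gt0 ?gap_var_gt0 // exprn_gt0 //; lra.
have -> : normal_moment r + (d1 n +i* d2 n) =
    n%:R^-1 * \sum_(1 <= m < n.+1) rpowC (zscore z n m) r.
  rewrite nm.
  have -> : (gexp f1 +i* gexp f2) + (d1 n +i* d2 n) =
      emean (zscore z) n f1 +i* emean (zscore z) n f2.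
    by apply/eqP; rewrite eq_complex /= /d1 /d2 !(addrC (gexp _)) !subrK !eqxx.
  have -> : n%:R^-1 = (n%:R^-1)%:C :> R[i].
    by rewrite -[X in _ = X]/(real_complex R _) fmorphV rmorph_nat.
  have sumE : \sum_(1 <= m < n.+1) rpowC (zscore z n m) r =
      (\sum_(1 <= m < n.+1) f1 (zscore z n m)) +i* (\sum_(1 <= m < n.+1) f2 (zscore z n m)).
    elim/big_rec3: _ => // m a b c _ ->.
    have -> : rpowC (zscore z n m) r = f1 (zscore z n m) +i* f2 (zscore z n m).
      by rewrite /f1 /f2 -Re_rpowC -Im_rpowC; case: (rpowC _ _).
    by [].
  rewrite sumE; apply/eqP; rewrite eq_complex /= /emean !mul0r subr0 addr0.
  by rewrite !eqxx.
rewrite -sdevE // -mulrA; congr (_ * _); rewrite mulr_suml; apply: eq_bigr => m _.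
by rewrite [RHS]mulrC -rpowCM //; congr rpowC; rewrite /zscore mulrCA mulfV ?gt_eqF // mulr1.
Unshelve. all: by end_near. Qed.
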